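(* Let $W=(W_t)_{t\in[0,1]}$ be a one-dimensional standard Brownian motion and let $\mu\colon\mathbb{R}\to\mathbb{R}$. Assume that there exist $k\in\mathbb{N}$ and $-\infty=\xi_0<\xi_1<\dots<\xi_k<\xi_{k+1}=\infty$ such that $\mu$ is Lipschitz continuous on $(\xi_{i-1},\xi_i)$ for every $i\in\{1,\dots,k+1\}$ and such that $\mu(\xi_i+)\ne\mu(\xi_i-)$ for some $i\in\{1,\dots,k\}$. Assume further that $\mu$ is increasing or decreasing. Then for every $\varepsilon\in(0,\infty)$ there exists $c\in(0,\infty)$ such that for all $n\in\mathbb{N}$, $$\inf_{\substack{t_1,\dots,t_n\in[0,1]\\ g\colon\mathbb{R}^n\to\mathbb{R}\ \text{measurable}}}\mathbb{E}\Bigl[\Bigl|\int_0^1\mu(W_s)\,ds-g(W_{t_1},\dots,W_{t_n})\Bigr|^p\Bigr]^{1/p}\ \ge\ \begin{cases}\dfrac{c}{n^{3/4}}, & \text{if } p=2,\\[2mm] \dfrac{c}{n^{3/4+\varepsilon}}, & \text{if } p=1.\end{cases}$$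
   Context: ''Increasing'' and ''decreasing'' are meant in the weak sense. $\mu(\xi_i-)=\lim_{x\uparrow\xi_i}\mu(x)$ and $\mu(\xi_i+)=\lim_{x\downarrow\xi_i}\mu(x)$; these limits exist in $\mathbb{R}$ by the Lipschitz continuity of $\mu$ on each interval $(\xi_{i-1},\xi_i)$. *)

(* Defs.v *)
From HB Require Import structures.
From mathcomp Require Import all_boot all_order all_algebra.
From mathcomp Require Import all_classical all_reals all_analysis.

Set Implicit Arguments.
Unset Strict Implicit.
Unset Printing Implicit Defensive.

Import Order.TTheory GRing.Theory Num.Theory.
Import numFieldNormedType.Exports.

Local Open Scope classical_set_scope.
Local Open Scope ring_scope.

Definition mutually_independent (d : measure_display) (T : measurableType d)
    (R : realType) (P : probability T R) (I : finType) (X : I -> T -> R) : Prop :=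
  forall (J : {set I}) (B : I -> set R),
    (forall i, i \in J -> measurable (B i)) ->
    P (\bigcap_(i in [set` J]) (X i @^-1` B i)) =
    (\prod_(i in J) P (X i @^-1` B i))%E.

(* The time set is [0, 1]; the values of [W] at other times are unconstrained
   and never used. *)
Record standard_brownian_motion (d : measure_display) (T : measurableType d)
    (R : realType) (P : probability T R) (W : R -> {RV P >-> R}) : Prop :=
  StandardBrownianMotion {
    bm_start : {ae P, forall w, W 0 w = 0};
    (* [normal_prob] takes the standard deviation, so W_t - W_s ~ N(0, t - s) *)
    bm_increments_normal : forall s t : R, 0 <= s -> s < t -> t <= 1 ->
      forall B : set R, measurable B ->
      pushforward P (W t \- W s) B = normal_prob 0 (Num.sqrt (t - s)) B;
    bm_increments_independent : forall (m : nat) (t : nat -> R),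
      (forall i, (i <= m)%N -> 0 <= t i <= 1) ->
      (forall i, (i < m)%N -> t i <= t i.+1) ->
      mutually_independent P (fun i : 'I_m => W (t i.+1) \- W (t i));
    bm_continuous :
      {ae P, forall w, {within `[0, 1], continuous (fun t : R => W t w)}}
  }.

(* The breakpoints live in \bar R, with xi 0 = -oo and xi k.+1 = +oo; strict
   monotonicity makes xi 1, ..., xi k finite. *)
Definition piecewise_lipschitz (R : realType) (mu : R -> R) (k : nat)
    (xi : nat -> \bar R) : Prop :=
  [/\ xi 0%N = -oo%E, xi k.+1 = +oo%E,
      forall i, (i <= k)%N -> (xi i < xi i.+1)%E &
      forall i, (1 <= i <= k.+1)%N ->
        [lipschitz mu x | x in [set x : R | (xi i.-1 < x%:E < xi i)%E]]].

Definition jump_at (R : realType) (mu : R -> R) (a : R) : Prop :=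
  lim (mu x @[x --> a^'+]) <> lim (mu x @[x --> a^'-]).

Definition occupation_integral (d : measure_display) (T : measurableType d)
    (R : realType) (P : probability T R) (W : R -> {RV P >-> R})
    (mu : R -> R) (w : T) : R :=
  \int[@lebesgue_measure R]_(s in `[0, 1]) mu (W s w).

(* The infimum is taken in \bar R, since the p-th moment of the error may be
   infinite for some g. *)
Definition minimal_error (d : measure_display) (T : measurableType d)
    (R : realType) (P : probability T R) (W : R -> {RV P >-> R})
    (mu : R -> R) (p : R) (n : nat) : \bar R :=
  ereal_inf [set e : \bar R |
    exists (t : n.-tuple R) (g : n.-tuple R -> R),
      [/\ forall i : 'I_n, 0 <= tnth t i <= 1,
          measurable_fun [set: n.-tuple R] g &
          e = ('E_P[(fun w => `|occupation_integral W mu w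
                 - g [tuple W (tnth t i) w | i < n]| `^ p)%R] `^ p^-1)%E]].

(* Main.v *)
From HB Require Import structures.
From mathcomp Require Import all_boot all_order all_algebra.
From mathcomp Require Import all_classical all_reals all_analysis.
From mathcomp Require Import measurable_realfun.
From mathcomp Require Import ring lra zify.
Require Import Defs.
Import Order.TTheory GRing.Theory Num.Theory.
Import numFieldNormedType.Exports.

Set Implicit Arguments.
Unset Strict Implicit.
Unset Printing Implicit Defensive.

Local Open Scope classical_set_scope.
Local Open Scope ring_scope.

(* It suffices to bound the L1 error from below by c n^(-3/4), the L2 error being
   larger.  Cut [0, 1] into 4n blocks; at least n of the blocks in [1/2, 1] contain
   no observation time in their interior.  Cut every block into a fixed number of
   cells, and exchange the increments of W over the first and the last cell of an
   arbitrary set of such free blocks: this changes neither the law of the path nor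
   the observed values, so the error of g is at least of the order of the oscillation
   of the integral under these exchanges.  By Khintchine's inequality the latter is of
   the order of E (sum of c_j^2)^(1/2), where c_j is the change of the integral over
   block j.  If W is within (4n)^(-1/2) of a jump of mu at the start of block j, which
   has a probability of the order n^(-1/2), then c_j is of the order 1/n with a
   conditional probability bounded below: inside the block the path is shifted by a
   constant, so by monotonicity of mu all contributions have the same sign, and the
   first and last cells, where this fails, contribute less if the cells are short
   enough.  As the number of blocks started near the jump has second moment O(n), it
   follows that E (sum of c_j^2)^(1/2) >= c n^(-1) n^(1/4). *)

(** * Regularity of monotone piecewise Lipschitz functions *)

(** Equality in law is available at finitely many times, while the error contains an integral over
    all times. The transfer goes through Riemann sums, whose L1 error is bounded uniformly over all
    processes with the finite-dimensional laws of W, whatever g is. A block of length dl has N0^2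
    cells, so an increment over one cell has standard deviation sqrt(dl) / N0. That a shift of this
    size carries the path across the jump costs a factor 1/N0 in probability, whereas the two outer
    cells occupy only a fraction 2/N0^2 of the block: a large N0, depending on mu alone, makes the
    gain exceed the loss. Times in [1/2, 1] keep the density of W near the jump between positive
    constants. A first moment is bounded below through a quartic minorant of |x|, that is, through
    second and fourth moments. This is done twice, for the signs and for (sum of c_j^2)^(1/2); it
    loses only constants, so the exponent 3/4 is obtained already for p = 1. *)

Lemma monotone_jump_gap (R : realType) (mu : R -> R) (a : R) :
  nondecreasing_fun mu -> jump_at mu a ->
  exists2 J : R, 0 < J & forall x y, x < a -> a < y -> J <= mu y - mu x.
Proof.
move=> ndmu jmp; apply: contrapT => noJ; apply: jmp.
have small e : 0 < e -> exists x y, [/\ x < a, a < y & mu y - mu x < e].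
  move=> e0; apply: contrapT => H; apply: noJ; exists e => // x y xa ay.
  by rewrite leNgt; apply/negP => He; apply: H; exists x, y.
(* Without a gap, monotonicity squeezes values on both sides of [a] arbitrarily close to [mu a], so
   both one-sided limits equal [mu a]. *)
transitivity (mu a).
  apply: cvg_lim => //; apply/cvgrPdist_le => e e0.
  have [x [y [xa ay xye]]] := small _ e0; near=> z.
  have az : a <= z by apply: ltW; near: z; exact: nbhs_right_gt.
  have zy : z <= y by apply: ltW; near: z; exact: nbhs_right_lt.
  have h1 := ndmu _ _ az; have h2 := ndmu _ _ zy; have h3 := ndmu _ _ (ltW xa).
  by rewrite ler_norml; apply/andP; split; lra.
apply/esym/cvg_lim => //; apply/cvgrPdist_le => e e0.
have [x [y [xa ay xye]]] := small _ e0; near=> z.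
have az : z <= a by apply: ltW; near: z; exact: nbhs_left_lt.
have zy : x <= z by apply: ltW; near: z; exact: nbhs_left_gt.
have h1 := ndmu _ _ az; have h2 := ndmu _ _ zy; have h3 := ndmu _ _ (ltW ay).
by rewrite ler_norml; apply/andP; split; lra.
Unshelve. all: by end_near. Qed.

Section piecewise_lipschitz_regularity.
Context (R : realType) (mu : R -> R) (k : nat) (xi : nat -> \bar R).
Hypotheses (hlip : piecewise_lipschitz mu k xi).

Lemma piecewise_lipschitz_const : exists2 L : R, 0 < L &
  forall i, (1 <= i <= k.+1)%N -> forall x y,
    (xi i.-1 < x%:E < xi i)%E -> (xi i.-1 < y%:E < xi i)%E ->
    `|mu x - mu y| <= L * `|x - y|.
Proof.
have [_ _ _ hl] := hlip.
(* The Lipschitz predicate says that all large constants work, so finitely many pieces are combined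
   by intersecting neighbourhoods of +oo. *)
have : forall K, (K <= k.+1)%N -> \forall M \near +oo,
   forall i, (1 <= i <= K)%N -> forall x y,
    (xi i.-1 < x%:E < xi i)%E -> (xi i.-1 < y%:E < xi i)%E ->
    `|mu x - mu y| <= M * `|x - y|.
  elim=> [_|K IH KK]; first by near=> M => i; lia.
  have h1 := IH (ltnW KK).
  have h2 := hl K.+1 KK; near=> M => i /andP[i1]; rewrite leq_eqVlt => /orP[/eqP ->|iK].
    move=> x y hx hy.
    have : forall p, ([set x0 : R | (xi K < x0%:E < xi K.+1)%E] `*`
       [set x0 : R | (xi K < x0%:E < xi K.+1)%E]) p ->
       `|mu p.1 - mu p.2| <= M * `|p.1 - p.2|.
      by near: M; exact: h2.
    by move=> /(_ (x, y)); apply.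
  have : forall i, (1 <= i <= K)%N -> forall x y,
    (xi i.-1 < x%:E < xi i)%E -> (xi i.-1 < y%:E < xi i)%E ->
    `|mu x - mu y| <= M * `|x - y| by near: M; exact: h1.
  by apply; rewrite i1.
move=> /(_ k.+1 (leqnn _)) H.
have : \forall M \near +oo, 0 < M :> R /\ forall i, (1 <= i <= k.+1)%N -> forall x y,
    (xi i.-1 < x%:E < xi i)%E -> (xi i.-1 < y%:E < xi i)%E ->
    `|mu x - mu y| <= M * `|x - y|.
  near=> M; split; first by near: M; exact: nbhs_pinfty_gt.
  by near: M; exact: H.
move=> [M0 [_ h]]; have [|h1 h2] := h (M0 + 1); first by rewrite ltrDl.
by exists (M0 + 1).
Unshelve. all: by end_near. Qed.

Lemma piecewise_breakpoint_fin i : (1 <= i <= k)%N -> ((fine (xi i))%:E = xi i)%E.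
Proof.
move=> /andP[i1 ik]; have [_ _ hinc _] := hlip; apply: fineK.
have h1 := hinc i.-1 ltac:(lia); have h2 := hinc i ltac:(lia).
move: h1 h2; case: i i1 ik => // i _ ik /=.
by case: (xi i.+1) => //=; rewrite ?ltNge ?leey ?leNye.
Qed.

Let bp := [seq fine (xi i) | i <- iota 1 k].

(** The piece is found as the least index whose breakpoint exceeds [x]; the previous breakpoint is
    then at most [x], and equality or a breakpoint below [y] would contradict the assumption. *)
Lemma piecewise_same_piece x y : x <= y ->
  (forall z, z \in bp -> ~~ (x <= z <= y)) ->
  exists2 i, (1 <= i <= k.+1)%N &
    (xi i.-1 < x%:E < xi i)%E && (xi i.-1 < y%:E < xi i)%E.
Proof.
move=> xy nobp; have [x0 xk hinc _] := hlip.
have ex : exists i, (x%:E < xi i)%E && (i <= k.+1)%N.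
  by exists k.+1; rewrite xk ltry leqnn.
case: (ex_minnP ex) => i /andP[xi_i ik] mini.
have i1 : (1 <= i)%N by move: xi_i; case: (i) => //; rewrite x0.
have lo : (xi i.-1 <= x%:E)%E.
  by rewrite leNgt; apply/negP => h; have := mini i.-1; rewrite h /=; lia.
have notin j : (1 <= j <= k)%N -> ~~ (x%:E <= xi j <= y%:E)%E.
  move=> jk; rewrite -(piecewise_breakpoint_fin jk) !lee_fin; apply: nobp.
  by apply/mapP; exists j => //; rewrite mem_iota; lia.
exists i; first by rewrite i1.
have lo' : (xi i.-1 < x%:E)%E.
  rewrite lt_neqAle lo andbT; apply/negP => /eqP h.
  have [ii|ii] := posnP i.-1; first by move: h; rewrite ii x0.
  by have := notin i.-1 ltac:(lia); rewrite h lexx lee_fin xy.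
rewrite lo' xi_i /=; apply/andP; split; first by apply: lt_le_trans lo' _; rewrite lee_fin.
rewrite ltNge; apply/negP => h.
have [ii|ii] := eqVneq i k.+1; first by move: h; rewrite ii xk leye_eq.
by have := notin i ltac:(lia); rewrite h (ltW xi_i).
Qed.

Hypothesis ndmu : nondecreasing_fun mu.

(** Outside a ball containing all breakpoints [mu] is Lipschitz; inside, monotonicity bounds the
    whole variation, jumps included, by [mu r - mu (- r)]. *)
Lemma piecewise_lipschitz_growth : exists2 C : R, 0 < C &
  forall x y, `|mu x - mu y| <= C * (1 + `|x - y|).
Proof.
have [L L0 hL] := piecewise_lipschitz_const.
have [r r0 rbp] : exists2 r : R, 0 < r & forall z, z \in bp -> `|z| < r.
  exists (1 + \sum_(z <- bp) `|z|); first by rewrite ltr_wpDr// sumr_ge0.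
  move=> z zb; rewrite (big_rem z) //=.
  have : 0 <= \sum_(y <- rem z bp) `|y| :> R by apply: sumr_ge0.
  lra.
have outer x y : x <= y -> (r <= x \/ y <= - r) -> mu y - mu x <= L * (y - x).
  move=> xy hxy; have [z zb|i ik /andP[h1 h2]] := @piecewise_same_piece x y xy.
    have := rbp z zb; rewrite ltr_norml => /andP[z1 z2].
    by apply/negP => /andP[z3 z4]; case: hxy; lra.
  have := hL i ik _ _ h1 h2; rewrite distrC (distrC x) ger0_norm ?subr_ge0 ?ndmu//.
  by rewrite ger0_norm// subr_ge0.
pose c0 := mu r - mu (- r).
have c00 : 0 <= c0 by rewrite subr_ge0 ndmu//; lra.
have key x y : x <= y -> mu y - mu x <= c0 + L * (y - x).
  move=> xy; have Lxy : 0 <= L * (y - x) by rewrite mulr_ge0 ?subr_ge0 // ltW.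
  have [rx|xr] := leP r x; first by have := outer _ _ xy (or_introl rx); lra.
  have [yr|ry] := leP y (- r); first by have := outer _ _ xy (or_intror yr); lra.
  have h1 : mu y - mu r <= L * (Num.max y r - r).
    have [ry'|yr'] := leP r y; first exact: outer (or_introl (lexx _)).
    by rewrite subrr mulr0 subr_le0 ndmu// ltW.
  have h2 : mu (- r) - mu x <= L * (- r - Num.min x (- r)).
    have [xr'|rx'] := leP x (- r); first exact: outer (or_intror (lexx _)).
    by rewrite subrr mulr0 subr_le0 ndmu// ltW.
  have : L * (Num.max y r - r) + L * (- r - Num.min x (- r)) <= L * (y - x).
    rewrite -mulrDr ler_wpM2l // ?(ltW L0)//.
    by case: (leP y r) => ?; case: (leP x (- r)) => ?; lra.
  rewrite /c0; lra.
exists (c0 + L); first by lra.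
move=> x y; rewrite mulrDr mulr1 mulrDl.
wlog xy : x y / x <= y.
  move=> H; have [xy|yx] := leP x y; first exact: H.
  by rewrite distrC (distrC x); apply: H; exact: ltW.
rewrite distrC (distrC x) ger0_norm ?subr_ge0 ?ndmu// ger0_norm ?subr_ge0//.
have := key _ _ xy.
have := mulr_ge0 c00 (ltac:(rewrite subr_ge0//) : 0 <= y - x).
lra.
Qed.

(** A jump between [x] and [y] forces a breakpoint within [|x - y|] of [y], and then the sum is at
    least 1 and the growth bound applies. The indicators depend on the position [y] and on the size
    of the increment only, so their expectations can be estimated. *)
Lemma piecewise_lipschitz_modulus : exists2 C : R, 0 < C &
  forall x y, `|mu x - mu y| <=
    C * (`|x - y| + \sum_(z <- bp) (`|y - z| <= `|x - y|)%R%:R).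
Proof.
have [L L0 hL] := piecewise_lipschitz_const.
have [C C0 hC] := piecewise_lipschitz_growth.
exists (L + C); first exact: addr_gt0.
move=> x y; set S := \sum_(z <- bp) _.
have S0 : 0 <= S by apply: sumr_ge0 => *; rewrite ler0n.
have nn := normr_ge0 (x - y).
have [/hasP[z zb hz]|/hasPn nob] := boolP (has (fun z => Num.min x y <= z <= Num.max x y) bp).
  have S1 : 1 <= S.
    rewrite /S (big_rem z) //= (_ : `|y - z| <= `|x - y|); last first.
      move: hz; case: (leP x y) => xy /andP[h1 h2].
        by rewrite (distrC x) !ger0_norm ?subr_ge0//; lra.
      by rewrite distrC !ger0_norm ?subr_ge0//; lra.
    by rewrite lerDl; apply: sumr_ge0 => *; rewrite ler0n.
  apply: le_trans (hC x y) _.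
  have : C * S >= C * 1 by rewrite ler_pM2l.
  have := mulr_ge0 (ltW L0) S0; have := mulr_ge0 (ltW L0) nn; rewrite !mulrDl !mulrDr; lra.
have h : `|mu x - mu y| <= L * `|x - y|.
  move: nob; case: (leP x y) => xy nob.
    by have [//|i ik /andP[h1 h2]] := @piecewise_same_piece x y xy; exact: (hL i).
  by have [//|i ik /andP[h1 h2]] := @piecewise_same_piece y x (ltW xy); exact: (hL i).
apply: le_trans h _; rewrite mulrDl mulrDr.
have := mulr_ge0 (ltW L0) S0; have := mulr_ge0 (ltW C0) S0; have := mulr_ge0 (ltW C0) nn.
rewrite mulrDr; lra.
Qed.

End piecewise_lipschitz_regularity.

(** * Densities and normal laws *)

Section integral_density.
Local Open Scope ereal_scope.
Context d (T : measurableType d) (R : realType).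
Variables (mu nu : {measure set T -> \bar R}) (h : T -> R).
Hypotheses (mh : measurable_fun setT h) (h0 : forall x, (0 <= h x)%R).
Hypothesis nuE : forall A, measurable A -> nu A = \int[mu]_(x in A) (h x)%:E.

Import HBNNSimple.

Let density_nnsfun (g : {nnsfun T >-> R}) :
  \int[nu]_x (g x)%:E = \int[mu]_x ((h x)%:E * (g x)%:E).
Proof.
rewrite integralT_nnsfun sintegralE.
under [RHS]eq_integral.
  move=> x _; rewrite fimfunE -fsumEFin// ge0_mule_fsumr; last first.
    by move=> r; rewrite EFinM nnfun_muleindic_ge0.
  over.
rewrite ge0_integral_fsum//; last 2 first.
- move=> r; apply/measurable_EFinP/measurable_funM => //.
  by apply: measurable_funM => //; exact: measurable_indic.
- move=> r x _; apply: mule_ge0; first by rewrite lee_fin.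
  by rewrite EFinM nnfun_muleindic_ge0.
apply: eq_fsbigr => r _; rewrite nuE//.
have [r0|r0] := ltP r 0%R.
  rewrite preimage_nnfun0// integral_set0 mule0; apply/esym/integral0_eq => x _.
  by rewrite indic0 mulr0 mule0.
rewrite integral_mkcond -ge0_integralZl//; last 2 first.
- apply/(measurable_restrictT _ _).1 => //.
  by apply/measurable_funTS/measurable_EFinP.
- by move=> x _; apply: erestrict_ge0 => y _; rewrite lee_fin.
apply: eq_integral => x _; rewrite patchE indicE.
by case: ifP => _ /=; rewrite ?mulr1 ?mulr0 ?mule0// muleC.
Qed.

(** Simple functions first, then monotone convergence. It serves for the normal law against Lebesgue
    measure, for [P] restricted to an event, and for the law of an increment on an event independent
    of it. *)
Lemma ge0_integral_density (f : T -> \bar R) :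
  measurable_fun setT f -> (forall x, 0 <= f x) ->
  \int[nu]_x f x = \int[mu]_x ((h x)%:E * f x).
Proof.
move=> mf f0; pose f_ := nnsfun_approx measurableT mf.
have f_nd x : {homo (fun n => (f_ n x)%:E) : m n / (m <= n)%N >-> m <= n}.
  by move=> m n mn; rewrite lee_fin; exact/lefP/nd_nnsfun_approx.
have f_f x : (f_ n x)%:E @[n --> \oo] --> f x by exact: cvg_nnsfun_approx.
transitivity (lim (\int[nu]_x (f_ n x)%:E @[n --> \oo])).
  rewrite -monotone_convergence//=; last 2 first.
  - by move=> n; exact/measurable_EFinP/measurable_funTS.
  - by move=> n ? _; rewrite lee_fin.
  by apply: eq_integral => x _; apply/esym/cvg_lim => //.
transitivity (lim (\int[mu]_x ((h x)%:E * (f_ n x)%:E) @[n --> \oo])).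
  by apply: congr_lim; apply/funext => n; exact: density_nnsfun.
rewrite -monotone_convergence//=; last 3 first.
- by move=> n; apply/measurable_EFinP/measurable_funM.
- by move=> n ? _; rewrite lee_fin mulr_ge0.
- by move=> x _ m n mn; rewrite lee_wpmul2l ?lee_fin//; exact: f_nd.
apply: eq_integral => x _; apply: cvg_lim => //.
by apply: cvgeZl.
Qed.

End integral_density.

Section normal_bounds.
Context (R : realType).
Implicit Types (v a b x : R).

(** The factor [2 pi] lies between 1 and 9 because [2 <= pi < 4]; this keeps [pi] out of all later
    constants. *)
Lemma sqr_ler_pi2 v : 0 < v -> Num.sqrt v <= Num.sqrt (Num.sqrt v ^+ 2 * pi *+ 2) <= 3 * Num.sqrt v.
Proof.
move=> v0; rewrite (sqr_sqrtr (ltW v0)) -mulr_natr; have p2 := @pi_ge2 R; have p4 := @pihalf_lt2 R.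
apply/andP; split; first by rewrite ler_sqrt; nra.
rewrite -(ler_pXn2r (ltn0Sn 1)) ?nnegrE ?mulr_ge0 ?sqrtr_ge0//.
by rewrite exprMn !sqr_sqrtr; nra.
Qed.

Lemma normal_peak_bounds v : 0 < v ->
  (3 * Num.sqrt v)^-1 <= normal_peak (Num.sqrt v) <= (Num.sqrt v)^-1.
Proof.
move=> v0; have s0 : 0 < Num.sqrt v by rewrite sqrtr_gt0.
have /andP[h1 h2] := sqr_ler_pi2 v0; rewrite /normal_peak.
by apply/andP; split; rewrite lef_pV2 ?posrE ?mulr_gt0//; exact: lt_le_trans h1.
Qed.

Lemma normal_prob_itv_le v a b : 0 < v -> a <= b ->
  (normal_prob 0 (Num.sqrt v) `[a, b] <= ((b - a) / Num.sqrt v)%:E)%E.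
Proof.
move=> v0 ab; have s0 : Num.sqrt v != 0 by rewrite gt_eqF// sqrtr_gt0.
rewrite /normal_prob.
apply: (@le_trans _ _ (\int[lebesgue_measure]_(x in `[a, b]) ((Num.sqrt v)^-1)%:E)%E).
  apply: ge0_le_integral => //=.
  - by move=> x _; rewrite lee_fin normal_pdf_ge0.
  - apply/measurable_EFinP/measurable_funTS; exact: measurable_normal_pdf.
  - move=> x _; rewrite lee_fin; apply: le_trans (normal_pdf_ub _ _ s0) _.
    by have /andP[] := normal_peak_bounds v0.
rewrite integral_cst//= lebesgue_measure_itv/= lte_fin; case: ltP => // _.
  by rewrite -EFinB -EFinM mulrC.
by rewrite mule0 lee_fin divr_ge0 ?subr_ge0// sqrtr_ge0.
Qed.

(** [m] bounds [x ^ 2 / v] on the interval, so the exponential factor of the density is at least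
    [expR (- m)]. The interval is half open in order to fit into a disjoint family. *)
Lemma normal_prob_itv_ge v a b m : 0 < v -> a <= b ->
  (forall x, a <= x <= b -> x ^+ 2 <= m * v) ->
  (((b - a) / (3 * Num.sqrt v) * expR (- m))%:E
    <= normal_prob 0 (Num.sqrt v) `[a, b[%classic)%E.
Proof.
move=> v0 ab hm; have s0 : Num.sqrt v != 0 by rewrite gt_eqF// sqrtr_gt0.
have /andP[hp _] := normal_peak_bounds v0.
rewrite /normal_prob.
apply: (@le_trans _ _ (\int[lebesgue_measure]_(x in `[a, b[%classic)
    ((3 * Num.sqrt v)^-1 * expR (- m))%:E)%E); last first.
  apply: ge0_le_integral => //=.
  - apply/measurable_EFinP/measurable_funTS; exact: measurable_normal_pdf.
  - move=> x; rewrite in_itv/= => /andP[ax xb]; rewrite lee_fin normal_pdfE//.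
    rewrite ler_pM ?expR_ge0// ?invr_ge0 ?mulr_ge0 ?sqrtr_ge0//.
    rewrite /normal_fun ler_expR subr0 (sqr_sqrtr (ltW v0)) mulNr lerN2.
    rewrite ler_pdivrMr ?mulrn_wgt0//.
    have := hm x; rewrite ax (ltW xb) => /(_ isT); rewrite -mulr_natr.
    by have := sqr_ge0 x; nra.
rewrite integral_cst//= lebesgue_measure_itv/= lte_fin; case: ltP => // ba.
  by rewrite -EFinB -EFinM lee_fin le_eqVlt; apply/orP; left; apply/eqP; ring.
by rewrite mule0 lee_fin (_ : b - a = 0) ?mul0r//; apply/eqP; rewrite subr_eq0 eq_le ab ba.
Qed.

Lemma normal_abs_moment_le v : 0 < v ->
  (\int[normal_prob 0 (Num.sqrt v)]_x `|x|%:E <= (2 * Num.sqrt v)%:E)%E.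
Proof.
move=> v0; have s0 : Num.sqrt v != 0 by rewrite gt_eqF// sqrtr_gt0.
rewrite (@ge0_integral_density _ _ _ lebesgue_measure _ (normal_pdf 0 (Num.sqrt v)))//; last 3 first.
- exact: measurable_normal_pdf.
- by move=> x; exact: normal_pdf_ge0.
- by apply/measurable_EFinP; exact: normr_measurable.
have v20 : 0 < 2 * v by rewrite mulr_gt0.
have s20 : Num.sqrt (2 * v) != 0 by rewrite gt_eqF// sqrtr_gt0.
pose c := Num.sqrt 2 * Num.sqrt v.
(* [y * exp (- y ^ 2 / 2) <= exp (- y ^ 2 / 4)] bounds the integrand by a centred density of variance [2 v] *)
apply: (@le_trans _ _ (\int[lebesgue_measure]_x (c%:E * (normal_pdf 0 (Num.sqrt (2 * v)) x)%:E))%E).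
  apply: ge0_le_integral => //=.
  - by move=> x _; rewrite -EFinM lee_fin mulr_ge0 ?normal_pdf_ge0.
  - apply/measurable_EFinP/measurable_funM; first exact: measurable_normal_pdf.
    exact: normr_measurable.
  - apply/measurable_EFinP/measurable_funM; first exact: measurable_cst.
    exact: measurable_normal_pdf.
  - move=> x _; rewrite -!EFinM lee_fin !normal_pdfE// /normal_fun !subr0.
    rewrite (sqr_sqrtr (ltW v0)) (sqr_sqrtr (ltW v20)).
    have -> : normal_peak (Num.sqrt v) = Num.sqrt 2 * normal_peak (Num.sqrt (2 * v)).
      rewrite /normal_peak (sqr_sqrtr (ltW v0)) (sqr_sqrtr (ltW v20)).
      have -> (r : R) : 2 * v * r *+ 2 = 2 * (v * r *+ 2) by rewrite -mulrA mulrnAr.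
      rewrite (sqrtrM _ (ler0n _ 2)) invfM mulrA divff ?mul1r//.
    set p := normal_peak _; set e1 := expR _; set e2 := expR _.
    suff h : e1 * `|x| <= Num.sqrt v * e2.
      have -> : Num.sqrt 2 * p * e1 * `|x| = Num.sqrt 2 * p * (e1 * `|x|) by ring.
      have -> : c * (p * e2) = Num.sqrt 2 * p * (Num.sqrt v * e2) by rewrite /c; ring.
      by rewrite ler_wpM2l// mulr_ge0 ?sqrtr_ge0 ?normal_peak_ge0.
    rewrite {}/e1 {}/e2.
    pose y := `|x| / Num.sqrt v.
    have xy : `|x| = y * Num.sqrt v by rewrite /y divfK.
    have x2 : x ^+ 2 = y ^+ 2 * v.
      by rewrite -(real_normK (num_real x)) xy exprMn (sqr_sqrtr (ltW v0)).
    rewrite x2 xy.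
    have -> : - (y ^+ 2 * v) / (v *+ 2) = - (y ^+ 2 / 4) + - (y ^+ 2 / 4).
      by rewrite -mulr_natr; field; rewrite gt_eqF.
    have -> : - (y ^+ 2 * v) / (2 * v *+ 2) = - (y ^+ 2 / 4).
      by rewrite -mulr_natr; field; rewrite gt_eqF.
    rewrite expRD; set e := expR _; have e0 : 0 < e by exact: expR_gt0.
    (* [e] is [expR (- y ^ 2 / 4)], and [expR (y ^ 2 / 4) >= 1 + y ^ 2 / 4 >= y] because
       [(y - 2) ^ 2 >= 0]. *)
    have ye : y * e <= 1.
      rewrite /e expRN ler_pdivrMr ?expR_gt0// mul1r.
      by apply: le_trans (expR_ge1Dx _); have := sqr_ge0 (y - 2); nra.
    have : 0 <= Num.sqrt v * e by rewrite mulr_ge0 ?sqrtr_ge0 ?ltW.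
    nra.
rewrite ge0_integralZl//; last 3 first.
- apply/measurable_EFinP; exact: measurable_normal_pdf.
- by move=> x _; rewrite lee_fin normal_pdf_ge0.
- by rewrite lee_fin mulr_ge0 ?sqrtr_ge0.
rewrite integral_normal_pdf mule1 lee_fin ler_wpM2r ?sqrtr_ge0//.
rewrite -(@ler_pXn2r _ 2) ?nnegrE ?sqrtr_ge0// sqr_sqrtr//.
lra.
Qed.

End normal_bounds.

(** * Brownian motion with continuous paths *)

Section continuous_brownian_motion.
Context (d : measure_display) (T : measurableType d) (R : realType).
Variable P : probability T R.

(** With [l = 1] it freezes a path outside [[0, 1]]; with [l] the length of a cell and [t] counted
    from the start of the cell, it is the time already spent in that cell. *)
Definition clip (l t : R) : R := Num.max 0 (Num.min t l).

Lemma clip_itv l t : 0 <= l -> 0 <= clip l t <= l.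
Proof. by move=> l0; rewrite /clip le_max lexx /= ge_max l0 ge_min lexx orbT. Qed.

Lemma clip_id l t : 0 <= t <= l -> clip l t = t.
Proof. by move=> /andP[t0 t1]; rewrite /clip (min_idPl t1) (max_idPr t0). Qed.

Lemma continuous_clip l : continuous (clip l).
Proof.
move=> t; apply: (@continuous_max R R (cst 0) (id \min cst l)).
  exact: cvg_cst.
by apply: (@continuous_min R R id (cst l)); [exact: cvg_id|exact: cvg_cst].
Qed.

(** [clip 1] is a continuous retraction onto [[0, 1]], which turns continuity in the subspace
    topology into continuity on the line. *)
Lemma within_continuous_clip (f : R -> R) :
  {within `[0, 1], continuous f} -> continuous (f \o clip 1).
Proof.
move=> fc t U fU.
have ct : (`[0, 1]%classic : set R) (clip 1 t).
  by rewrite /= in_itv /= clip_itv.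
have h : within `[0, 1] (nbhs (clip 1 t)) (f @^-1` U).
  by rewrite (nbhs_subspace_in ct); exact: fc.
have h' : \forall s \near t, (`[0, 1]%classic : set R) (clip 1 s) -> U (f (clip 1 s)).
  exact: (@continuous_clip 1 t _ h).
change (\forall s \near t, U (f (clip 1 s))).
near=> s; have : (`[0, 1]%classic : set R) (clip 1 s) -> U (f (clip 1 s)) by near: s.
apply; by rewrite /= in_itv /= clip_itv.
Unshelve. all: by end_near. Qed.

Lemma clip_le0 l t : t <= 0 -> clip l t = 0.
Proof. by move=> t0; apply: max_l; rewrite ge_min t0. Qed.

Lemma clip_ge l t : 0 <= l -> l <= t -> clip l t = l.
Proof. by move=> l0 lt; rewrite /clip (min_idPr lt) (max_idPr l0). Qed.

Lemma clip_homo l : {homo clip l : s t / s <= t}.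
Proof.
move=> s t st; rewrite /clip.
have mm : Num.min s l <= Num.min t l by rewrite le_min !ge_min st lexx orbT.
by rewrite ge_max !le_max lexx mm orbT.
Qed.

(* The properties that hold almost surely for a Brownian motion are required
   of every [w], and paths are frozen outside [0, 1]. *)
Record continuous_brownian (V : R -> T -> R) : Prop := ContinuousBrownian {
  cbm_measurable : forall t, measurable_fun setT (V t);
  cbm_continuous : forall w, continuous (fun t => V t w);
  cbm_start : forall w, V 0 w = 0;
  cbm_clip : forall t w, V (clip 1 t) w = V t w;
  cbm_normal : forall s t, 0 <= s -> s < t -> t <= 1 ->
    forall B : set R, measurable B ->
    P [set w | B (V t w - V s w)] = normal_prob 0 (Num.sqrt (t - s)) B;
  cbm_independent : forall (m : nat) (t : nat -> R),
    (forall i, (i <= m)%N -> 0 <= t i <= 1) ->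
    (forall i, (i < m)%N -> t i <= t i.+1) ->
    forall B : nat -> set R, (forall i, measurable (B i)) ->
    P [set w | forall i, (i < m)%N -> B i (V (t i.+1) w - V (t i) w)] =
    (\prod_(i < m) P [set w | B i (V (t i.+1) w - V (t i) w)%R])%E
}.

Lemma eq_probability_outside (N A B : set T) : measurable N -> P N = 0%E ->
  measurable A -> measurable B -> (forall w, ~ N w -> A w <-> B w) -> P A = P B.
Proof.
move=> mN PN; have half (A' B' : set T) : measurable A' -> measurable B' ->
    (forall w, ~ N w -> A' w -> B' w) -> (P A' <= P B')%E.
  move=> mA mB AB; apply: (@le_trans _ _ (P (B' `|` N))).
    apply: le_measure; rewrite ?inE//; first exact: measurableU.
    by move=> w Aw; have [Nw|nNw] := pselect (N w); [right|left; exact: AB].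
  by apply: le_trans (measureU2 _ mB mN) _; rewrite [X in (_ + X)%E]PN adde0.
move=> mA mB AB; apply/eqP; rewrite eq_le !half// => w nNw.
  by have [] := AB w nNw.
by have [] := AB w nNw.
Qed.

Lemma continuous_version (W : R -> {RV P >-> R}) :
  standard_brownian_motion W ->
  exists2 V, continuous_brownian V &
    exists N : set T, [/\ measurable N, P N = 0%E &
      forall w, ~ N w -> forall t, 0 <= t <= 1 -> V t w = W t w].
Proof.
case=> W0 Wn Wi Wc.
have [N [mN PN subN]] : {ae P, forall w, W 0 w = 0 /\
    {within `[0, 1], continuous (fun t : R => W t w)}}.
  by apply: filterS2 W0 Wc => w; split.
have NW w : ~ N w -> W 0 w = 0 /\ {within `[0, 1], continuous (fun t : R => W t w)}.
  by move=> nN; apply: contrapT => h; apply: nN; exact: subN.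
pose V (t : R) (w : T) : R := \1_(~` N) w * W (clip 1 t) w.
have VW w : ~ N w -> forall t, 0 <= t <= 1 -> V t w = W t w.
  by move=> nN t t01; rewrite /V indicE mem_set// mul1r clip_id.
have V0 w : N w -> forall t, V t w = 0.
  by move=> Nw t; rewrite /V indicE memNset ?mul0r// => /(_ Nw).
have mV t : measurable_fun setT (V t).
  apply: measurable_funM => //.
  by apply: measurable_indic; exact: measurableC.
have mVB (s t : R) (B : set R) : measurable B -> measurable [set w | B (V t w - V s w)].
  move=> mB; rewrite -[X in measurable X]setTI.
  by apply: (measurable_funB (mV t) (mV s)).
have mWB (s t : R) (B : set R) : measurable B -> measurable [set w | B (W t w - W s w)].
  move=> mB; rewrite -[X in measurable X]setTI.
  by apply: (measurable_funB (f := W t) (g := W s)).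
have eqVW (s t : R) (B : set R) : 0 <= s <= 1 -> 0 <= t <= 1 -> measurable B ->
    P [set w | B (V t w - V s w)] = P [set w | B (W t w - W s w)].
  move=> s01 t01 mB; apply: (eq_probability_outside mN PN); [exact: mVB|exact: mWB|].
  by move=> w nN /=; rewrite !VW.
exists V; last by exists N.
split => //.
- move=> w; have [Nw|nNw] := pselect (N w).
    rewrite (_ : (fun t => V t w) = cst 0); first exact: cst_continuous.
    by apply/funext => t; rewrite V0.
  rewrite (_ : (fun t => V t w) = (fun t => W t w) \o clip 1).
    by apply: within_continuous_clip; exact: (NW w nNw).2.
  by apply/funext => t; rewrite /V indicE mem_set// mul1r.
- move=> w; have [Nw|nNw] := pselect (N w); first by rewrite V0.
  by rewrite VW ?lexx ?ler01// (NW w nNw).1.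
- by move=> t w; rewrite /V (clip_id (clip_itv t ler01)).
- move=> s t s0 st t1 B mB; rewrite eqVW//; last 2 first.
  + by rewrite s0 (le_trans (ltW st)).
  + by rewrite t1 (le_trans s0 (ltW st)).
  by rewrite -Wn.
- move=> m t t01 tle B mB.
  have t01' i : (i < m)%N -> 0 <= t i <= 1 by move=> im; apply: t01; exact: ltnW.
  transitivity (P [set w | forall i, (i < m)%N -> B i (W (t i.+1) w - W (t i) w)]).
    have mcap (U : R -> T -> R) :
        (forall s t (B : set R), measurable B -> measurable [set w | B (U t w - U s w)]) ->
        measurable [set w | forall i, (i < m)%N -> B i (U (t i.+1) w - U (t i) w)].
      move=> mU; rewrite (_ : [set w | _] =
          \bigcap_(i < m) [set w | B i (U (t i.+1) w - U (t i) w)])//.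
      by apply: bigcap_measurableType => i _; exact: mU.
    apply: (eq_probability_outside mN PN).
    - exact: mcap.
    - exact: (mcap (fun t => W t)).
    - by move=> w nN /=; split => h i im; have := h i im;
        have := t01 i.+1 im; have := t01' i im => ? ?; rewrite !VW.
  have := Wi m t t01 tle [set: 'I_m]%SET (fun i => B i) (fun i _ => mB i).
  rewrite (_ : \bigcap_(_ in _) _ =
    [set w | forall i, (i < m)%N -> B i (W (t i.+1) w - W (t i) w)]); last first.
    apply/seteqP; split => w /= h i.
      by move=> im; have := h (Ordinal im); apply; rewrite /= inE.
    by move=> _; exact: h.
  move=> ->; apply: eq_big => [i|i _]; first by rewrite inE.
  by rewrite eqVW// ?(t01 i.+1 (ltn_ord i)) ?(t01' i (ltn_ord i)).
Qed.

End continuous_brownian_motion.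

(** * Exchanging increments *)

Section equality_in_law.
Context (d : measure_display) (T : measurableType d) (R : realType).
Variable P : probability T R.

Lemma setI_closed_boxes N : setI_closed [set A : set (N.-tuple R) |
  exists2 B : 'I_N -> set R, (forall i, measurable (B i)) &
    A = [set x | forall i, B i (tnth x i)]].
Proof.
move=> _ _ [B mB ->] [C mC ->]; exists (fun i => B i `&` C i).
  by move=> i; exact: measurableI.
apply/seteqP; split=> x /=; first by move=> [h1 h2] i; split; [exact: h1|exact: h2].
by move=> h; split=> i; have [] := h i.
Qed.

Lemma tuple_measurable_boxes N : (measurable : set (set (N.-tuple R))) =
  <<s [set A : set (N.-tuple R) |
  exists2 B : 'I_N -> set R, (forall i, measurable (B i)) &
    A = [set x | forall i, B i (tnth x i)]] >>.
Proof.
apply/seteqP; split; apply: smallest_sub.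
- exact: smallest_sigma_algebra.
- case: N => [|N]; first by rewrite big_ord0.
  rewrite -bigcup_mkord_ord; apply: bigcup_sub => i iN _ [B mB <-].
  apply: sub_sigma_algebra.
  exists (fun j => if j == inord i then B else setT).
    by move=> j; case: ifP.
  rewrite setTI; apply/seteqP; split=> x /=.
    by move=> Bx j; case: eqP => [->|].
  by move=> /(_ (inord i)); rewrite eqxx.
- exact: sigma_algebra_measurable.
- move=> _ [B mB ->].
  rewrite (_ : [set x | _] = \bigcap_(i in [set: 'I_N]) ((fun x => tnth x i) @^-1` B i)).
    apply: fin_bigcap_measurable => // i _; rewrite -[X in measurable X]setTI.
    exact: measurable_tnth.
  by apply/seteqP; split=> x /= h i *; exact: h.
Qed.

(** Boxes form an intersection-stable generator of the product sigma-algebra, so agreement on boxes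
    gives equality of the two laws. *)
Lemma eq_boxes_eq_integral N (X Y : 'I_N -> T -> R) (H : N.-tuple R -> \bar R) :
  (forall i, measurable_fun setT (X i)) -> (forall i, measurable_fun setT (Y i)) ->
  (forall B : 'I_N -> set R, (forall i, measurable (B i)) ->
     P [set w | forall i, B i (X i w)] = P [set w | forall i, B i (Y i w)]) ->
  measurable_fun setT H -> (forall x, 0 <= H x)%E ->
  (\int[P]_w H [tuple X i w | i < N] = \int[P]_w H [tuple Y i w | i < N])%E.
Proof.
move=> mX mY XY mH H0.
have mtX : measurable_fun setT (fun w => [tuple X i w | i < N]).
  apply/measurable_fun_tnthP => i; rewrite (_ : _ \o _ = X i)//.
  by apply/funext => w /=; rewrite tnth_mktuple.
have mtY : measurable_fun setT (fun w => [tuple Y i w | i < N]).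
  apply/measurable_fun_tnthP => i; rewrite (_ : _ \o _ = Y i)//.
  by apply/funext => w /=; rewrite tnth_mktuple.
pose fX : {mfun T >-> N.-tuple R} := HB.pack (fun w => [tuple X i w | i < N])
  (isMeasurableFun.Build _ _ _ _ _ mtX).
pose fY : {mfun T >-> N.-tuple R} := HB.pack (fun w => [tuple Y i w | i < N])
  (isMeasurableFun.Build _ _ _ _ _ mtY).
transitivity (\int[distribution P fX]_x H x)%E.
  by rewrite ge0_integral_distribution.
transitivity (\int[distribution P fY]_x H x)%E; last first.
  by rewrite ge0_integral_distribution.
apply: eq_measure_integral => A mA _.
apply: (measure_unique _ (fun=> setT) (tuple_measurable_boxes N)) => //.
- exact: setI_closed_boxes.
- by move=> _; exists (fun=> setT) => //; apply/seteqP; split.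
- by rewrite bigcup_const.
- move=> _ [B mB ->]; rewrite /distribution /pushforward /=.
  transitivity (P [set w | forall i, B i (X i w)]).
    by congr (P _); apply/seteqP; split=> w /= h i; have := h i; rewrite tnth_mktuple.
  rewrite XY//.
  by congr (P _); apply/seteqP; split=> w /= h i; have := h i; rewrite tnth_mktuple.
- move=> _; apply: le_lt_trans (ltry 1); exact: (probability_le1 (distribution P fX)).
Qed.

End equality_in_law.

Section nonoverlapping_increments.
Context (d : measure_display) (T : measurableType d) (R : realType).
Variable P : probability T R.
Variables (V : R -> T -> R) (hV : continuous_brownian P V).

Lemma measurable_incr_preimage s t (B : set R) : measurable B ->
  measurable [set w | B (V t w - V s w)].
Proof.
move=> mB; rewrite -[X in measurable X]setTI.
by apply: (measurable_funB (cbm_measurable hV t) (cbm_measurable hV s)).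
Qed.

Lemma incr_stationary s t s' t' (B : set R) :
  0 <= s -> s <= t -> t <= 1 -> 0 <= s' -> s' <= t' -> t' <= 1 ->
  t - s = t' - s' -> measurable B ->
  P [set w | B (V t w - V s w)] = P [set w | B (V t' w - V s' w)].
Proof.
move=> s0 st t1 s0' st' t1' E mB.
have [e|ne] := eqVneq s t.
  have e' : s' = t' by apply/eqP; rewrite eq_sym -subr_eq0 -E e subrr.
  by congr (P _); apply/seteqP; split=> w /=; rewrite e e' !subrr.
have ne' : s' != t'.
  by apply/eqP => e'; move/eqP: ne; apply; apply/eqP; rewrite eq_sym -subr_eq0 E e' subrr.
have h : s < t by rewrite lt_neqAle ne.
have h' : s' < t' by rewrite lt_neqAle ne'.
by rewrite (cbm_normal hV s0 h t1 mB) (cbm_normal hV s0' h' t1' mB) E.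
Qed.

Lemma prode_double (M : nat) (F : nat -> \bar R) : (forall i, odd i -> F i = 1%E) ->
  (\prod_(i < M.*2) F i = \prod_(j < M) F j.*2)%E.
Proof.
move=> F1; elim: M => [|M IH]; first by rewrite !big_ord0.
by rewrite doubleS !big_ord_recr /= IH (F1 M.*2.+1) ?mule1//= odd_double.
Qed.

(** Sorting the intervals and interleaving their endpoints, left at even and right at odd indices,
    gives one nondecreasing grid to which independence of successive increments applies. The gaps
    between the intervals carry no constraint. *)
Lemma nonoverlapping_independent (K : finType) (l r : K -> R) (B : K -> set R) :
  (forall k, 0 <= l k) -> (forall k, l k <= r k) -> (forall k, r k <= 1) ->
  (forall k k', k != k' -> (r k <= l k') \/ (r k' <= l k)) ->
  (forall k, measurable (B k)) ->
  P [set w | forall k, B k (V (r k) w - V (l k) w)] =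
  (\prod_k P [set w | B k (V (r k) w - V (l k) w)%R])%E.
Proof.
move=> l0 lr r1 nonov mB.
case: (pickP (@predT K)) => [k0 _|K0]; last first.
  rewrite big_pred0//= (_ : [set _ | _] = setT) ?probability_setT//.
  by apply/seteqP; split=> // w _ /= k; have := K0 k.
(* Comparing both endpoints also sorts degenerate intervals correctly, such as a point at the left
   end of another interval. *)
pose leK k k' := (l k <= l k') && (r k <= r k').
have leK_total : total leK.
  move=> k k'; have [->|ne] := eqVneq k k'; first by rewrite /leK !lexx.
  have := lr k; have := lr k'; rewrite /leK.
  case: (nonov _ _ ne) => h h1 h2.
    by rewrite (le_trans h2 h) (le_trans h h1).
  by rewrite orbC (le_trans h1 h) (le_trans h h2).
pose s := sort leK (enum K); have [M ME] : exists M, M = size s by exists (size s).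
have sorted_s : sorted leK s by exact: sort_sorted.
have us : uniq s by rewrite sort_uniq enum_uniq.
have mem_s k : k \in s by rewrite mem_sort mem_enum.
pose e j := nth k0 s j.
have step j : (j.+1 < M)%N -> r (e j) <= l (e j.+1).
  move=> jM; have /andP[h1 h2] : leK (e j) (e j.+1).
    by apply: (sortedP k0 sorted_s); rewrite -ME.
  have : e j != e j.+1 by rewrite /e nth_uniq -?ME// ?(ltnW jM)// neq_ltn ltnSn.
  move=> /nonov[//|h]; have := lr (e j); have := lr (e j.+1); lra.
pose t i := if (i < M.*2)%N then (if odd i then r (e i./2) else l (e i./2)) else 1.
have t01 i : 0 <= t i <= 1.
  rewrite /t; case: ifP => _; last by rewrite ler01 lexx.
  by case: ifP => _; rewrite ?l0 ?r1 ?(le_trans (l0 _) (lr _)) ?(le_trans (lr _) (r1 _)).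
have tle i : (i < M.*2)%N -> t i <= t i.+1.
  move=> iM; have [_ ti1] := andP (t01 i); move: ti1.
  rewrite /t iM; case: (ltnP i.+1 M.*2) => // iM1 _.
  rewrite /= uphalf_half; case oi : (odd i) => /=; last by rewrite add0n.
  by rewrite add1n; apply: step; lia.
(* Odd increments run over the gaps; their events are certain and drop out of the product by
   [prode_double]. *)
pose C i := if odd i then setT else B (e i./2).
have mC i : measurable (C i) by rewrite /C; case: ifP.
have tE j : (j < M)%N -> t j.*2 = l (e j) /\ t j.*2.+1 = r (e j).
  move=> jM; have jM1 : (j.*2 < M.*2)%N by rewrite ltn_double.
  have jM2 : (j.*2.+1 < M.*2)%N by rewrite -doubleS leq_double.
  by rewrite /t jM1 jM2 /= odd_double /= doubleK uphalf_double.
have := cbm_independent hV (fun i _ => t01 i) tle mC.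
rewrite (_ : [set w | _] = [set w | forall k, B k (V (r k) w - V (l k) w)]); last first.
  apply/seteqP; split=> w /= h.
    move=> k; have kM : (index k s < M)%N by rewrite ME index_mem.
    have [t1 t2] := tE _ kM; have := h (index k s).*2.
    rewrite /C odd_double doubleK t1 t2 /e nth_index//; apply.
    by rewrite ltn_double.
  move=> i iM; rewrite /C; case oi : (odd i) => //.
  have ii : i = i./2.*2 by rewrite -[LHS]odd_double_half oi.
  have [t1 t2] : t i./2.*2 = l (e i./2) /\ t i./2.*2.+1 = r (e i./2).
    by apply: tE; rewrite -ltn_double -ii.
  by rewrite ii t1 t2 doubleK.
move=> ->.
rewrite (@prode_double M (fun i => P [set w | C i (V (t i.+1) w - V (t i) w)])); last first.
  by move=> i oi; rewrite /C oi -(probability_setT P); congr (P _); apply/seteqP; split.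
rewrite [RHS](perm_big s)/=; last first.
  by apply: uniq_perm; rewrite ?index_enum_uniq// => k; rewrite mem_index_enum mem_s.
rewrite (big_nth k0) big_mkord -ME; apply: eq_bigr => j _.
by have [-> ->] := tE j (ltn_ord j); rewrite /C odd_double doubleK.
Qed.

End nonoverlapping_increments.

Section cell_permutation.
Context (d : measure_display) (T : measurableType d) (R : realType).
Variable P : probability T R.
Variables (V : R -> T -> R) (hV : continuous_brownian P V).
Variables (Q : nat) (Q0 : (0 < Q)%N).
Let h : R := Q%:R^-1.

(* The process whose increments over the cell [z / Q, (z + 1) / Q] are those
   of [V] over the cell with number [sigma z]. *)
Definition cell_process (sigma : nat -> nat) (t : R) (w : T) : R :=
  \sum_(z < Q) (V ((sigma z)%:R * h + clip h (t - z%:R * h)) w - V ((sigma z)%:R * h) w).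

Let h0 : 0 < h. Proof. by rewrite invr_gt0 ltr0n. Qed.
Let Qh : Q%:R * h = 1. Proof. by rewrite /h divff// pnatr_eq0 -lt0n. Qed.

(** A cell contributes nothing before it begins, a partial increment while [t] is in it, and its
    full increment afterwards. Applied to a path, this identifies the process with unpermuted cells
    as [V]. *)
Lemma telescope_cells (f : R -> R) (t : R) M : 0 <= t ->
  \sum_(z < M) (f (z%:R * h + clip h (t - z%:R * h)) - f (z%:R * h)) =
  f (Num.min t (M%:R * h)) - f 0.
Proof.
move=> t0; elim: M => [|M IH]; first by rewrite big_ord0 mul0r (min_idPr t0) subrr.
rewrite big_ord_recr /= IH -natr1 mulrDl mul1r.
have Mh : 0 <= M%:R * h by rewrite mulr_ge0// ltW.
case: (leP t (M%:R * h)) => tM.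
  rewrite clip_le0 ?subr_le0// addr0 subrr addr0 (_ : Num.min t _ = t)//.
  by apply/min_idPl; apply: le_trans tM _; rewrite lerDl ltW.
case: (leP t (M%:R * h + h)) => tM1.
  rewrite clip_id; last by apply/andP; split; lra.
  by rewrite (_ : M%:R * h + (t - M%:R * h) = t); ring.
rewrite clip_ge; [|exact: ltW|by lra].
by ring.
Qed.

Lemma cell_process_id t w : 0 <= t <= 1 -> cell_process id t w = V t w.
Proof.
move=> /andP[t0 t1]; rewrite /cell_process (@telescope_cells (fun s => V s w))//.
by rewrite Qh (min_idPl t1) (cbm_start hV) subr0.
Qed.

Section increments.
Variables (sigma : nat -> nat).
Hypothesis sigma_lt : forall z, (z < Q)%N -> (sigma z < Q)%N.
Hypothesis sigma_inj : forall z z', (z < Q)%N -> (z' < Q)%N -> sigma z = sigma z' -> z = z'.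
Variables (N : nat) (tau : nat -> R).
Hypothesis tau_nd : forall i j, (i <= j)%N -> (j <= N)%N -> tau i <= tau j.

Let lft (k : 'I_N * 'I_Q) := (sigma k.2)%:R * h + clip h (tau k.1 - k.2%:R * h).
Let rgt (k : 'I_N * 'I_Q) := (sigma k.2)%:R * h + clip h (tau k.1.+1 - k.2%:R * h).

(** An increment of the permuted process between two grid times splits into one piece per cell. Each
    piece has the length of the corresponding unpermuted piece, and the pieces stay nonoverlapping
    because [sigma] is injective; hence the joint law does not depend on [sigma]. *)
Lemma cell_increments_law (B : 'I_N * 'I_Q -> set R) : (forall k, measurable (B k)) ->
  P [set w | forall k, B k (V (rgt k) w - V (lft k) w)] =
  (\prod_k P [set w | B k (V (k.2%:R * h + clip h (tau k.1.+1 - k.2%:R * h)) w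
                         - V (k.2%:R * h + clip h (tau k.1 - k.2%:R * h)) w)%R])%E.
Proof.
move=> mB.
have l0 (a : nat) t : 0 <= a%:R * h + clip h t.
  by have /andP[c0 _] := clip_itv t (ltW h0); rewrite addr_ge0// mulr_ge0// ltW.
have r1 (a : nat) t : (a < Q)%N -> a%:R * h + clip h t <= 1.
  move=> aQ; have /andP[_ c1] := clip_itv t (ltW h0).
  have : (a.+1)%:R * h <= Q%:R * h by rewrite ler_pM2r// ler_nat.
  by rewrite Qh -natr1 mulrDl mul1r; lra.
have lr (i : 'I_N) (z : 'I_Q) : clip h (tau i - z%:R * h) <= clip h (tau i.+1 - z%:R * h).
  by apply: clip_homo; rewrite lerB// tau_nd.
rewrite (nonoverlapping_independent hV)//.
- apply: eq_bigr => -[i z] _; rewrite /lft /rgt /=.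
  apply: (incr_stationary hV (l0 _ _) _ (r1 _ _ (sigma_lt (ltn_ord z))) (l0 _ _) _
    (r1 _ _ (ltn_ord z))) => //; rewrite ?lerD2l//.
  by ring.
- by move=> [i z]; exact: l0.
- by move=> [i z]; rewrite /lft /rgt /= lerD2l.
- by move=> [i z]; apply: r1; exact: sigma_lt.
- move=> [i z] [i' z'] ne; rewrite /lft /rgt /=.
  have cell (a b : nat) s t : (a < b)%N -> a%:R * h + clip h s <= b%:R * h + clip h t.
    move=> ab; have /andP[_ c1] := clip_itv s (ltW h0).
    have /andP[c0 _] := clip_itv t (ltW h0).
    have : a.+1%:R * h <= b%:R * h by rewrite ler_pM2r// ler_nat.
    by rewrite -natr1 mulrDl mul1r; lra.
  have [ez|nz] := eqVneq z z'.
    subst z'; have ni : i != i' :> nat by apply: contraNneq ne => /val_inj ->.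
    rewrite !lerD2l; case: (ltngtP i i') ni => // ii _; [left|right];
      by apply: clip_homo; rewrite lerD2r tau_nd// ltnW.
  have : sigma z != sigma z'.
    by apply: contraNneq nz => /(sigma_inj (ltn_ord z) (ltn_ord z')) /val_inj ->.
  by rewrite neq_ltn => /orP[h1|h1]; [left|right]; exact: cell.
Qed.

End increments.

Lemma cell_process_law_sorted (sigma : nat -> nat) N (tau : nat -> R)
    (ix : 'I_N -> nat) (H : N.-tuple R -> \bar R) :
  (forall z, (z < Q)%N -> (sigma z < Q)%N) ->
  (forall z z', (z < Q)%N -> (z' < Q)%N -> sigma z = sigma z' -> z = z') ->
  tau 0%N = 0 -> (forall i, (i <= N)%N -> 0 <= tau i <= 1) ->
  (forall i j, (i <= j)%N -> (j <= N)%N -> tau i <= tau j) ->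
  (forall i, (ix i <= N)%N) ->
  measurable_fun setT H -> (forall x, 0 <= H x)%E ->
  (\int[P]_w H [tuple cell_process sigma (tau (ix i)) w | i < N] =
   \int[P]_w H [tuple V (tau (ix i)) w | i < N])%E.
Proof.
move=> s_lt s_inj tau0 tau01 tau_nd ixN mH H0.
pose K : finType := ('I_N * 'I_Q)%type.
pose X (s : nat -> nat) (k : K) (w : T) :=
  V ((s k.2)%:R * h + clip h (tau k.1.+1 - k.2%:R * h)) w
  - V ((s k.2)%:R * h + clip h (tau k.1 - k.2%:R * h)) w.
have mX s k : measurable_fun setT (X s k).
  by apply: measurable_funB; exact: (cbm_measurable hV).
(* The values at the grid times are the same linear functions of the pieces for every permutation,
   so equality of laws of the pieces suffices. *)
pose Lin (x : #|K|.-tuple R) : N.-tuple R :=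
  [tuple \sum_(k : K | (k.1 < ix i)%N) tnth x (enum_rank k) | i < N].
have mLin : measurable_fun setT Lin.
  apply/measurable_fun_tnthP => i.
  rewrite (_ : _ \o _ = (fun x => \sum_(k : K) if (k.1 < ix i)%N then tnth x (enum_rank k) else 0)).
    apply: measurable_sum => k; case: (k.1 < ix i)%N; last exact: measurable_cst.
    exact: measurable_tnth.
  by apply/funext => x /=; rewrite tnth_mktuple big_mkcond.
have sumX s m w : (m <= N)%N ->
    \sum_(k : K | (k.1 < m)%N) X s k w = cell_process s (tau m) w.
  move=> mN; transitivity (\sum_(i < N | (i < m)%N) \sum_(z < Q) X s (i, z) w).
    by rewrite pair_big /=; apply: eq_big => [[i z]|[i z] _] //=; rewrite andbT.
  rewrite exchange_big /=; apply: eq_bigr => z _.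
  pose F i := V ((s z)%:R * h + clip h (tau i - z%:R * h)) w.
  rewrite -(big_ord_widen _ (fun i => F i.+1 - F i) mN) -(big_mkord xpredT (fun i => F i.+1 - F i)).
  rewrite telescope_sumr// /F tau0 [clip h (0 - _)]clip_le0 ?addr0//.
  by rewrite sub0r oppr_le0 mulr_ge0// ltW.
transitivity (\int[P]_w (H \o Lin) [tuple X sigma (enum_val i) w | i < #|K|])%E.
  apply: eq_integral => w _ /=; congr H; apply: eq_from_tnth => i.
  rewrite !tnth_mktuple -sumX//; apply: eq_bigr => k _.
  by rewrite tnth_mktuple enum_rankK.
transitivity (\int[P]_w (H \o Lin) [tuple X id (enum_val i) w | i < #|K|])%E; last first.
  apply: eq_integral => w _ /=; congr H; apply: eq_from_tnth => i.
  rewrite !tnth_mktuple -(cell_process_id _ (tau01 _ (ixN i))) -sumX//; apply: eq_bigr => k _.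
  by rewrite tnth_mktuple enum_rankK.
apply: (eq_boxes_eq_integral (X := fun i => X sigma (enum_val i))
  (Y := fun i => X id (enum_val i))) => [i|i|B mB||x]; [exact: mX|exact: mX| | |exact: H0].
  2: by apply: (measurableT_comp mH mLin).
have boxK s : [set w | forall i, B i (X s (enum_val i) w)] =
    [set w | forall k, B (enum_rank k) (X s k w)].
  apply/seteqP; split=> w /= hw k; last by have := hw (enum_val k); rewrite enum_valK.
  by have := hw (enum_rank k); rewrite enum_rankK.
rewrite !boxK (cell_increments_law s_lt s_inj tau_nd (fun k => mB (enum_rank k))).
by rewrite (cell_increments_law (sigma := id) (fun _ lt => lt) (fun _ _ _ _ e => e) tau_nd (fun k => mB (enum_rank k))).
Qed.

Lemma cell_process_law (sigma : nat -> nat) N (tt : N.-tuple R) (H : N.-tuple R -> \bar R) :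
  (forall z, (z < Q)%N -> (sigma z < Q)%N) ->
  (forall z z', (z < Q)%N -> (z' < Q)%N -> sigma z = sigma z' -> z = z') ->
  (forall i, 0 <= tnth tt i <= 1) ->
  measurable_fun setT H -> (forall x, 0 <= H x)%E ->
  (\int[P]_w H [tuple cell_process sigma (tnth tt i) w | i < N] =
   \int[P]_w H [tuple V (tnth tt i) w | i < N])%E.
Proof.
move=> s_lt s_inj tt01 mH H0.
(* The prepended 0 makes every value a sum of increments from time 0; it also accounts for the
   successor in [ix]. *)
pose s := 0 :: sort <=%R tt.
have sz : size s = N.+1 by rewrite /= size_sort size_tuple.
have s01 i : (i <= N)%N -> 0 <= nth 0 s i <= 1.
  move=> iN; have : nth 0 s i \in s by rewrite mem_nth// sz.
  rewrite inE => /orP[/eqP ->|]; first by rewrite lexx ler01.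
  by rewrite mem_sort => /tnthP[j ->].
have s_nd i j : (i <= j)%N -> (j <= N)%N -> nth 0 s i <= nth 0 s j.
  move=> ij jN.
  have ss : sorted <=%R s.
    rewrite /s /= path_sortedE; last exact: le_trans.
    rewrite sort_le_sorted andbT; apply/allP => x; rewrite mem_sort => /tnthP[k ->].
    by have /andP[] := tt01 k.
  by apply: (sorted_leq_nth le_trans le_refl 0 ss) => //; rewrite inE sz ltnS// (leq_trans ij).
pose ix (i : 'I_N) := (index (tnth tt i) (sort <=%R tt)).+1.
have ixE i : nth 0 s (ix i) = tnth tt i.
  by rewrite /= nth_index// mem_sort mem_tnth.
have ixN i : (ix i <= N)%N.
  by rewrite /ix -[X in (_ < X)%N](size_tuple tt) -(size_sort <=%R) index_mem mem_sort mem_tnth.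
have := @cell_process_law_sorted sigma N (nth 0 s) ix H s_lt s_inj erefl s01 s_nd ixN mH H0.
under [in X in X = _]eq_integral => w _ do under eq_mktuple => i do rewrite ixE.
by under [in X in _ = X]eq_integral => w _ do under eq_mktuple => i do rewrite ixE.
Qed.

End cell_permutation.

Section joint_measurability.
Context (d : measure_display) (T : measurableType d) (R : realType).
Variable P : probability T R.
Variables (V : R -> T -> R) (hV : continuous_brownian P V).

Lemma cbm_jointly_measurable : measurable_fun setT (fun p : R * T => V p.1 p.2).
Proof.
pose c (p : R * T) : R := clip 1 p.1.
have mc : measurable_fun setT c.
  have mclip : measurable_fun setT (clip 1 : R -> R).
    by apply: continuous_measurable_fun; exact: continuous_clip.
  exact: (measurableT_comp mclip (@measurable_fst _ _ R T)).
(* The path is frozen at the left end of a mesh interval. The index runs up to [n.+1], one beyond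
   the intervals that partition [[0, 1[], to cover the time 1. *)
pose step n (p : R * T) : R := \sum_(k < n.+2)
  ((k%:R / n.+1%:R <= c p < k.+1%:R / n.+1%:R)%R%:R) * V (k%:R / n.+1%:R) p.2.
apply: (@measurable_fun_cvg _ _ _ _ step) => [n|p _].
  apply: measurable_sum => k; apply: measurable_funM.
    rewrite (_ : (fun p => _) = \1_(`[k%:R / n.+1%:R, k.+1%:R / n.+1%:R[%classic) \o c).
      by apply: measurableT_comp mc; apply: measurable_indic; exact: measurable_itv.
    by apply/funext => p; rewrite /= indicE mem_setE in_itv.
  by apply: measurableT_comp => //; exact: (cbm_measurable hV).
have stepE n : exists2 s, `|s - c p| <= n.+1%:R^-1 & step n p = V s p.2.
  have /andP[c0 c1] := clip_itv p.1 (@ler01 R).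
  have [k kE] : exists k, k = Num.truncn (c p * n.+1%:R) by eexists.
  have n0 : 0 < n.+1%:R :> R by [].
  have /andP[k1 k2] : k%:R / n.+1%:R <= c p < k.+1%:R / n.+1%:R.
    have := truncn_itv (mulr_ge0 c0 (ltW n0)).
    by rewrite -kE ler_pdivrMr// ltr_pdivlMr.
  have kn : (k < n.+2)%N.
    rewrite -(ltr_nat R) -(ltr_pM2r (ltac:(by rewrite invr_gt0) : 0 < n.+1%:R^-1 :> R)).
    apply: le_lt_trans k1 _; apply: le_lt_trans c1 _.
    by rewrite ltr_pdivlMr// mul1r ltr_nat.
  exists (k%:R / n.+1%:R).
    rewrite ler_norml; move: k2; rewrite -[k.+1%:R]natr1 mulrDl mul1r => k2.
    have : 0 < n.+1%:R^-1 :> R by rewrite invr_gt0.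
    by move: k1 k2; move: (_^-1) (_ / _) (c p) => x y z *; apply/andP; split; lra.
  rewrite /step (bigD1 (Ordinal kn))//= k1 k2 mul1r big1 ?addr0// => j nj.
  rewrite (_ : (_ && _) = false) ?mul0r//; apply/negbTE; apply: contraNN nj => /andP[j1 j2].
  have lt_cell (a b : nat) : a%:R / n.+1%:R <= c p -> c p < b.+1%:R / n.+1%:R -> (a <= b)%N.
    move=> h1 h2; rewrite -ltnS -(ltr_nat R).
    rewrite -(ltr_pM2r (ltac:(by rewrite invr_gt0) : 0 < n.+1%:R^-1 :> R)).
    exact: le_lt_trans h1 h2.
  by apply/eqP/val_inj => /=; apply/eqP; rewrite eqn_leq !lt_cell.
rewrite -(cbm_clip hV) -/(c p).
apply/cvgrPdist_lt => e e0.
have hc : V t p.2 @[t --> c p] --> V (c p) p.2 by exact: (cbm_continuous hV).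
have /cvgrPdist_lt/(_ e e0) [r /= r0 hr] := hc.
near=> n; have [s hs ->] := stepE n.
apply: hr; rewrite /ball /= distrC; apply: le_lt_trans hs _.
by near: n; exact: near_infty_natSinv_lt (PosNum r0).
Unshelve. all: by end_near. Qed.

End joint_measurability.

Section swap_process.
Context (d : measure_display) (T : measurableType d) (R : realType).
Variable P : probability T R.
Variables (V : R -> T -> R) (hV : continuous_brownian P V).
(* [m] blocks of [M.+2] cells each *)
Variables (m M : nat) (m0 : (0 < m)%N).
Let Q := (m * M.+2)%N.
Let h : R := Q%:R^-1.

Definition block_start (j : nat) : R := (j * M.+2)%:R * h.
Definition block_last (j : nat) : R := (j * M.+2 + M.+1)%:R * h.

(* The effect on the path of exchanging the increments over the first and the
   last cell of block [j]. *)
Definition swap_shift (j : nat) (t : R) (w : T) : R :=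
  let a := clip h (t - block_start j) in let b := clip h (t - block_last j) in
  (V (block_last j + a) w - V (block_start j + a) w) -
  (V (block_last j + b) w - V (block_start j + b) w).

Definition swap_process (fr : nat -> bool) (t : R) (w : T) : R :=
  V t w + \sum_(j < m) (if fr j then swap_shift j t w else 0).

Let swap_cells (fr : nat -> bool) (z : nat) : nat :=
  let j := (z %/ M.+2)%N in
  if fr j then
    if (z %% M.+2 == 0)%N then (j * M.+2 + M.+1)%N
    else if (z %% M.+2 == M.+1)%N then (j * M.+2)%N else z
  else z.

Let Q0 : (0 < Q)%N. Proof. by rewrite muln_gt0 m0. Qed.
Let h0 : 0 < h. Proof. by rewrite invr_gt0 ltr0n. Qed.
Let Qh : Q%:R * h = 1. Proof. by rewrite /h divff// pnatr_eq0 -lt0n. Qed.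

Let cellE j i : (i < M.+2)%N -> ((j * M.+2 + i) %/ M.+2 = j /\ (j * M.+2 + i) %% M.+2 = i)%N.
Proof. by move=> iM; rewrite divnMDl// modnMDl divn_small// addn0 modn_small. Qed.

Let swap_cellsE (fr : nat -> bool) j i : (i < M.+2)%N -> swap_cells fr (j * M.+2 + i) =
  (j * M.+2 + (if fr j then if i == 0 then M.+1 else if i == M.+1 then 0 else i else i))%N.
Proof.
move=> iM; have [h1 h2] := cellE j iM; rewrite /swap_cells h1 h2.
by case: (fr j) => //; case: eqP => // _; case: eqP => // _; rewrite addn0.
Qed.

Let swap_index_lt (fr : nat -> bool) j i : (i < M.+2)%N ->
  ((if fr j then if i == 0 then M.+1 else if i == M.+1 then 0 else i else i) < M.+2)%N.
Proof. by move=> iM; case: (fr j) => //; case: eqP => // _; case: eqP. Qed.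

Let swap_cells_lt (fr : nat -> bool) z : (z < Q)%N -> (swap_cells fr z < Q)%N.
Proof.
move=> zQ; rewrite (divn_eq z M.+2) swap_cellsE ?ltn_pmod//.
have jm : (z %/ M.+2 < m)%N by rewrite ltn_divLR.
have := swap_index_lt fr (z %/ M.+2) (ltn_pmod z (ltn0Sn M.+1)).
set i := (if _ then _ else _) => iM.
apply: (@leq_trans ((z %/ M.+2).+1 * M.+2)); last by rewrite leq_mul2r.
by rewrite mulSnr ltn_add2l.
Qed.

Let swap_cellsK (fr : nat -> bool) z : swap_cells fr (swap_cells fr z) = z.
Proof.
have main j i : (i < M.+2)%N ->
    swap_cells fr (swap_cells fr (j * M.+2 + i)) = (j * M.+2 + i)%N.
  move=> iM; rewrite swap_cellsE// swap_cellsE; last exact: swap_index_lt.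
  case: (fr j) => //; have [->|i0] := eqVneq i 0%N; first by rewrite eqxx.
  have [->|i1] := eqVneq i M.+1; first by [].
  by rewrite (negbTE i0) (negbTE i1).
by rewrite (divn_eq z M.+2) main// ltn_pmod.
Qed.

(** This brings [cell_process_law] to bear: block by block, the permutation changes only the
    summands of the first and the last cell, and their change is [swap_shift]. *)
Lemma swap_process_cell (fr : nat -> bool) t w : 0 <= t <= 1 ->
  swap_process fr t w = cell_process V Q (swap_cells fr) t w.
Proof.
move=> t01; rewrite /swap_process -(cell_process_id hV Q0 w t01).
pose g y z := V (y%:R * h + clip h (t - z%:R * h)) w - V (y%:R * h) w.
suff E m' : \sum_(z < m' * M.+2) (g (swap_cells fr z) z - g z z) =
    \sum_(j < m') (if fr j then swap_shift j t w else 0).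
  by rewrite -E /Q sumrB /cell_process -/Q -/h addrC subrK.
elim: m' => [|m' IH]; first by rewrite mul0n !big_ord0.
rewrite mulSnr big_split_ord /= IH [in RHS]big_ord_recr /=; congr (_ + _).
rewrite big_ord_recl big_ord_recr /= big1 ?add0r; last first.
  move=> i _; rewrite /bump /= add1n swap_cellsE; last by rewrite ltnS ltnW// ltnS.
  case: (fr m') => /=; last by rewrite subrr.
  by rewrite (_ : (i.+1 == M.+1) = false) ?subrr// eqSS ltn_eqF.
rewrite /bump /= add1n !swap_cellsE// eqxx /=.
case: (fr m'); last by rewrite !subrr addr0.
rewrite eqxx addn0 /g /swap_shift /block_start /block_last; ring.
Qed.

Lemma swap_process_law (fr : nat -> bool) N (tt : N.-tuple R) (H : N.-tuple R -> \bar R) :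
  (forall i, 0 <= tnth tt i <= 1) ->
  measurable_fun setT H -> (forall x, 0 <= H x)%E ->
  (\int[P]_w H [tuple swap_process fr (tnth tt i) w | i < N] =
   \int[P]_w H [tuple V (tnth tt i) w | i < N])%E.
Proof.
move=> tt01 mH H0.
rewrite -(cell_process_law hV Q0 (sigma := swap_cells fr))//; last 2 first.
- exact: swap_cells_lt.
- by move=> z z' _ _ e; rewrite -(swap_cellsK fr z) e swap_cellsK.
apply: eq_integral => w _; congr H; apply: eq_from_tnth => i.
by rewrite !tnth_mktuple swap_process_cell.
Qed.

Lemma block_next j : block_last j + h = block_start j.+1.
Proof. by rewrite /block_last /block_start mulSnr [(_ + M.+2)%N]addnS -[in RHS]natr1 mulrDl mul1r. Qed.

Lemma block_lastE j : block_last j = block_start j + M.+1%:R * h.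
Proof. by rewrite /block_last /block_start natrD mulrDl. Qed.

Lemma block_start_le j : block_start j + h <= block_last j.
Proof.
by rewrite block_lastE lerD2l -[leLHS]mul1r ler_pM2r// ler1n.
Qed.

(** At the end of the block both increments have been added, only in the other order; so the path is
    altered strictly inside the block alone. *)
Lemma swap_shift_out j t w : t <= block_start j \/ block_start j.+1 <= t ->
  swap_shift j t w = 0.
Proof.
have hp : 0 < h := h0.
have := block_start_le j; have := block_next j => E le [] tj; rewrite /swap_shift.
  by rewrite !clip_le0 ?subrr//; lra.
by rewrite !clip_ge ?subrr//; try lra; exact: ltW.
Qed.

(** The shift is constant in time between the two exchanged cells, so monotonicity of [mu] gives the
    change of the integrand one sign there. *)
Lemma swap_shift_mid j t w : block_start j + h <= t <= block_last j ->
  swap_shift j t w = (V (block_start j.+1) w - V (block_last j) w) -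
                     (V (block_start j + h) w - V (block_start j) w).
Proof.
have hp : 0 < h := h0.
move=> /andP[t1 t2]; rewrite /swap_shift clip_ge; [|exact: ltW|lra].
rewrite clip_le0; last by lra.
by rewrite block_next !addr0; ring.
Qed.

Lemma swap_process_in (fr : nat -> bool) j t w : (j < m)%N -> block_start j <= t <= block_start j.+1 ->
  swap_process fr t w = V t w + (if fr j then swap_shift j t w else 0).
Proof.
move=> jm /andP[t1 t2]; rewrite /swap_process (bigD1 (Ordinal jm))//= big1 ?addr0// => i ij.
case: ifP => // _; apply: swap_shift_out.
have mono a b : (a <= b)%N -> block_start a <= block_start b.
  by move=> ab; rewrite /block_start ler_pM2r// ler_nat leq_mul2r ab orbT.
case: (ltngtP i j) => [lt|lt|e]; last by move/eqP: ij; case; apply: val_inj.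
  by right; apply: le_trans t1; exact: mono.
by left; apply: le_trans t2 _; exact: mono.
Qed.

Lemma swap_process_out (fr : nat -> bool) t w :
  (forall j, (j < m)%N -> fr j -> t <= block_start j \/ block_start j.+1 <= t) ->
  swap_process fr t w = V t w.
Proof.
move=> out; rewrite /swap_process big1 ?addr0// => j _; case: ifP => // frj.
by apply: swap_shift_out; exact: out.
Qed.

Lemma swap_shift_jointly_measurable j :
  measurable_fun setT (fun p : R * T => swap_shift j p.1 p.2).
Proof.
have mV (f : R -> R) : measurable_fun setT f ->
    measurable_fun setT (fun p : R * T => V (f p.1) p.2).
  move=> mf; apply: (measurableT_comp (cbm_jointly_measurable hV)
    (g := fun p : R * T => (f p.1, p.2))).
  apply: measurable_fun_pair => /=; last exact: measurable_snd.
  exact: (measurableT_comp mf (@measurable_fst _ _ R T)).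
have mc (a b : R) : measurable_fun setT (fun t : R => a + clip h (t - b)).
  have mclip : measurable_fun setT (clip h : R -> R).
    by apply: continuous_measurable_fun; exact: continuous_clip.
  have mt : measurable_fun setT (fun t : R => t - b).
    by apply: measurable_funB; [exact: measurable_id|exact: measurable_cst].
  apply: measurable_funD; first exact: measurable_cst.
  exact: (measurableT_comp mclip mt).
have mVc a b := mV _ (mc a b).
by rewrite /swap_shift; do 2 apply: measurable_funB; exact: mVc.
Qed.

Lemma swap_process_jointly_measurable (fr : nat -> bool) :
  measurable_fun setT (fun p : R * T => swap_process fr p.1 p.2).
Proof.
apply: measurable_funD; first exact: (cbm_jointly_measurable hV).
apply: measurable_sum => j; case: (fr j); last exact: measurable_cst.
exact: swap_shift_jointly_measurable.
Qed.

End swap_process.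

(** * Moments of increments and integrals over time *)

Section brownian_increments.
Context (d : measure_display) (T : measurableType d) (R : realType).
Variable P : probability T R.
Variables (V : R -> T -> R) (hV : continuous_brownian P V).

Lemma measurable_position_preimage t (B : set R) : measurable B -> measurable [set w | B (V t w)].
Proof.
by move=> mB; rewrite -[X in measurable X]setTI; apply: (cbm_measurable hV t).
Qed.

Lemma position_normal t (B : set R) : 0 < t -> t <= 1 -> measurable B ->
  P [set w | B (V t w)] = normal_prob 0 (Num.sqrt t) B.
Proof.
move=> t0 t1 mB; have := cbm_normal hV (lexx 0) t0 t1 mB; rewrite subr0 => <-.
by congr (P _); apply/seteqP; split=> w /=; rewrite (cbm_start hV) subr0.
Qed.

Lemma position_incr_independent u s t (B C : set R) :
  0 <= u -> u <= s -> s <= t -> t <= 1 -> measurable B -> measurable C ->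
  P [set w | B (V u w) /\ C (V t w - V s w)] =
  (P [set w | B (V u w)] * P [set w | C (V t w - V s w)%R])%E.
Proof.
move=> u0 us st t1 mB mC.
pose l (b : bool) := if b then 0 else s; pose r b := if b then u else t.
pose D b := if b then B else C.
have := @nonoverlapping_independent _ _ _ P V hV bool l r D.
rewrite big_bool /l /r /D /=.
have -> : [set w | forall k : bool, (if k then B else C)
    (V (if k then u else t) w - V (if k then 0 else s) w)] =
    [set w | B (V u w) /\ C (V t w - V s w)].
  apply/seteqP; split=> w /= h.
    by split; [have := h true; rewrite (cbm_start hV) subr0|exact: (h false)].
  by case: h => h1 h2 [] //; rewrite (cbm_start hV) subr0.
have -> : [set w | B (V u w - V 0 w)] = [set w | B (V u w)].
  by apply/seteqP; split=> w /=; rewrite (cbm_start hV) subr0.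
apply.
- by case; [exact: lexx|exact: le_trans us].
- by case.
- by case; [exact: le_trans us (le_trans st t1)|exact: t1].
- by case; case=> //= _; [left|right].
- by case.
Qed.

(** The event concerns the path at time [u <= s], hence is independent of the increment: under [P]
    restricted to the event, the increment has the normal law multiplied by the probability of the
    event. *)
Lemma incr_abs_moment u s t (B : set R) :
  0 <= u -> u <= s -> s <= t -> t <= 1 -> measurable B ->
  (\int[P]_w (\1_[set w | B (V u w)] w * `|V t w - V s w|)%:E <=
   P [set w | B (V u w)] * (2 * Num.sqrt (t - s))%:E)%E.
Proof.
move=> u0 us st t1 mB; set A := [set w | B (V u w)].
have mA : measurable A by exact: measurable_position_preimage.
have [<-|ne] := eqVneq s t.
  rewrite integral0_eq ?mule_ge0 ?lee_fin ?mulr_ge0//.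
  by move=> w _; rewrite subrr normr0 mulr0.
have lt : s < t by rewrite lt_neqAle ne.
pose D := V t \- V s.
have mD : measurable_fun setT D by apply: measurable_funB; exact: (cbm_measurable hV).
pose nu : {measure set T -> \bar R} := mrestr P mA.
have mD' : measurable_fun setT (D : T -> measurableTypeR R) by exact: mD.
pose fD : {mfun T >-> measurableTypeR R} := HB.pack (D : T -> measurableTypeR R)
  (isMeasurableFun.Build _ _ _ _ _ mD').
have -> : (\int[P]_w (\1_A w * `|V t w - V s w|)%:E = \int[nu]_w `|D w|%:E)%E.
  rewrite (@ge0_integral_density _ _ _ P nu (\1_A))//.
  - by move=> C mC; rewrite integral_indic// /nu /= /mrestr setIC.
  - by apply/measurable_EFinP; exact: (measurableT_comp (@normr_measurable R setT) mD).
have -> : (\int[nu]_w `|D w|%:E = \int[pushforward nu fD]_x `|x|%:E)%E.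
  by rewrite ge0_integral_pushforward//; apply/measurable_EFinP; exact: normr_measurable.
have PA : P A = (fine (P A))%:E by rewrite fineK// fin_num_measure.
rewrite (@ge0_integral_density _ _ _ (normal_prob 0 (Num.sqrt (t - s))) (pushforward nu fD)
  (cst (fine (P A))))//; last 3 first.
- by move=> x; rewrite fine_ge0.
- move=> C mC; rewrite [RHS](integral_cst _ mC (fine (P A))%:E) -PA /pushforward /nu /= /mrestr.
  rewrite (_ : normal_prob 0 _ C = P [set w | C (V t w - V s w)]); last first.
    by rewrite -(cbm_normal hV (le_trans u0 us) lt t1 mC).
  rewrite -(position_incr_independent u0 us st t1 mB mC).
  by congr (P _); apply/seteqP; split=> w [].
- by apply/measurable_EFinP; exact: normr_measurable.
rewrite /= ge0_integralZl//; last 2 first.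
- by apply/measurable_EFinP; exact: normr_measurable.
- by rewrite lee_fin fine_ge0.
by rewrite /= -PA lee_wpmul2l// normal_abs_moment_le// subr_gt0.
Qed.

End brownian_increments.

Section time_integrals.
Context (d : measure_display) (T : measurableType d) (R : realType).
Variable P : probability T R.
Notation leb := (@lebesgue_measure R).
Variables (D : set R) (mD : measurable D).

Section nonnegative.
Variables (F : R * T -> \bar R) (mF : measurable_fun setT F) (F0 : forall p, (0 <= F p)%E).

Let G (p : R * T) := (F p * (\1_D p.1)%:E)%E.

Let mG : measurable_fun setT G.
Proof.
apply: emeasurable_funM => //; apply/measurable_EFinP.
by apply: (measurableT_comp _ (@measurable_fst _ _ R T)); exact: measurable_indic.
Qed.

Let G0 p : (0 <= G p)%E.
Proof. by rewrite mule_ge0// lee_fin. Qed.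

Let GE w : (\int[leb]_(s in D) F (s, w) = \int[leb]_s G (s, w))%E.
Proof.
rewrite integral_mkcond; apply: eq_integral => s _; rewrite patchE /G /= indicE.
by case: ifP => _; rewrite ?mule1 ?mule0.
Qed.

Lemma measurable_time_integral : measurable_fun setT (fun w => \int[leb]_(s in D) F (s, w))%E.
Proof.
under eq_fun do rewrite GE.
exact: (@measurable_fun_fubini_tonelli_G _ _ _ _ _ leb G mG G0).
Qed.

Lemma measurable_space_integral : measurable_fun setT (fun s => \int[P]_w F (s, w))%E.
Proof. exact: (@measurable_fun_fubini_tonelli_F _ _ _ _ _ P F mF F0). Qed.

Lemma tonelli_time : (\int[P]_w \int[leb]_(s in D) F (s, w) =
  \int[leb]_(s in D) \int[P]_w F (s, w))%E.
Proof.
under eq_integral do rewrite GE.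
rewrite -(@fubini_tonelli _ _ _ _ _ leb P G mG G0) [RHS]integral_mkcond.
apply: eq_integral => s _; rewrite patchE /G /= indicE.
case: ifP => _; first by apply: eq_integral => w _; rewrite mule1.
by apply: integral0_eq => w _; rewrite mule0.
Qed.

End nonnegative.

Lemma measurable_time_Rintegral (F : R * T -> R) : measurable_fun setT F ->
  measurable_fun setT (fun w => \int[leb]_(s in D) F (s, w)).
Proof.
move=> mF; have mEF : measurable_fun setT (EFin \o F) by exact/measurable_EFinP.
apply: (measurableT_comp (fine_measurable measurableT)).
under eq_fun do rewrite integralE.
apply: emeasurable_funB.
- have h : measurable_fun setT (fun p => ((EFin \o F)^\+ p)%E) by exact: measurable_funepos.
  have := measurable_time_integral h (fun p => funepos_ge0 _ p).
  by congr (measurable_fun _ _); apply/funext => w; apply: eq_integral => s _; rewrite !funeposE.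
- have h : measurable_fun setT (fun p => ((EFin \o F)^\- p)%E) by exact: measurable_funeneg.
  have := measurable_time_integral h (fun p => funeneg_ge0 _ p).
  by congr (measurable_fun _ _); apply/funext => w; apply: eq_integral => s _; rewrite !funenegE.
Qed.

End time_integrals.

Section bounded_integrands.
Context (R : realType).
Notation leb := (@lebesgue_measure R).
Implicit Types (f g : R -> R) (a b : R).

Lemma lebesgue_itv_length a b : a <= b -> leb `[a, b]%classic = (b - a)%:E.
Proof.
rewrite lebesgue_measure_itv /= lte_fin le_eqVlt => /predU1P[->|->//].
by rewrite ltxx subrr.
Qed.

Lemma bounded_integrable_itv f a b (x y : bool) : measurable_fun setT f ->
  (exists C, forall x, `|f x| <= C) -> leb.-integrable [set` Interval (BSide x a) (BSide y b)] (EFin \o f).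
Proof.
move=> mf [C fC]; apply: measurable_bounded_integrable => //=.
- by rewrite lebesgue_measure_itv /=; case: ifP => _; rewrite ?ltry// -EFinD ltry.
- exact: measurable_funTS.
- exists C; split; first exact: num_real.
  by move=> M CM z _; apply: le_trans (fC z) (ltW CM).
Qed.

Lemma Rintegral_split_cells f (a : nat -> R) q : (forall i, a i <= a i.+1) ->
  measurable_fun setT f -> (exists C, forall x, `|f x| <= C) ->
  \int[leb]_(s in `[a 0%N, a q]) f s = \sum_(i < q) \int[leb]_(s in `[a i, a i.+1]) f s.
Proof.
move=> a_nd mf bf; elim: q => [|q IH]; first by rewrite big_ord0 set_itv1 Rintegral_set1.
have a0q : a 0%N <= a q by elim: (q) => // j /le_trans; apply.
rewrite big_ord_recr /= -IH -(@Rintegral_itv_obnd_cbnd _ (a q)); last exact: bounded_integrable_itv.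
rewrite -(@Rintegral_itvB _ _ (BLeft (a 0%N)) (BRight (a q.+1)) (a q)) ?bnd_simp//.
  by rewrite addrC subrK.
exact: bounded_integrable_itv.
Qed.

End bounded_integrands.

(** * The error along a path of the same law *)

(** Induction through [1 / sqrt (q + 1) <= 2 (sqrt (q + 1) - sqrt q)]. *)
Lemma sum_inv_sqrt (R : realType) q :
  \sum_(i < q) (Num.sqrt i.+1%:R)^-1 <= 2 * Num.sqrt q%:R :> R.
Proof.
elim: q => [|q IH]; first by rewrite big_ord0 mulr_ge0// sqrtr_ge0.
rewrite big_ord_recr /=; apply: le_trans (lerD IH (lexx _)) _.
have x0 : 0 <= Num.sqrt q%:R :> R by exact: sqrtr_ge0.
have y0 : 0 < Num.sqrt q.+1%:R :> R by rewrite sqrtr_gt0.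
have xy : Num.sqrt q.+1%:R ^+ 2 = Num.sqrt q%:R ^+ 2 + 1 :> R.
  by rewrite !sqr_sqrtr// natr1.
move: x0 y0 xy; move: (Num.sqrt q.+1%:R) (Num.sqrt q%:R) => y x x0 y0 xy.
rewrite -lerBrDl -(ler_pM2r y0) mulVf ?gt_eqF//; nra.
Qed.

Section riemann_sums.
Context (d : measure_display) (T : measurableType d) (R : realType).
Variable P : probability T R.
Notation leb := (@lebesgue_measure R).
Variables (V : R -> T -> R) (hV : continuous_brownian P V).

Lemma cbm_bounded w : exists C, forall t, `|V t w| <= C.
Proof.
have cw : {within `[0, 1], continuous (fun t => V t w)}.
  by apply: continuous_subspaceT => t; exact: (cbm_continuous hV).
have [c1 _ h1] := EVT_max (@ler01 R) cw; have [c2 _ h2] := EVT_min (@ler01 R) cw.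
exists (`|V c1 w| + `|V c2 w|) => t; rewrite -(cbm_clip hV).
have t01 : clip 1 t \in `[0, 1] by rewrite in_itv /= clip_itv.
have a1 : V (clip 1 t) w <= V c1 w := h1 _ t01.
have a2 : V c2 w <= V (clip 1 t) w := h2 _ t01.
have := ler_norm (V c1 w); have := ler_norm (- V c2 w); rewrite normrN.
have := normr_ge0 (V c1 w); have := normr_ge0 (V c2 w).
by rewrite ler_norml => *; apply/andP; split; lra.
Qed.

(** Equality in law is asked at finitely many times; [riemann_sum_error], which only compares pairs
    of times, carries it over to the time integral. *)
Record brownian_copy (U : R -> T -> R) : Prop := BrownianCopy {
  copy_measurable : measurable_fun setT (fun p : R * T => U p.1 p.2);
  copy_bounded : forall w, exists C, forall t, `|U t w| <= C;
  copy_law : forall N (tt : N.-tuple R) (H : N.-tuple R -> \bar R),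
    (forall i, 0 <= tnth tt i <= 1) ->
    measurable_fun setT H -> (forall x, 0 <= H x)%E ->
    (\int[P]_w H [tuple U (tnth tt i) w | i < N] =
     \int[P]_w H [tuple V (tnth tt i) w | i < N])%E
}.

Lemma cbm_copy : brownian_copy V.
Proof.
split=> //; last exact: cbm_bounded.
exact: (cbm_jointly_measurable hV).
Qed.

Lemma copy_measurable_at U t : brownian_copy U -> measurable_fun setT (U t).
Proof.
move=> hU; apply: (measurableT_comp (copy_measurable hU) (g := fun w => (t, w))).
exact: pair1_measurable.
Qed.

Variables (mu : R -> R) (ndmu : nondecreasing_fun mu).
Variables (bp : seq R) (C : R) (C0 : 0 < C).
Hypothesis modulus : forall x y, `|mu x - mu y| <=
    C * (`|x - y| + \sum_(z <- bp) (`|y - z| <= `|x - y|)%R%:R).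

Lemma measurable_drift : measurable_fun setT mu.
Proof. by apply: nondecreasing_measurable. Qed.

Lemma incr_abs_expectation s t : 0 <= s -> s <= t -> t <= 1 ->
  (\int[P]_w `|V t w - V s w|%:E <= (2 * Num.sqrt (t - s))%:E)%E.
Proof.
move=> s0 st t1; have := incr_abs_moment hV (lexx 0) s0 st t1 measurableT.
rewrite (_ : [set w | _] = setT) ?probability_setT ?mul1e; last by apply/seteqP.
by under eq_integral => w _ do rewrite indicT mul1r.
Qed.

(** If a breakpoint lies within the increment of [V r], then either it lies within [theta] of [V r],
    which the normal density makes improbable, or the increment exceeds [theta] and its indicator is
    at most the increment divided by [theta]. *)
Lemma drift_incr_expectation s r theta : 0 <= s -> s <= r -> 0 < r -> r <= 1 -> 0 < theta ->
  (\int[P]_w `|mu (V s w) - mu (V r w)|%:E <=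
   (C * ((1 + (size bp)%:R / theta) * (2 * Num.sqrt (r - s)) +
         (size bp)%:R * (2 * theta / Num.sqrt r)))%:E)%E.
Proof.
move=> s0 sr r0 r1 th0.
pose A z := [set w | `[z - theta, z + theta]%classic (V r w)].
have mA z : measurable (A z).
  by apply: (measurable_position_preimage hV); exact: measurable_itv.
have mV t : measurable_fun setT (V t) by exact: (cbm_measurable hV).
have mD : measurable_fun setT (fun w => `|V r w - V s w|).
  by apply: (measurableT_comp (@normr_measurable R setT)); exact: measurable_funB.
have c10 : 0 <= 1 + (size bp)%:R / theta by rewrite addr_ge0// divr_ge0// ltW.
apply: (@le_trans _ _ (\int[P]_w (C%:E * ((1 + (size bp)%:R / theta)%:E * `|V r w - V s w|%:E +
   \sum_(z <- bp) (\1_(A z) w)%:E)))%E).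
  apply: ge0_le_integral => //.
  - apply/measurable_EFinP; apply: (measurableT_comp (@normr_measurable R setT)).
    by apply: measurable_funB; apply: (measurableT_comp measurable_drift).
  - rewrite (_ : (fun w => _) = EFin \o (fun w => C * ((1 + (size bp)%:R / theta) *
      `|V r w - V s w| + \sum_(z <- bp) \1_(A z) w))); last first.
      by apply/funext => w /=; rewrite sumEFin.
    apply/measurable_EFinP; apply: measurable_funM => //; apply: measurable_funD.
      exact: measurable_funM.
    by apply: measurable_sum => z; exact: measurable_indic.
  - move=> w _; rewrite sumEFin -EFinM lee_fin.
    apply: le_trans (modulus _ _) _; rewrite ler_pM2l// [`|V s w - _|]distrC.
    set D := `|_|; have D0 : 0 <= D by exact: normr_ge0.
    rewrite mulrDl mul1r -addrA lerD2l mulrAC -mulrA.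
    rewrite (_ : (size bp)%:R * (D / theta) = \sum_(z <- bp) D / theta); last first.
      by rewrite big_const_seq count_predT iter_addr_0 mulr_natl.
    rewrite -big_split /=; apply: ler_sum => z _; rewrite indicE.
    have Dt : 0 <= D / theta by rewrite divr_ge0// ltW.
    case: (leP `|V r w - z| D) => h; last by rewrite addr_ge0.
    have [in_A|notA] := boolP (w \in A z); first by rewrite lerDr.
    rewrite addr0 /= ler_pdivlMr// mul1r; apply: le_trans h.
    move: notA; rewrite notin_setE /A /= in_itv /= => /negP; rewrite negb_and -!ltNge.
    by rewrite ler_normr => /orP[] ?; apply/orP; [right|left]; lra.
have mDE : measurable_fun setT (fun w => ((1 + (size bp)%:R / theta)%:E * `|V r w - V s w|%:E)%E).
  by apply/measurable_EFinP; exact: measurable_funM.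
have mS : measurable_fun setT (fun w => (\sum_(z <- bp) (\1_(A z) w : R)%:E)%E).
  rewrite [X in measurable_fun _ X](_ : _ = EFin \o (fun w => \sum_(z <- bp) \1_(A z) w)); last first.
    by apply/funext => w /=; rewrite sumEFin.
  by apply/measurable_EFinP; apply: measurable_sum => z; exact: measurable_indic.
rewrite ge0_integralZl//; last 3 first.
- exact: emeasurable_funD.
- by move=> w _; rewrite adde_ge0 ?mule_ge0 ?lee_fin// sume_ge0// => z _; rewrite lee_fin.
- by rewrite lee_fin ltW.
rewrite ge0_integralD//; last 2 first.
- by move=> w _; rewrite mule_ge0 ?lee_fin.
- by move=> w _; rewrite sume_ge0// => z _; rewrite lee_fin.
rewrite ge0_integralZl//; last exact/measurable_EFinP.
rewrite ge0_integral_sum//; last first.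
  by move=> z; apply/measurable_EFinP; exact: measurable_indic.
rewrite EFinM; apply: lee_wpmul2l; first by rewrite lee_fin ltW.
rewrite [X in (_ <= X)%E]EFinD; apply: leeD.
  rewrite EFinM; apply: lee_wpmul2l; first by rewrite lee_fin.
  exact: incr_abs_expectation.
apply: (@le_trans _ _ (\sum_(z <- bp) (2 * theta / Num.sqrt r)%:E)%E).
  apply: lee_sum => z _; rewrite integral_indic// setIT.
  rewrite [X in (X <= _)%E](_ : _ = normal_prob 0 (Num.sqrt r) `[z - theta, z + theta]); last first.
    exact: (position_normal hV r0 r1 (measurable_itv _)).
  apply: le_trans (normal_prob_itv_le r0 _) _; first by lra.
  by rewrite lee_fin ler_pM2r ?invr_gt0 ?sqrtr_gt0//; lra.
by rewrite sumEFin lee_fin big_const_seq count_predT iter_addr_0 [leRHS]mulr_natl.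
Qed.

Definition drift_integral (U : R -> T -> R) (w : T) : R :=
  \int[leb]_(s in `[0, 1]) mu (U s w).

Definition riemann_sum q (U : R -> T -> R) (w : T) : R :=
  \sum_(i < q) mu (U (i.+1%:R / q%:R) w) / q%:R.

Section copies.
Variables (U : R -> T -> R) (hU : brownian_copy U).

Lemma drift_path_measurable w : measurable_fun setT (fun s => mu (U s w)).
Proof.
apply: (measurableT_comp measurable_drift).
apply: (measurableT_comp (copy_measurable hU) (g := fun s => (s, w))).
exact: pair2_measurable.
Qed.

Lemma drift_path_bounded w : exists B, forall s, `|mu (U s w)| <= B.
Proof.
have [B hB] := copy_bounded hU w; exists (`|mu B| + `|mu (- B)|) => s.
have /andP[b1 b2] : - B <= U s w <= B by rewrite -ler_norml.
have := ndmu b1; have := ndmu b2.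
have := ler_norm (mu B); have := ler_norm (- mu (- B)); rewrite normrN.
have := normr_ge0 (mu B); have := normr_ge0 (mu (- B)).
by rewrite ler_norml => *; apply/andP; split; lra.
Qed.

Lemma drift_jointly_measurable : measurable_fun setT (fun p : R * T => mu (U p.1 p.2)).
Proof. exact: (measurableT_comp measurable_drift (copy_measurable hU)). Qed.

Lemma measurable_drift_integral : measurable_fun setT (drift_integral U).
Proof. exact: (measurable_time_Rintegral (measurable_itv _) drift_jointly_measurable). Qed.

Lemma measurable_riemann_sum q : measurable_fun setT (riemann_sum q U).
Proof.
apply: measurable_sum => i; apply: measurable_funM => //.
apply: (measurableT_comp measurable_drift); exact: copy_measurable_at.
Qed.

Lemma copy_drift_incr s r : 0 <= s <= 1 -> 0 <= r <= 1 ->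
  (\int[P]_w `|mu (U s w) - mu (U r w)|%:E = \int[P]_w `|mu (V s w) - mu (V r w)|%:E)%E.
Proof.
move=> s01 r01.
pose H (x : 2.-tuple R) : \bar R := `|mu (tnth x ord0) - mu (tnth x ord_max)|%:E.
have mH : measurable_fun setT H.
  apply/measurable_EFinP; apply: (measurableT_comp (@normr_measurable R setT)).
  by apply: measurable_funB; apply: (measurableT_comp measurable_drift);
    exact: measurable_tnth.
have tt01 i : 0 <= tnth [tuple s; r] i <= 1.
  by case: i => -[|[|//]] i; rewrite /tnth.
have := copy_law hU tt01 mH (fun x => ltac:(by rewrite lee_fin)).
under [in X in X = _ -> _]eq_integral => w _ do rewrite /H !tnth_mktuple /tnth /=.
by under [in X in _ = X -> _]eq_integral => w _ do rewrite /H !tnth_mktuple /tnth /=.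
Qed.

Lemma riemann_sum_error_path q w : (0 < q)%N ->
  `|drift_integral U w - riemann_sum q U w| <= \sum_(i < q)
    \int[leb]_(s in `[i%:R / q%:R, i.+1%:R / q%:R]) `|mu (U s w) - mu (U (i.+1%:R / q%:R) w)|.
Proof.
move=> q0; have q0' : 0 < q%:R :> R by rewrite ltr0n.
have mf := drift_path_measurable w; have bf := drift_path_bounded w.
have := @Rintegral_split_cells R (fun s => mu (U s w)) (fun i => i%:R / q%:R) q.
rewrite /= mul0r divff ?gt_eqF// => E.
rewrite /drift_integral E//; last first.
  by move=> i; rewrite ler_pM2r ?invr_gt0// ler_nat.
rewrite /riemann_sum -sumrB; apply: le_trans (ler_norm_sum _ _ _) _.
apply: ler_sum => i _; set c := `[_, _]%classic; set r := i.+1%:R / q%:R.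
have ic : leb.-integrable c (EFin \o (fun=> mu (U r w))).
  by apply: bounded_integrable_itv => //; exists `|mu (U r w)|.
have iU : leb.-integrable c (EFin \o (fun s => mu (U s w))) by exact: bounded_integrable_itv.
have -> : mu (U r w) / q%:R = \int[leb]_(s in c) mu (U r w).
  rewrite Rintegral_cst; last exact: measurable_itv.
  rewrite [X in _ = _ * fine X](_ : _ = (q%:R^-1)%:E)//.
  apply: (etrans (lebesgue_itv_length _)); first by rewrite ler_pM2r ?invr_gt0// ler_nat.
  by rewrite -mulrBl -natr1 addrAC subrr add0r mul1r.
rewrite -RintegralB//; last exact: measurable_itv.
apply: le_normr_Rintegral; first exact: measurable_itv.
rewrite (_ : _ \o _ = (EFin \o (fun s => mu (U s w))) \- (EFin \o (fun=> mu (U r w))))%E//.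
by apply: integrableB => //; exact: measurable_itv.
Qed.

Lemma riemann_sum_error p : (0 < p)%N ->
  (\int[P]_w `|drift_integral U w - riemann_sum (p ^ 4) U w|%:E <=
   (C * (2 + 6 * (size bp)%:R) / p%:R)%:E)%E.
Proof.
move=> p0; set q := (p ^ 4)%N; have q0 : (0 < q)%N by rewrite expn_gt0 p0.
have pR : 0 < p%:R :> R by rewrite ltr0n.
have qR : 0 < q%:R :> R by rewrite ltr0n.
have sqrtq : Num.sqrt q%:R = p%:R ^+ 2 :> R.
  by rewrite /q natrX (_ : 4 = 2 * 2)%N// exprM sqrtr_sqr ger0_norm// exprn_ge0.
pose c (i : nat) : set R := `[i%:R / q%:R, i.+1%:R / q%:R]%classic.
pose F (i : nat) (x : R * T) := `|mu (U x.1 x.2) - mu (U (i.+1%:R / q%:R) x.2)|.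
have mF i : measurable_fun setT (F i).
  apply: (measurableT_comp (@normr_measurable R setT)); apply: measurable_funB.
    exact: drift_jointly_measurable.
  apply: (measurableT_comp measurable_drift).
  exact: (measurableT_comp (copy_measurable_at _ hU) (@measurable_snd _ _ R T)).
have mc i : measurable (c i) by exact: measurable_itv.
have len i : leb (c i) = (q%:R^-1)%:E.
  apply: (etrans (lebesgue_itv_length _)); first by rewrite ler_pM2r ?invr_gt0// ler_nat.
  by rewrite -mulrBl -natr1 addrAC subrr add0r mul1r.
pose K (i : nat) : R := C * ((1 + (size bp)%:R * p%:R) * (2 / p%:R ^+ 2) +
  (size bp)%:R * (2 / p%:R / (Num.sqrt i.+1%:R / p%:R ^+ 2))).
have FK (i : 'I_q) : (\int[P]_w (\int[leb]_(s in c i) F i (s, w))%:E <= (K i / q%:R)%:E)%E.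
  apply: (@le_trans _ _ (\int[P]_w \int[leb]_(s in c i) (F i (s, w))%:E)%E).
    rewrite le_eqVlt; apply/orP; left; apply/eqP; apply: eq_integral => w _.
    rewrite fineK//; apply: integrable_fin_num => //.
      exact: mc.
    rewrite /c; apply: (@bounded_integrable_itv _ (fun s => F i (s, w))).
      apply: (measurableT_comp (@normr_measurable R setT)); apply: measurable_funB => //.
        exact: drift_path_measurable.
      exact: (@measurable_cst _ _ _ _ _ (mu (U (i.+1%:R / q%:R) w))).
    have [B hB] := drift_path_bounded w; exists (B + B) => s.
    by rewrite /F normr_id; apply: le_trans (ler_normB _ _) _; rewrite lerD.
  rewrite (tonelli_time P (mc i) (F := EFin \o F i)); last 2 first.
  - exact/measurable_EFinP.
  - by move=> x; rewrite /= lee_fin /F.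
  apply: (@le_trans _ _ (\int[leb]_(s in c i) (K i)%:E)%E); last first.
    have -> : (\int[leb]_(s in c i) (K i)%:E = (K i)%:E * leb (c i))%E.
      exact: (integral_cst leb (mc i) (K i)%:E).
    by rewrite [X in (_ * X)%E]len -EFinM.
  apply: ge0_le_integral => //.
  - exact: mc.
  - by move=> s _; apply: integral_ge0 => w _; rewrite lee_fin /F.
  - apply: measurable_funTS; apply: (measurable_space_integral P (F := EFin \o F i)).
      exact/measurable_EFinP.
    by move=> x; rewrite /= lee_fin /F.
  move=> s; rewrite /c /= in_itv /= => /andP[s1 s2].
  have r0 : 0 < i.+1%:R / q%:R :> R by rewrite divr_gt0.
  have r1 : i.+1%:R / q%:R <= 1 :> R by rewrite ler_pdivrMr// mul1r ler_nat.
  have s0 : 0 <= s by apply: le_trans s1; rewrite divr_ge0.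
  rewrite /F /= copy_drift_incr ?s0 ?(le_trans s2)// ?(ltW r0)//.
  have p10 : 0 < p%:R^-1 :> R by rewrite invr_gt0.
  apply: le_trans (drift_incr_expectation s0 s2 r0 r1 p10) _.
  rewrite lee_fin /K ler_pM2l// invrK lerD//; last first.
    by rewrite sqrtrM// sqrtrV// sqrtq.
  rewrite ler_wpM2l ?addr_ge0 ?mulr_ge0// ler_pM2l// -sqrtq -sqrtrV// ler_sqrt ?invr_ge0 ?ler0n//.
  by move: s1; rewrite -natr1 mulrDl mul1r; lra.
apply: (@le_trans _ _ (\int[P]_w (\sum_(i < q) \int[leb]_(s in c i) F i (s, w))%:E)%E).
  apply: ge0_le_integral => //.
  - apply/measurable_EFinP; apply: (measurableT_comp (@normr_measurable R setT)).
    by apply: measurable_funB; [exact: measurable_drift_integral|exact: measurable_riemann_sum].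
  - apply/measurable_EFinP; apply: measurable_sum => i.
    exact: measurable_time_Rintegral.
  - by move=> w _; rewrite lee_fin; exact: riemann_sum_error_path.
under eq_integral do rewrite -sumEFin.
rewrite ge0_integral_sum//; last 2 first.
- by move=> i; apply/measurable_EFinP; exact: measurable_time_Rintegral.
- by move=> i w _; rewrite lee_fin Rintegral_ge0// => s _; rewrite /F.
apply: le_trans (lee_sum _ (fun i _ => FK i)) _; rewrite sumEFin lee_fin.
have qE : q%:R = p%:R ^+ 4 :> R by rewrite /q natrX.
pose A : R := C * ((1 + (size bp)%:R * p%:R) * (2 / p%:R ^+ 2)).
pose B : R := C * (size bp)%:R * 2 / p%:R ^+ 3.
have pn0 : p%:R != 0 :> R by rewrite gt_eqF.
have KE (i : 'I_q) : K i / q%:R = A / q%:R + B * (Num.sqrt i.+1%:R)^-1.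
  have : Num.sqrt i.+1%:R != 0 :> R by rewrite gt_eqF// sqrtr_gt0.
  by rewrite /K /A /B qE; move: (Num.sqrt _) => x x0; field; rewrite pn0 x0.
under eq_bigr do rewrite KE.
rewrite big_split /= sumr_const card_ord -[A / q%:R *+ q]mulr_natr divfK ?gt_eqF// -mulr_sumr.
have B0 : 0 <= B by rewrite /B divr_ge0 ?exprn_ge0 ?mulr_ge0// ltW.
have := ler_wpM2l B0 (sum_inv_sqrt R q); rewrite sqrtq => S.
apply: le_trans (lerD (lexx _) S) _.
have -> : A + B * (2 * p%:R ^+ 2) = C * (2 / p%:R + 6 * (size bp)%:R) / p%:R.
  by rewrite /A /B; field.
rewrite ler_pM2r ?invr_gt0// ler_pM2l// lerD2r ler_pdivrMr// ler_pMr// ler1n.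
done.
Qed.

End copies.

End riemann_sums.

Section copy_error.
Context (d : measure_display) (T : measurableType d) (R : realType).
Variable P : probability T R.
Variables (V : R -> T -> R) (hV : continuous_brownian P V).
Variables (mu : R -> R) (ndmu : nondecreasing_fun mu).
Variables (bp : seq R) (C : R) (C0 : 0 < C).
Hypothesis modulus : forall x y, `|mu x - mu y| <=
    C * (`|x - y| + \sum_(z <- bp) (`|y - z| <= `|x - y|)%R%:R).
Variables (n : nat) (tt : n.-tuple R) (g : n.-tuple R -> R).
Hypotheses (tt01 : forall i, 0 <= tnth tt i <= 1) (mg : measurable_fun setT g).

Definition quadrature_error (I U : R -> T -> R) (w : T) : R :=
  `|drift_integral mu I w - g [tuple U (tnth tt i) w | i < n]|.

Lemma measurable_sample U : brownian_copy P V U ->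
  measurable_fun setT (fun w => g [tuple U (tnth tt i) w | i < n]).
Proof.
move=> hU; apply: (measurableT_comp mg); apply/measurable_fun_tnthP => i.
rewrite (_ : _ \o _ = U (tnth tt i)); first exact: (copy_measurable_at _ hU).
by apply/funext => w /=; rewrite tnth_mktuple.
Qed.

Let riemann_error q (U : R -> T -> R) (w : T) : R :=
  `|riemann_sum mu q U w - g [tuple U (tnth tt i) w | i < n]|.

(** Grid times and observation times are sampled together as one tuple of [q + n] times, since the
    error depends on their joint law. *)
Let riemann_error_law q U : brownian_copy P V U -> (0 < q)%N ->
  (\int[P]_w (riemann_error q U w)%:E = \int[P]_w (riemann_error q V w)%:E)%E.
Proof.
move=> hU q0.
pose tq : (q + n).-tuple R := [tuple match fintype.split i with
  | inl a => a.+1%:R / q%:R | inr b => tnth tt b end | i < q + n].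
have tq01 i : 0 <= tnth tq i <= 1.
  rewrite tnth_mktuple; case: (fintype.split i) => [a|b]; last exact: tt01.
  by rewrite divr_ge0//= ler_pdivrMr ?ltr0n// mul1r ler_nat.
pose H (x : (q + n).-tuple R) : \bar R := `|\sum_(a < q) mu (tnth x (lshift n a)) / q%:R -
  g [tuple tnth x (rshift q b) | b < n]|%:E.
have mH : measurable_fun setT H.
  apply/measurable_EFinP; apply: (measurableT_comp (@normr_measurable R setT)).
  apply: measurable_funB.
    apply: measurable_sum => a; apply: measurable_funM => //.
    by apply: (measurableT_comp (measurable_drift ndmu)); exact: measurable_tnth.
  apply: (measurableT_comp mg); apply/measurable_fun_tnthP => b.
  rewrite (_ : _ \o _ = (fun x => tnth x (rshift q b))); first exact: measurable_tnth.
  by apply/funext => x /=; rewrite tnth_mktuple.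
have HE U' w : H [tuple U' (tnth tq i) w | i < q + n] = (riemann_error q U' w)%:E.
  rewrite /H /riemann_error; congr (`|_ - g _|%:E).
    apply: eq_bigr => a _; rewrite !tnth_mktuple.
    by rewrite (unsplitK (inl a : 'I_q + 'I_n)).
  apply: eq_from_tnth => b; rewrite !tnth_mktuple.
  by rewrite (unsplitK (inr b : 'I_q + 'I_n)).
have := copy_law hU tq01 mH (fun x => ltac:(by rewrite lee_fin)).
under [in X in X = _ -> _]eq_integral => w _ do rewrite HE.
by under [in X in _ = X -> _]eq_integral => w _ do rewrite HE.
Qed.

(** The triangle inequality is used twice, to replace the integral by the Riemann sum along [U] and
    back along [V]; each replacement costs at most [B / p] for arbitrary [p]. *)
Lemma copy_error_le U : brownian_copy P V U ->
  (\int[P]_w (quadrature_error U U w)%:E <= \int[P]_w (quadrature_error V V w)%:E)%E.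
Proof.
move=> hU; apply/lee_addgt0Pr => e e0.
pose B := C * (2 + 6 * (size bp)%:R); have B0 : 0 < B by rewrite mulr_gt0// ltr_wpDr// mulr_ge0.
have [p p0 pe] : exists2 p, (0 < p)%N & B / p%:R + B / p%:R <= e.
  exists (Num.truncn (2 * B / e)).+1 => //.
  rewrite -mulrDl ler_pdivrMr ?ltr0n// mulrC -ler_pdivrMr//.
  by rewrite (_ : B + B = 2 * B); [exact: ltW (truncnS_gt _)|ring].
pose q := (p ^ 4)%N; have q0 : (0 < q)%N by rewrite expn_gt0 p0.
have mI U' : brownian_copy P V U' -> measurable_fun setT (drift_integral mu U').
  exact: measurable_drift_integral.
have mR U' : brownian_copy P V U' -> measurable_fun setT (riemann_sum mu q U').
  by move=> h; exact: (measurable_riemann_sum ndmu h).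
have mabs (f f' : T -> R) : measurable_fun setT f -> measurable_fun setT f' ->
    measurable_fun setT (fun w => `|f w - f' w|%:E).
  move=> mf mf'; apply/measurable_EFinP; apply: (measurableT_comp (@normr_measurable R setT)).
  exact: measurable_funB.
have half (f f' f'' : T -> R) : measurable_fun setT f -> measurable_fun setT f' ->
    measurable_fun setT f'' -> (\int[P]_w `|f w - f'' w|%:E <=
      \int[P]_w `|f' w - f'' w|%:E + \int[P]_w `|f w - f' w|%:E)%E.
  move=> mf mf' mf''; rewrite -ge0_integralD//; last 2 first.
  - exact: mabs.
  - exact: mabs.
  apply: ge0_le_integral => //.
  - exact: mabs.
  - by apply: emeasurable_funD; exact: mabs.
  - move=> w _; rewrite -EFinD lee_fin.
    apply: le_trans (ler_normD _ _).
    by rewrite (_ : f' w - f'' w + (f w - f' w) = f w - f'' w); [exact: lexx|ring].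
have hV' : brownian_copy P V V by exact: cbm_copy.
have eU := riemann_sum_error hV ndmu C0 modulus hU p0.
have eV := riemann_sum_error hV ndmu C0 modulus hV' p0.
apply: le_trans (half _ _ _ (mI _ hU) (mR _ hU) (measurable_sample hU)) _.
rewrite [X in (X + _ <= _)%E](riemann_error_law hU q0).
have := half _ _ _ (mR _ hV') (mI _ hV') (measurable_sample hV').
move=> h; apply: le_trans (leeD h (lexx _)) _; rewrite -addeA leeD2l//.
apply: (@le_trans _ _ ((B / p%:R)%:E + (B / p%:R)%:E)%E); last by rewrite -EFinD lee_fin.
apply: leeD => //.
by under eq_integral do rewrite distrC.
Qed.

End copy_error.

(** * Averages over signs *)

(** The quartic touches [|x|] at [0], [K] and [- K]. It turns an upper bound on a fourth moment and
    a lower bound on a second moment into a lower bound on a first moment; [K] should be of the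
    typical size of [x]. *)
Lemma abs_ge_tangent (R : realType) (K x : R) : 0 < K ->
  3 / (2 * K) * x ^+ 2 - x ^+ 4 / (2 * K ^+ 3) <= `|x|.
Proof.
move=> K0; rewrite -(real_normK (num_real x)) (_ : x ^+ 4 = `|x| ^+ 4); last first.
  by rewrite (exprM x 2 2) -(real_normK (num_real x)) -exprM.
have : 0 <= `|x| by []; move: (`|x|) => u u0.
rewrite -subr_ge0.
have -> : u - (3 / (2 * K) * u ^+ 2 - u ^+ 4 / (2 * K ^+ 3)) =
    u * (u - K) ^+ 2 * (u + 2 * K) / (2 * K ^+ 3) by field; rewrite gt_eqF.
have K1 := ltW K0.
have K2 : 0 <= 2 * K ^+ 3 by rewrite mulr_ge0// exprn_ge0.
have uK : 0 <= u + 2 * K by rewrite addr_ge0// mulr_ge0.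
by apply: divr_ge0 => //; apply: mulr_ge0 => //; rewrite mulr_ge0// sqr_ge0.
Qed.

Section rademacher_averages.
Context (R : realType).
Implicit Types (b : nat -> R) (F G : R -> R).

(* The expectation of [F (x + sum of (+/- b j) for j < m)] over independent fair signs. *)
Fixpoint sign_average b (m : nat) F (x : R) : R :=
  if m is m'.+1 then (sign_average b m' F (x + b m') + sign_average b m' F (x - b m')) / 2
  else F x.

Lemma sign_average_le b m F G x : (forall y, F y <= G y) ->
  sign_average b m F x <= sign_average b m G x.
Proof.
move=> FG; elim: m x => [//|m IH] x /=.
by rewrite ler_pM2r// lerD.
Qed.

Lemma sign_average_cst b m (c x : R) : sign_average b m (fun=> c) x = c.
Proof. by elim: m x => [//|m IH] x /=; rewrite !IH; field. Qed.

Lemma sign_average_comb b m F G (k l : R) x :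
  sign_average b m (fun y => k * F y - l * G y) x =
  k * sign_average b m F x - l * sign_average b m G x.
Proof. by elim: m x => [//|m IH] x /=; rewrite !IH; field. Qed.

Lemma sign_average_sqr b m x :
  sign_average b m (fun y => y ^+ 2) x = x ^+ 2 + \sum_(j < m) b j ^+ 2.
Proof.
elim: m x => [|m IH] x /=; first by rewrite big_ord0 addr0.
by rewrite !IH big_ord_recr /=; field.
Qed.

(** The bound is the fourth moment of a Gaussian variable with the same mean and variance; each sign
    leaves a surplus proportional to [c ^ 4]. *)
Lemma sign_average_exp4 b m x : sign_average b m (fun y => y ^+ 4) x <=
  x ^+ 4 + 6 * x ^+ 2 * (\sum_(j < m) b j ^+ 2) + 3 * (\sum_(j < m) b j ^+ 2) ^+ 2.
Proof.
elim: m x => [|m IH] x /=.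
  by rewrite big_ord0 expr0n /= !mulr0 !addr0.
rewrite ler_pdivrMr//; apply: le_trans (lerD (IH _) (IH _)) _.
rewrite big_ord_recr /=; move: (\sum_(j < m) _) (b m) => S c.
rewrite -subr_ge0; set y := (X in 0 <= X).
have -> : y = 4 * c ^+ 4 by rewrite /y; ring.
by rewrite mulr_ge0// exprn_even_ge0.
Qed.

(** Together with evenness, convexity shows that the average is smallest at centre 0; this removes
    an unknown centre. *)
Lemma sign_average_abs_convex b m x y :
  2 * sign_average b m Num.norm ((x + y) / 2) <=
  sign_average b m Num.norm x + sign_average b m Num.norm y.
Proof.
elim: m x y => [|m IH] x y /=.
  rewrite normrM [`|2^-1|]ger0_norm ?invr_ge0// mulrCA mulfV ?pnatr_eq0// mulr1.
  exact: ler_normD.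
have h1 := IH (x + b m) (y + b m); have h2 := IH (x - b m) (y - b m).
have e1 : (x + b m + (y + b m)) / 2 = (x + y) / 2 + b m by field.
have e2 : (x - b m + (y - b m)) / 2 = (x + y) / 2 - b m by field.
rewrite e1 in h1; rewrite e2 in h2; lra.
Qed.

Lemma sign_average_absN b m x :
  sign_average b m Num.norm (- x) = sign_average b m Num.norm x.
Proof.
elim: m x => [|m IH] x /=; first by rewrite normrN.
have -> : - x + b m = - (x - b m) by ring.
have -> : - x - b m = - (x + b m) by ring.
by rewrite !IH [_ + sign_average _ _ _ _]addrC.
Qed.

(* By comparison of |x| with a quartic polynomial. *)
Lemma khintchine_abs b m x :
  Num.sqrt (\sum_(j < m) b j ^+ 2) / 2 <= sign_average b m Num.norm x.
Proof.
set S := \sum_(j < m) b j ^+ 2.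
have S0 : 0 <= S by apply: sumr_ge0 => j _; exact: sqr_ge0.
apply: (@le_trans _ _ (sign_average b m Num.norm 0)); last first.
  have := sign_average_abs_convex b m x (- x).
  by rewrite sign_average_absN subrr mul0r; lra.
have [/eqP s0|s0] := boolP (S == 0).
  rewrite s0 sqrtr0 mul0r.
  have := sign_average_le b m 0 (F := fun=> 0) (G := Num.norm) (fun y => normr_ge0 y).
  by rewrite sign_average_cst.
have {}s0 : 0 < S by rewrite lt_neqAle eq_sym s0.
pose r := Num.sqrt S; have r0 : 0 < r by rewrite sqrtr_gt0.
have rS : r ^+ 2 = S by rewrite sqr_sqrtr.
(* [3 / 2] is a rational substitute for the optimal factor [sqrt 3]: the quadratic term gives [r],
   the quartic one at most [4 / 9 * r], and [5 / 9] exceeds the claimed [1 / 2]. *)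
pose K := 3 / 2 * r; have K0 : 0 < K by rewrite mulr_gt0.
apply: (@le_trans _ _ (sign_average b m (fun y => 3 / (2 * K) * y ^+ 2 - (2 * K ^+ 3)^-1 * y ^+ 4) 0)); last first.
  by apply: sign_average_le => y; have := abs_ge_tangent y K0; rewrite [_ / (2 * K ^+ 3)]mulrC.
rewrite sign_average_comb sign_average_sqr expr0n /= add0r -/S.
have h4 := sign_average_exp4 b m 0.
rewrite /= -/S !expr0n /= mulr0 mul0r !add0r in h4.
have k3 : 0 <= (2 * K ^+ 3)^-1 by rewrite invr_ge0 mulr_ge0// exprn_ge0// ltW.
have := ler_wpM2l k3 h4; rewrite -/r.
have -> : (2 * K ^+ 3)^-1 * (3 * S ^+ 2) = 4 / 9 * r.
  by rewrite /K -rS; field; rewrite gt_eqF.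
have -> : 3 / (2 * K) * S = r by rewrite /K -rS; field; rewrite gt_eqF.
by move: r0; lra.
Qed.

(** The uniform average of [f] over the indicators of all subsets of the first [m] indices, the last
    index being decided first. *)
Fixpoint subset_average (m : nat) (f : (nat -> bool) -> R) : R :=
  if m is m'.+1 then
    (subset_average m' (fun e => f (fun j => (j == m') || (j < m')%N && e j)) +
     subset_average m' (fun e => f (fun j => (j < m')%N && e j))) / 2
  else f (fun=> false).

Lemma subset_average_ext m f f' : (forall e, f e = f' e) ->
  subset_average m f = subset_average m f'.
Proof. by move=> ff'; congr subset_average; apply/funext. Qed.

(** Taking or omitting [b j] means [b j / 2] plus or minus [b j / 2]: random subsets are random
    signs around a shifted centre. *)
Lemma subset_average_sign b m F x :
  subset_average m (fun e => F (x + \sum_(j < m) (if e j then b j else 0))) =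
  sign_average (fun j => b j / 2) m F (x + \sum_(j < m) b j / 2).
Proof.
elim: m x => [|m IH] x /=; first by rewrite !big_ord0.
have E (e : nat -> bool) (c : bool) : \sum_(j < m.+1) (if (c && (j == m :> nat)) || (j < m)%N && e j then b j else 0)
    = \sum_(j < m) (if e j then b j else 0) + (if c then b m else 0).
  rewrite big_ord_recr /= eqxx ltnn andbT orbF; congr (_ + _).
  by apply: eq_bigr => j _; rewrite ltn_ord ltn_eqF// andbF.
rewrite [in RHS]big_ord_recr /=.
rewrite (_ : x + (\sum_(i < m) b i / 2 + b m / 2) + b m / 2 = (x + b m) + \sum_(i < m) b i / 2); last by field.
rewrite (_ : x + (\sum_(i < m) b i / 2 + b m / 2) - b m / 2 = x + \sum_(i < m) b i / 2); last by field.
rewrite -!IH; congr ((_ + _) / 2); apply: subset_average_ext => e.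
  by rewrite (E e true) /=; congr F; ring.
by rewrite (E e false) addr0.
Qed.

End rademacher_averages.

Section average_integral.
Context (d : measure_display) (T : measurableType d) (R : realType).
Variable P : probability T R.

Lemma subset_average_integral_le m (f : (nat -> bool) -> T -> R) (E : \bar R) :
  (forall e, measurable_fun setT (f e)) -> (forall e w, 0 <= f e w) ->
  (forall e, (\int[P]_w (f e w)%:E <= E)%E) ->
  [/\ measurable_fun setT (fun w => subset_average m (fun e => f e w)),
      forall w, 0 <= subset_average m (fun e => f e w) &
      (\int[P]_w (subset_average m (fun e => f e w))%:E <= E)%E].
Proof.
elim: m f => [|m IH] f mf f0 fE /=; first by split.
have [m1 p1 i1] := IH (fun e => f (fun j => (j == m) || (j < m)%N && e j))
  (fun e => mf _) (fun e => f0 _) (fun e => fE _).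
have [m2 p2 i2] := IH (fun e => f (fun j => (j < m)%N && e j))
  (fun e => mf _) (fun e => f0 _) (fun e => fE _).
split.
- by apply: measurable_funM => //; exact: measurable_funD.
- by move=> w; rewrite divr_ge0// addr_ge0.
under eq_integral do rewrite EFinM EFinD.
rewrite ge0_integralZr//; last 2 first.
- by apply: emeasurable_funD; exact/measurable_EFinP.
- by move=> w _; rewrite adde_ge0 ?lee_fin.
rewrite ge0_integralD//; last 4 first.
- by move=> w _; rewrite lee_fin.
- exact/measurable_EFinP.
- by move=> w _; rewrite lee_fin.
- exact/measurable_EFinP.
apply: (@le_trans _ _ ((E + E) * (2^-1)%:E)%E).
  by rewrite lee_wpmul2r ?lee_fin ?invr_ge0// leeD.
case: E {IH fE i1 i2} => [r| |]; rewrite ?leey//.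
  by rewrite -EFinD -EFinM lee_fin; lra.
by rewrite addeNy mulNyr gtr0_sg ?invr_gt0// mul1e.
Qed.

End average_integral.

(** * Crossing the jump *)

Section crossing_probabilities.
Context (d : measure_display) (T : measurableType d) (R : realType).
Variable P : probability T R.
Variables (V : R -> T -> R) (hV : continuous_brownian P V).
Variable (x0 : R).

Definition near_level (r u : R) : set T := [set w | `[x0 - r, x0 + r]%classic (V u w)].

Lemma measurable_near_level r u : measurable (near_level r u).
Proof. by apply: (measurable_position_preimage hV); exact: measurable_itv. Qed.

Lemma sqrt_half_le u : 2^-1 <= u -> 2^-1 <= Num.sqrt u :> R.
Proof.
move=> u2; rewrite -(@ler_pXn2r _ 2) ?nnegrE ?sqrtr_ge0 ?invr_ge0// sqr_sqrtr; last by lra.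
by rewrite expr2; lra.
Qed.

(** From time [1 / 2] on the standard deviation is at least [1 / 2], which bounds the density by
    2. *)
Lemma near_level_le r u : 2^-1 <= u -> u <= 1 -> 0 <= r ->
  (P (near_level r u) <= (4 * r)%:E)%E.
Proof.
move=> u2 u1 r0; have u0 : 0 < u by lra.
have -> : P (near_level r u) = normal_prob 0 (Num.sqrt u) `[x0 - r, x0 + r].
  exact: (position_normal hV u0 u1 (measurable_itv _)).
apply: le_trans (normal_prob_itv_le u0 _) _; first by lra.
have s2 := sqrt_half_le u2.
by rewrite lee_fin ler_pdivrMr; [nra|lra].
Qed.

(** Two visits near the level force an increment of size at most [2 * r], and this increment is
    independent of the first position. *)
Lemma near_level_pair_le r u v : 2^-1 <= u -> u < v -> v <= 1 -> 0 <= r ->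
  (P (near_level r u `&` near_level r v) <= (4 * r * (4 * r / Num.sqrt (v - u)))%:E)%E.
Proof.
move=> u2 uv v1 r0; have vu0 : 0 < v - u by rewrite subr_gt0.
have u0 : 0 <= u by lra. have u1 : u <= 1 by lra.
pose D : set R := `[- (2 * r), 2 * r]%classic.
have mD : measurable D by exact: measurable_itv.
apply: (@le_trans _ _ (P [set w | (`[x0 - r, x0 + r]%classic : set R) (V u w) /\ D (V v w - V u w)])).
  apply: le_measure; rewrite ?inE.
  - by apply: measurableI; exact: measurable_near_level.
  - apply: (measurableI _ _ (measurable_near_level r u)).
    exact: (measurable_incr_preimage hV).
  - move=> w [] /=; rewrite /near_level /D /= !in_itv /= => /andP[h1 h2] /andP[h3 h4].
    by split; apply/andP; split; lra.
rewrite (position_incr_independent hV u0 (lexx u) (ltW uv) v1 (measurable_itv _) mD).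
rewrite EFinM; apply: lee_pmul => //; first exact: near_level_le.
rewrite (cbm_normal hV u0 uv v1 mD).
apply: le_trans (normal_prob_itv_le vu0 _) _; first by lra.
by rewrite lee_fin ler_pM2r ?invr_gt0 ?sqrtr_gt0//; lra.
Qed.

(* Exchanging the increments over [u, a] and [b, e] moves the path across the
   level at time [s]. *)
Definition crossing u a s b e : set T := [set w | V s w < x0 /\
  x0 < V s w + ((V e w - V b w) - (V a w - V u w))].

Lemma measurable_crossing u a s b e : measurable (crossing u a s b e).
Proof.
have mV t : measurable_fun setT (V t) by exact: (cbm_measurable hV).
have m2 : measurable_fun setT (fun w => V s w + ((V e w - V b w) - (V a w - V u w))).
  by apply: measurable_funD => //; apply: measurable_funB; exact: measurable_funB.
pose f w := V s w + ((V e w - V b w) - (V a w - V u w)).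
rewrite (_ : crossing u a s b e = (V s @^-1` `]-oo, x0[%classic) `&` (f @^-1` `]x0, +oo[%classic)).
  apply: measurableI; rewrite -[X in measurable X]setTI.
    by apply: (mV s) => //; exact: measurable_itv.
  by apply: m2 => //; exact: measurable_itv.
by apply/seteqP; split=> w; rewrite /crossing /= !in_itv /= andbT => -[? ?]; split.
Qed.

(** The product of the four constants in [crossing_cell_ge]: [324 = 6 * 3 * 6 * 3], and the
    exponents are [4], [4], [9] for the three increments and [2 * (|x0| + 1) ^ 2] for the position
    at a time of at least [1 / 2]. *)
Definition crossing_const : R := expR (- (2 * (`|x0| + 1) ^+ 2 + 17)) / 324.

Lemma crossing_const_gt0 : 0 < crossing_const.
Proof. by rewrite divr_gt0// expR_gt0. Qed.

Lemma four_increments_independent u a s b e (B0 B1 B2 B3 : set R) :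
  0 <= u -> u <= a -> a <= s -> s <= b -> b <= e -> e <= 1 ->
  measurable B0 -> measurable B1 -> measurable B2 -> measurable B3 ->
  P [set w | [/\ B0 (V u w), B1 (V a w - V u w), B2 (V s w - V a w) & B3 (V e w - V b w)]] =
  (P [set w | B0 (V u w)] * P [set w | B1 (V a w - V u w)%R] *
   P [set w | B2 (V s w - V a w)%R] * P [set w | B3 (V e w - V b w)%R])%E.
Proof.
move=> u0 ua as_ sb be e1 mB0 mB1 mB2 mB3.
pose l (i : 'I_4) := nth 0 [:: 0; u; a; b] i; pose r (i : 'I_4) := nth 0 [:: u; a; s; e] i.
pose B (i : 'I_4) := nth setT [:: B0; B1; B2; B3] i.
have := @nonoverlapping_independent _ _ _ P V hV _ l r B.
rewrite !big_ord_recl big_ord0 mule1 !muleA /l /r /B /=.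
have -> : [set w | B0 (V u w - V 0 w)] = [set w | B0 (V u w)].
  by apply/seteqP; split=> w /=; rewrite (cbm_start hV) subr0.
move=> <-.
- congr (P _); apply/seteqP; split=> w /=.
    move=> [h0 h1 h2 h3] [[|[|[|[|//]]]] i] //=.
    by rewrite (cbm_start hV) subr0.
  move=> h; split.
  + by have := h (@Ordinal 4 0 isT); rewrite /= (cbm_start hV) subr0.
  + exact: (h (@Ordinal 4 1 isT)).
  + exact: (h (@Ordinal 4 2 isT)).
  + exact: (h (@Ordinal 4 3 isT)).
- by case=> -[|[|[|[|//]]]] i /=; lra.
- by case=> -[|[|[|[|//]]]] i /=; lra.
- by case=> -[|[|[|[|//]]]] i /=; lra.
- case=> -[|[|[|[|//]]]] i; case=> -[|[|[|[|//]]]] i' //= _; (left; lra) || (right; lra).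
- by case=> -[|[|[|[|//]]]] i.
Qed.

End crossing_probabilities.

Section crossing_lower_bound.
Context (d : measure_display) (T : measurableType d) (R : realType).
Variable P : probability T R.
Variables (V : R -> T -> R) (hV : continuous_brownian P V).
Variable (x0 : R).

(** A scenario of crossing for a start near [x0 + x]: the first increment is a fall by [r] to
    [2 * r], and the middle one brings [V s] between [x0 - 3 * r] and [x0 - r]. Exchanging the fall
    with the rise over the last cell adds more than [3 * r], enough to pass [x0]. *)
Definition crossing_cell x r u a s b e : set T :=
  [set w | [/\ `[x0 + x, x0 + x + r / 2[%classic (V u w),
     `[- (2 * r), - r[%classic (V a w - V u w),
     `[- x - r, - x - r / 2[%classic (V s w - V a w) &
     `[2 * r, 3 * r[%classic (V e w - V b w)]].

(** Independence gives four factors. The position contributes order [r], the length of its interval;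
    the increments over the two cells are of the size of their standard deviation [r] and contribute
    constants; the middle increment, of standard deviation of order [N * r], hits an interval of
    length [r / 2] and contributes order [1 / N]. *)
Lemma crossing_cell_ge N i x r u a s b e :
  (i < N)%N -> x = i%:R * r / 2 ->
  0 < r -> N%:R * r <= 1 -> 2^-1 <= u -> a - u = r ^+ 2 -> e - b = r ^+ 2 ->
  (N%:R * r) ^+ 2 / 4 <= s - a -> s - a <= (N%:R * r) ^+ 2 -> s <= b -> e <= 1 ->
  (((crossing_const x0) * r / N%:R)%:E <= P (crossing_cell x r u a s b e))%E.
Proof.
move=> iN xE r0 Nr1 u2 au eb sa1 sa2 sb e1.
have N0 : 0 < N%:R :> R by rewrite ltr0n (leq_ltn_trans _ iN).
have r2 : 0 < r ^+ 2 by rewrite exprn_gt0.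
have Nr0 : 0 < N%:R * r by rewrite mulr_gt0.
have Nr2 : 0 < (N%:R * r) ^+ 2 by rewrite exprn_gt0.
have u0 : 0 < u by lra. have u1 : u <= 1 by lra.
have u0' : 0 <= u by lra. have ua : u <= a by lra. have as_ : a <= s by lra.
have be : b <= e by lra.
have a1 : a <= 1 by lra. have s1 : s <= 1 by lra. have a0 : 0 <= a by lra.
have ua' : u < a by lra. have as' : a < s by lra. have be' : b < e by lra.
have b0 : 0 <= b by lra. have sa0 : 0 < s - a by lra.
rewrite /crossing_cell (four_increments_independent hV u0' ua as_ sb be e1
  (measurable_itv _) (measurable_itv _) (measurable_itv _) (measurable_itv _)).
have xN : 0 <= x /\ x + r <= N%:R * r.
  rewrite xE; split; first by rewrite divr_ge0// mulr_ge0// ltW.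
  have : i.+1%:R * r <= N%:R * r by rewrite ler_pM2r// ler_nat.
  rewrite -natr1 mulrDl mul1r; have : 0 <= i%:R * r by rewrite mulr_ge0// ltW.
  lra.
have rE : Num.sqrt (r ^+ 2) = r by rewrite sqrtr_sqr ger0_norm// ltW.
have p0 : ((r / 6 * expR (- (2 * (`|x0| + 1) ^+ 2)))%:E <= P [set w | (`[x0 + x, x0 + x + r / 2[%classic (V u w))%R])%E.
  rewrite (position_normal hV u0 u1 (measurable_itv _)).
  apply: (le_trans _ (@normal_prob_itv_ge _ u _ _ (2 * (`|x0| + 1) ^+ 2) u0 _ _)).
  - rewrite lee_fin ler_pM2r ?expR_gt0// (_ : x0 + x + r / 2 - (x0 + x) = r / 2); last by ring.
    have s1' : Num.sqrt u <= 1 by rewrite -sqrtr1 ler_sqrt.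
    have s0' : 0 < Num.sqrt u by rewrite sqrtr_gt0.
    rewrite ler_pdivlMr ?mulr_gt0//.
    have : r * Num.sqrt u <= r by rewrite ler_piMr// ltW.
    by lra.
  - by lra.
  - move=> y /andP[y1 y2]; have [xN1 xN2] := xN.
    have ny : `|y| <= `|x0| + 1.
      have := ler_norm x0; have := ler_norm (- x0); rewrite normrN => *.
      by rewrite ler_norml; apply/andP; split; lra.
    have : `|y| ^+ 2 <= (`|x0| + 1) ^+ 2 by rewrite ler_pXn2r// nnegrE ?addr_ge0.
    rewrite real_normK ?num_real//; have : 0 <= (`|x0| + 1) ^+ 2 by exact: sqr_ge0.
    by move: (_ ^+ 2) => z z0 yz; nra.
have p1 : ((expR (- 4) / 3)%:E <= P [set w | (`[- (2 * r), - r[%classic (V a w - V u w))%R])%E.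
  rewrite (cbm_normal hV u0' ua' a1 (measurable_itv _)) au.
  apply: (le_trans _ (@normal_prob_itv_ge _ (r ^+ 2) _ _ 4 r2 _ _)).
  - rewrite lee_fin rE (_ : - r - - (2 * r) = r); last by ring.
    rewrite (_ : r / (3 * r) = 3^-1); last by field; rewrite gt_eqF.
    by rewrite mulrC.
  - by lra.
  - by move=> y /andP[y1 y2]; nra.
have p2 : ((expR (- 4) / (6 * N%:R))%:E <= P [set w | (`[- x - r, - x - r / 2[%classic (V s w - V a w))%R])%E.
  rewrite (cbm_normal hV a0 as' s1 (measurable_itv _)).
  apply: (le_trans _ (@normal_prob_itv_ge _ (s - a) _ _ 4 sa0 _ _)).
  - rewrite lee_fin (_ : - x - r / 2 - (- x - r) = r / 2); last by field.
    rewrite mulrC ler_pM2r ?expR_gt0//.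
    have sN : Num.sqrt (s - a) <= N%:R * r.
      by rewrite -(ger0_norm (ltW Nr0)) -sqrtr_sqr ler_sqrt// ltW.
    have s0' : 0 < Num.sqrt (s - a) by rewrite sqrtr_gt0.
    rewrite ler_pdivlMr ?mulr_gt0// mulrC ler_pdivrMr ?mulr_gt0//.
    by move: sN; lra.
  - by lra.
  - move=> y /andP[y1 y2]; have [xN1 xN2] := xN; nra.
have p3 : ((expR (- 9) / 3)%:E <= P [set w | (`[2 * r, 3 * r[%classic (V e w - V b w))%R])%E.
  rewrite (cbm_normal hV b0 be' e1 (measurable_itv _)) eb.
  apply: (le_trans _ (@normal_prob_itv_ge _ (r ^+ 2) _ _ 9 r2 _ _)).
  - rewrite lee_fin rE (_ : 3 * r - 2 * r = r); last by ring.
    rewrite (_ : r / (3 * r) = 3^-1); last by field; rewrite gt_eqF.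
    by rewrite mulrC.
  - by lra.
  - by move=> y /andP[y1 y2]; nra.
have -> : (crossing_const x0) * r / N%:R = (r / 6 * expR (- (2 * (`|x0| + 1) ^+ 2))) *
    (expR (- 4) / 3) * (expR (- 4) / (6 * N%:R)) * (expR (- 9) / 3).
  rewrite /crossing_const.
  have -> : expR (- (2 * (`|x0| + 1) ^+ 2 + 17)) =
      expR (- (2 * (`|x0| + 1) ^+ 2)) * expR (- 4) * expR (- 4) * expR (- 9) :> R.
    by rewrite -!expRD; congr expR; ring.
  by field; rewrite gt_eqF.
have e0 z : 0 <= expR z :> R by exact: expR_ge0.
have r0' := ltW r0; have N0' := ltW N0.
rewrite EFinM; apply: lee_pmul => //; rewrite ?lee_fin ?mulr_ge0 ?divr_ge0 ?mulr_ge0//.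
rewrite EFinM; apply: lee_pmul => //; rewrite ?lee_fin ?mulr_ge0 ?divr_ge0 ?mulr_ge0//.
by rewrite EFinM; apply: lee_pmul => //; rewrite ?lee_fin ?mulr_ge0 ?divr_ge0 ?mulr_ge0.
Qed.

(** The scenarios with start offsets [i * r / 2] for [i < N] are disjoint, and summing their
    probabilities of order [r / N] gives order [r]. *)
Lemma crossing_prob_ge N r u a s b e :
  (0 < N)%N -> 0 < r -> N%:R * r <= 1 -> 2^-1 <= u -> a - u = r ^+ 2 -> e - b = r ^+ 2 ->
  (N%:R * r) ^+ 2 / 4 <= s - a -> s - a <= (N%:R * r) ^+ 2 -> s <= b -> e <= 1 ->
  ((crossing_const x0 * r)%:E <=
   P (near_level V x0 (N%:R * r) u `&` crossing V x0 u a s b e))%E.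
Proof.
move=> N0 r0 Nr1 u2 au eb sa1 sa2 sb e1.
have N0' : 0 < N%:R :> R by rewrite ltr0n.
pose F i := crossing_cell (i%:R * r / 2) r u a s b e.
have mF i : measurable (F i).
  rewrite (_ : F i =
    [set w | `[x0 + i%:R * r / 2, x0 + i%:R * r / 2 + r / 2[%classic (V u w)] `&`
    [set w | `[- (2 * r), - r[%classic (V a w - V u w)] `&`
    [set w | `[- (i%:R * r / 2) - r, - (i%:R * r / 2) - r / 2[%classic (V s w - V a w)] `&`
    [set w | `[2 * r, 3 * r[%classic (V e w - V b w)]).
    do ![apply: measurableI]; try exact: (measurable_incr_preimage hV _ _ (measurable_itv _)).
    exact: (measurable_position_preimage hV _ (measurable_itv _)).
  by apply/seteqP; split=> w /=; [move=> [*]; split|move=> [[[? ?] ?] ?]; split].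
have tF : trivIset setT F.
  apply/trivIsetP => i j _ _ ij; apply/seteqP; split=> w // [] [+ _ _ _] [+ _ _ _].
  rewrite /= !in_itv /= => /andP[h1 h2] /andP[h3 h4].
  have lt (p q : nat) : (p < q)%N -> p%:R * r / 2 + r / 2 <= q%:R * r / 2.
    move=> pq; have : p.+1%:R * r <= q%:R * r by rewrite ler_pM2r// ler_nat.
    by rewrite -natr1 mulrDl mul1r; lra.
  by case: (ltngtP i j) ij => // /lt ij _; lra.
have mU : measurable (\big[setU/set0]_(i < N) F i) by exact: bigsetU_measurable.
apply: (@le_trans _ _ (P (\big[setU/set0]_(i < N) F i))).
  rewrite measure_semi_additive//.
  apply: (@le_trans _ _ (\sum_(i < N) ((crossing_const x0) * r / N%:R)%:E)%E).
    rewrite sumEFin sumr_const card_ord -[(crossing_const x0 * r / N%:R) *+ N]mulr_natr divfK ?gt_eqF//.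
  apply: lee_sum => i _.
  exact: (crossing_cell_ge (ltn_ord i) erefl r0 Nr1 u2 au eb sa1 sa2 sb e1).
apply: le_measure; rewrite ?inE//.
  by apply: measurableI; [exact: (measurable_near_level hV)|exact: (measurable_crossing hV)].
rewrite -bigcup_mkord => w [i /= iN] [].
rewrite /= !in_itv /= => /andP[h1 h2] /andP[h3 h4] /andP[h5 h6] /andP[h7 h8].
have i0 : 0 <= i%:R * r / 2 by rewrite divr_ge0// mulr_ge0// ltW.
have iN' : i.+1%:R * r <= N%:R * r by rewrite ler_pM2r// ler_nat.
rewrite -natr1 mulrDl mul1r in iN'.
move: (i%:R * r) (N%:R * r) i0 iN' h1 h2 h5 h6 => y z i0 iN' h1 h2 h5 h6.
split; first by rewrite /near_level /= in_itv /=; apply/andP; split; lra.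
by rewrite /crossing /=; split; lra.
Qed.

End crossing_lower_bound.

(** * The change of the integral over one block *)

Section swapped_blocks.
Context (d : measure_display) (T : measurableType d) (R : realType).
Variable P : probability T R.
Notation leb := (@lebesgue_measure R).
Variables (V : R -> T -> R) (hV : continuous_brownian P V).
Variables (mu : R -> R) (ndmu : nondecreasing_fun mu).
Variables (m M : nat) (m0 : (0 < m)%N).

Let bs (j : nat) : R := block_start R m M j.

Lemma swap_shift_bounded j w : exists B, forall t, `|swap_shift V m M j t w| <= B.
Proof.
have [B hB] := cbm_bounded hV w; exists (B + B + (B + B)) => t.
rewrite /swap_shift; do 2! (apply: le_trans (ler_normB _ _) _; apply: lerD) => //.
all: by apply: le_trans (ler_normB _ _) _; apply: lerD.
Qed.

Lemma swap_process_bounded fr w : exists B, forall t, `|swap_process V m M fr t w| <= B.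
Proof.
have [B hB] := cbm_bounded hV w; rewrite /swap_process.
suff H q : exists B, forall t,
    `|V t w + \sum_(j < q) (if fr j then swap_shift V m M j t w else 0)| <= B by exact: H.
elim: q => [|q [B' IH]].
  by exists B => t; rewrite big_ord0 addr0.
have [B'' hB''] := swap_shift_bounded q w; exists (B' + (B'' + 0)) => t.
rewrite big_ord_recr /= addrA; apply: le_trans (ler_normD _ _) _; apply: lerD => //.
have := hB'' t; have := normr_ge0 (swap_shift V m M q t w).
by case: ifP => _; rewrite ?normr0 addr0 //; exact: le_trans.
Qed.

Lemma swap_process_copy fr : brownian_copy P V (swap_process V m M fr).
Proof.
split.
- exact: (swap_process_jointly_measurable hV).
- exact: swap_process_bounded.
- by move=> N tt H; exact: (swap_process_law hV).
Qed.

Definition block_gain (j : nat) (w : T) : R :=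
  \int[leb]_(s in `[bs j, bs j.+1]) (mu (V s w + swap_shift V m M j s w) - mu (V s w)).

Lemma block_startE j : bs j = j%:R / m%:R.
Proof. by rewrite /bs /block_start !natrM invfM mulrACA divff ?mulr1. Qed.

Lemma block_start_next_le j : bs j <= bs j.+1.
Proof. by rewrite /bs /block_start ler_wpM2r ?invr_ge0// ler_nat leq_mul2r leqnSn orbT. Qed.

Let measurable_swapped_drift j :
  measurable_fun setT (fun p : R * T => mu (V p.1 p.2 + swap_shift V m M j p.1 p.2)).
Proof.
apply: (measurableT_comp (measurable_drift ndmu)); apply: measurable_funD.
  exact: (cbm_jointly_measurable hV).
exact: (swap_shift_jointly_measurable hV).
Qed.

Lemma block_gain_integrand_measurable j :
  measurable_fun setT (fun p : R * T =>
    mu (V p.1 p.2 + swap_shift V m M j p.1 p.2) - mu (V p.1 p.2)).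
Proof.
apply: measurable_funB; first exact: measurable_swapped_drift.
exact: (drift_jointly_measurable ndmu (cbm_copy hV)).
Qed.

Lemma measurable_block_gain j : measurable_fun setT (block_gain j).
Proof.
exact: (measurable_time_Rintegral (measurable_itv _) (block_gain_integrand_measurable j)).
Qed.

Lemma nondecreasing_bounded_comp (f : R -> R) : (exists B, forall s, `|f s| <= B) ->
  exists B, forall s, `|mu (f s)| <= B.
Proof.
move=> [B hB]; exists (`|mu B| + `|mu (- B)|) => s.
have /andP[b1 b2] : - B <= f s <= B by rewrite -ler_norml.
have := ndmu b1; have := ndmu b2.
have := ler_norm (mu B); have := ler_norm (- mu (- B)); rewrite normrN.
have := normr_ge0 (mu B); have := normr_ge0 (mu (- B)).
by rewrite ler_norml => *; apply/andP; split; lra.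
Qed.

Lemma block_gain_integrand_bounded j w : exists B, forall s,
  `|mu (V s w + swap_shift V m M j s w) - mu (V s w)| <= B.
Proof.
have [B1 hB1] := nondecreasing_bounded_comp (cbm_bounded hV w).
have [B3 hB3] : exists B, forall s, `|V s w + swap_shift V m M j s w| <= B.
  have [B4 hB4] := cbm_bounded hV w; have [B5 hB5] := swap_shift_bounded j w.
  by exists (B4 + B5) => s; apply: le_trans (ler_normD _ _) _; exact: lerD.
have [B2 hB2] := nondecreasing_bounded_comp (ex_intro _ _ hB3).
by exists (B2 + B1) => s; apply: le_trans (ler_normB _ _) _; exact: lerD.
Qed.

(** Each exchange acts inside its own block, so the changes add up without interaction. This
    additivity is what makes the average over sets of blocks an average over signs. *)
Lemma drift_integral_swap fr w :
  drift_integral mu (swap_process V m M fr) w =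
  drift_integral mu V w + \sum_(j < m) (if fr j then block_gain j w else 0).
Proof.
have bs0 : bs 0 = 0 by rewrite /bs /block_start mul0n mul0r.
have bsm : bs m = 1.
  by rewrite /bs /block_start divff// pnatr_eq0 muln_eq0 negb_or -lt0n m0.
have hU := swap_process_copy fr; have hC := cbm_copy hV.
have mU := drift_path_measurable ndmu hU w.
have bU := drift_path_bounded ndmu hU w.
have mV := drift_path_measurable ndmu hC w.
have bV := drift_path_bounded ndmu hC w.
have := Rintegral_split_cells m block_start_next_le mU bU.
have := Rintegral_split_cells m block_start_next_le mV bV.
rewrite bs0 bsm /drift_integral => -> ->; rewrite -big_split /=.
apply: eq_bigr => j _; set I := `[_, _]%classic.
have E s : s \in I -> swap_process V m M fr s w = V s w + (if fr j then swap_shift V m M j s w else 0).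
  by rewrite inE /I /= in_itv /= => sI; exact: (swap_process_in V m0).
case: (fr j) E => E; last first.
  by rewrite addr0; apply: eq_Rintegral => s sI; rewrite E// addr0.
transitivity (\int[leb]_(s in I) (mu (V s w) + (mu (V s w + swap_shift V m M j s w) - mu (V s w)))).
  by apply: eq_Rintegral => s sI; rewrite E// [RHS]addrC subrK.
rewrite RintegralD//; first exact: measurable_itv.
  exact: bounded_integrable_itv.
apply: bounded_integrable_itv; last exact: block_gain_integrand_bounded.
apply: (measurableT_comp (block_gain_integrand_measurable j) (g := fun s => (s, w))).
exact: pair2_measurable.
Qed.

End swapped_blocks.

(** The factor [m] brings the change over a block of length [1 / m] to order one. The truncation at
    [J] bounds it by a multiple of the indicator of a start near the jump, so moments of the sum
    reduce to counting such starts. *)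
Definition truncated_gain (d : measure_display) (T : measurableType d) (R : realType)
    (V : R -> T -> R) (mu : R -> R) (x0 J : R) (m M j : nat) (w : T) : R :=
  \1_(near_level V x0 (Num.sqrt m%:R^-1) (block_start R m M j)) w *
  Num.min (m%:R * `|block_gain V mu m M j w|) J.

Section block_gain_lower_bound.
Context (d : measure_display) (T : measurableType d) (R : realType).
Variable P : probability T R.
Notation leb := (@lebesgue_measure R).
Variables (V : R -> T -> R) (hV : continuous_brownian P V).
Variables (mu : R -> R) (ndmu : nondecreasing_fun mu).
Variables (x0 J Cg : R) (J0 : 0 < J) (Cg0 : 0 < Cg).
Hypothesis gap : forall x y, x < x0 -> x0 < y -> J <= mu y - mu x.
Hypothesis growth : forall x y, `|mu x - mu y| <= Cg * (1 + `|x - y|).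
Variables (m M N0 : nat) (m0 : (0 < m)%N) (N02 : (1 < N0)%N) (MN : (M.+2 = N0 ^ 2)%N).
Variables (j : nat) (jm : (j < m)%N) (mj : (m <= 2 * j)%N).

(** The block is [[u, e]], of length [dl], with outer cells [[u, a]] and [[b, e]] of length [h]. The
    times are variables tied by equations so that linear arithmetic treats them as atoms. *)
Variables (h dl u a b e : R).
Hypotheses (h_def : h = (m * M.+2)%:R^-1) (dl_def : dl = m%:R^-1).
Hypotheses (u_def : u = block_start R m M j) (a_def : a = u + h).
Hypotheses (b_def : b = block_last R m M j) (e_def : e = block_start R m M j.+1).
Let shift (s : R) (w : T) := swap_shift V m M j s w.

Let m0' : 0 < m%:R :> R. Proof. by rewrite ltr0n. Qed.
Let N0' : 2 <= N0%:R :> R. Proof. by rewrite ler_nat. Qed.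
Let dl0 : 0 < dl. Proof. by rewrite dl_def invr_gt0. Qed.
Let hE : h = dl / N0%:R ^+ 2.
Proof. by rewrite h_def dl_def MN natrM natrX invfM. Qed.
Let h0 : 0 < h. Proof. by rewrite hE divr_gt0// exprn_gt0// (lt_le_trans _ N0'). Qed.
Let dl1 : dl <= 1. Proof. by rewrite dl_def invf_le1// ler1n. Qed.
Let h4 : h <= dl / 4.
Proof.
rewrite hE ler_pM2l// lef_pV2 ?posrE//; last by rewrite exprn_gt0// (lt_le_trans _ N0').
have N2 := N0'.
have : 0 <= (N0%:R - 2) * (N0%:R + 2) :> R by rewrite mulr_ge0//; lra.
by rewrite expr2; lra.
Qed.
Let uE : u = j%:R * dl. Proof. by rewrite u_def dl_def block_startE. Qed.
Let eE : e = u + dl.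
Proof.
rewrite uE e_def /block_start dl_def mulSnr natrD mulrDl.
have M0 : M.+2%:R != 0 :> R by rewrite pnatr_eq0.
by rewrite [(m * _)%:R]natrM invfM [(j * _)%:R]natrM mulrACA divff// mulr1 mulrCA divff// mulr1.
Qed.
Let bE : b = e - h. Proof. by rewrite b_def e_def h_def -block_next addrK. Qed.
Let u2 : 2^-1 <= u.
Proof.
rewrite uE dl_def ler_pdivlMr// mulrC ler_pdivrMr//.
by rewrite mulrC -natrM ler_nat.
Qed.
Let e1 : e <= 1.
Proof.
rewrite eE uE -[X in _ + X]mul1r -mulrDl dl_def ler_pdivrMr// mul1r.
by rewrite natr1 ler_nat.
Qed.

Let D w := (V e w - V b w) - (V a w - V u w).
Let A : set T := near_level V x0 (Num.sqrt dl) u.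
(** For these times [s - a] is comparable with [dl], as [crossing_prob_ge] requires, and [s <= b]
    because [h <= dl / 4]. *)
Let G : set R := `[a + dl / 4, a + dl / 2]%classic.
Let I : set R := `[u, e]%classic.
Let C : set (R * T) := [set p | V p.1 p.2 < x0 /\ x0 < V p.1 p.2 + D p.2].
Let cr (p : R * T) : R := \1_G p.1 * \1_C p.
Let edge (s : R) : R := \1_(`[u, a]%classic : set R) s + \1_(`[b, e]%classic : set R) s.
(** The growth bound for the possible loss on the two outer cells, where the shift varies and its
    sign is not controlled. *)
Let k (p : R * T) : R := Cg * (1 + `|shift p.1 p.2|) * edge p.1.

Let mA : measurable A. Proof. exact: (measurable_near_level hV). Qed.
Let mI : measurable I. Proof. exact: measurable_itv. Qed.
Let mD : measurable_fun setT D.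
Proof.
by apply: measurable_funB; apply: measurable_funB; exact: (cbm_measurable hV).
Qed.

Let mfst_indic (B : set R) : measurable B -> measurable_fun setT (fun p : R * T => \1_B p.1 : R).
Proof.
move=> mB; apply: (measurableT_comp (f := \1_B : R -> R)); last exact: measurable_fst.
exact: measurable_indic.
Qed.

Let mC : measurable C.
Proof.
have mV := cbm_jointly_measurable hV.
pose f (p : R * T) := V p.1 p.2 + D p.2.
have mf : measurable_fun setT f.
  apply: measurable_funD => //.
  by apply: (measurableT_comp mD); exact: measurable_snd.
rewrite (_ : C = ((fun p : R * T => V p.1 p.2) @^-1` `]-oo, x0[%classic) `&` (f @^-1` `]x0, +oo[%classic)).
  apply: measurableI; rewrite -[X in measurable X]setTI.
    by apply: mV => //; exact: measurable_itv.
  by apply: mf => //; exact: measurable_itv.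
by apply/seteqP; split=> w; rewrite /C /= !in_itv /= andbT => -[? ?]; split.
Qed.

Let mcr : measurable_fun setT cr.
Proof.
apply: measurable_funM; first by apply: mfst_indic; exact: measurable_itv.
exact: measurable_indic.
Qed.

Let mshift : measurable_fun setT (fun p : R * T => shift p.1 p.2).
Proof. exact: (swap_shift_jointly_measurable hV). Qed.

Let mk : measurable_fun setT k.
Proof.
apply: measurable_funM; last first.
  by apply: measurable_funD; apply: mfst_indic; exact: measurable_itv.
apply: measurable_funM; first exact: measurable_cst.
apply: measurable_funD; first exact: measurable_cst.
exact: (measurableT_comp (@normr_measurable R setT)).
Qed.

Let indic01 (X : Type) (B : set X) (x : X) : 0 <= (\1_B x : R) <= 1.
Proof. by rewrite indicE; case: (_ \in _); rewrite ?lexx ?ler01. Qed.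

Let cr01 p : 0 <= cr p <= 1.
Proof.
have /andP[i1 i2] := indic01 G p.1; have /andP[i3 i4] := indic01 C p.
by rewrite /cr mulr_ge0//= mulr_ile1.
Qed.

Let edge02 s : 0 <= edge s <= 2.
Proof.
have /andP[i1 i2] := indic01 (`[u, a]%classic : set R) s.
have /andP[i3 i4] := indic01 (`[b, e]%classic : set R) s.
by rewrite /edge addr_ge0//=; lra.
Qed.

Let k0 p : 0 <= k p.
Proof.
rewrite /k mulr_ge0//; last by case/andP: (edge02 p.1).
by rewrite mulr_ge0 ?addr_ge0// ltW.
Qed.

Let section_measurable (F : R * T -> R) w : measurable_fun setT F ->
  measurable_fun setT (fun s => F (s, w)).
Proof.
by move=> mF; apply: (measurableT_comp mF (g := fun s => (s, w))); exact: pair2_measurable.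
Qed.

Let cr_bounded w : exists B, forall s, `|cr (s, w)| <= B.
Proof. by exists 1 => s; have /andP[c0 c1] := cr01 (s, w); rewrite ger0_norm. Qed.

Let k_bounded w : exists B, forall s, `|k (s, w)| <= B.
Proof.
have [B hB] := swap_shift_bounded hV m M j w; exists (Cg * (1 + B) * 2) => s.
rewrite ger0_norm ?k0// /k /=; have /andP[c0 c1] := edge02 s.
have B0 := le_trans (normr_ge0 _) (hB s).
apply: ler_pM => //; first by rewrite mulr_ge0 ?addr_ge0// ltW.
by rewrite ler_pM2l// lerD2l; exact: hB.
Qed.

Let Z w := \int[leb]_(s in I) cr (s, w).
Let L w := \int[leb]_(s in I) k (s, w).

Let bounded_EFin (f : R -> R) : measurable_fun setT f -> (exists B, forall s, `|f s| <= B) ->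
  ((\int[leb]_(s in I) f s)%:E = \int[leb]_(s in I) (f s)%:E)%E.
Proof.
move=> mf bf; rewrite /Rintegral fineK//; apply: integrable_fin_num => //.
exact: bounded_integrable_itv.
Qed.

(** Between the outer cells a positive constant shift can only increase [mu], by at least [J] if the
    path crosses the jump; on the outer cells [k] pays for any decrease. *)
Let gain_loss s w : I s -> 0 < D w -> J * cr (s, w) <=
  mu (V s w + shift s w) - mu (V s w) + k (s, w).
Proof.
rewrite /I /= in_itv /= => /andP[us se] Dw; have hp : 0 < h := h0; have hq := h4; have dp := dl0.
have kp := k0 (s, w).
have [mid|] := boolP (a <= s <= b).
  have -> : shift s w = D w.
    rewrite /D a_def h_def b_def e_def u_def.
    by apply: (swap_shift_mid V m0); rewrite -u_def -b_def -h_def -a_def.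
  have V0 : 0 <= mu (V s w + D w) - mu (V s w).
    by rewrite subr_ge0; apply: ndmu; rewrite lerDl ltW.
  have [|nc] := boolP ((s, w) \in C).
    rewrite inE /C /= => -[c1 c2]; have gp := gap c1 c2.
    have /andP[c3 c4] := cr01 (s, w).
    have : J * cr (s, w) <= J * 1 by rewrite ler_pM2l.
    by lra.
  by rewrite /cr [\1_C _]indicE (negbTE nc) !mulr0 addr_ge0.
rewrite negb_and -!ltNge => side.
have cr0 : cr (s, w) = 0.
  rewrite /cr [\1_G _]indicE (_ : _ \in G = false) ?mul0r//.
  apply/negbTE/negP; rewrite inE /G /= in_itv /= => /andP[g1 g2].
  case/orP: side => sb; first by lra.
  by move: g2 sb; rewrite bE eE a_def; lra.
rewrite cr0 mulr0.
have gr := growth (V s w + shift s w) (V s w).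
rewrite (_ : V s w + shift s w - V s w = shift s w) in gr; last by ring.
have ed : 1 <= edge s.
  have /andP[i1 _] := indic01 (`[u, a]%classic : set R) s.
  have /andP[i3 _] := indic01 (`[b, e]%classic : set R) s.
  rewrite /edge; case/orP: side => sb.
    have -> : \1_(`[u, a]%classic : set R) s = 1 :> R; last by lra.
    by rewrite indicE mem_set//= in_itv /= us (ltW sb).
  have -> : \1_(`[b, e]%classic : set R) s = 1 :> R; last by lra.
  by rewrite indicE mem_set//= in_itv /= se (ltW sb).
have kge : Cg * (1 + `|shift s w|) <= k (s, w).
  by rewrite /k /= ler_peMr// mulr_ge0 ?addr_ge0// ltW.
have := ler_norm (- (mu (V s w + shift s w) - mu (V s w))); rewrite normrN.
by lra.
Qed.

Let block_gain_path w : J * Z w <= `|block_gain V mu m M j w| + L w.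
Proof.
have L0 : 0 <= L w by apply: Rintegral_ge0 => s _; exact: k0.
(* Without an upward shift there is no crossing and [Z w = 0]. *)
have [Dw|Dw] := ltP 0 (D w); last first.
  rewrite (_ : Z w = 0) ?mulr0 ?addr_ge0//.
  rewrite /Z (_ : (fun s => cr (s, w)) = fun=> 0) ?Rintegral_cst ?mul0r//.
  apply/funext => s; rewrite /cr [\1_C _]indicE (_ : _ \in C = false) ?mulr0//.
  by apply/negbTE/negP; rewrite inE /C /= => -[c1 c2]; lra.
apply: le_trans (lerD (ler_norm _) (lexx _)).
have ig : leb.-integrable I (EFin \o (fun s => mu (V s w + shift s w) - mu (V s w))).
  have mf := section_measurable w (block_gain_integrand_measurable hV ndmu m M j).
  have bf := block_gain_integrand_bounded hV ndmu m M j w.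
  exact: (bounded_integrable_itv _ _ _ _ mf bf).
have ik : leb.-integrable I (EFin \o (fun s => k (s, w))).
  by apply: bounded_integrable_itv => //; exact: section_measurable.
have ic : leb.-integrable I (EFin \o (fun s => cr (s, w))).
  by apply: bounded_integrable_itv => //; exact: section_measurable.
rewrite /block_gain -u_def -e_def -/I /Z /L -RintegralD// -RintegralZl//.
apply: le_Rintegral => //.
- apply: bounded_integrable_itv.
    by apply: measurable_funM; [exact: measurable_cst|exact: section_measurable].
  have [B hB] := cr_bounded w; exists (`|J| * B) => s.
  by rewrite normrM ler_wpM2l.
- apply: bounded_integrable_itv.
    apply: measurable_funD; last exact: section_measurable.
    exact: (section_measurable w (block_gain_integrand_measurable hV ndmu m M j)).
  have [B hB] := block_gain_integrand_bounded hV ndmu m M j w.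
  have [B' hB'] := k_bounded w; exists (B + B') => s.
  by apply: le_trans (ler_normD _ _) _; exact: lerD.
- by move=> s Is; exact: gain_loss.
Qed.

Let weighted_tonelli (F : R * T -> R) : measurable_fun setT F -> (forall p, 0 <= F p) ->
  (forall w, exists B, forall s, `|F (s, w)| <= B) ->
  (\int[P]_w (\1_A w * \int[leb]_(s in I) F (s, w))%:E =
   \int[leb]_(s in I) \int[P]_w (\1_A w * F (s, w))%:E)%E.
Proof.
move=> mF F0 bF.
have mAF : measurable_fun setT (fun p : R * T => (\1_A p.2 * F p)%:E).
  apply/measurable_EFinP; apply: measurable_funM => //.
  by apply: (measurableT_comp (f := \1_A : T -> R)).
have AF0 p : (0 <= (\1_A p.2 * F p)%:E)%E.
  by rewrite lee_fin mulr_ge0//; case/andP: (indic01 A p.2).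
rewrite -(tonelli_time P mI mAF AF0).
apply: eq_integral => w _ /=.
rewrite EFinM bounded_EFin//; last exact: section_measurable.
under [RHS]eq_integral => s _ do rewrite EFinM.
rewrite ge0_integralZl//.
- by apply/measurable_EFinP; apply: measurable_funTS; exact: section_measurable.
- by move=> s _; rewrite lee_fin.
Qed.

Let sqrt_dl : 0 < Num.sqrt dl. Proof. by rewrite sqrtr_gt0. Qed.
Let sqr_dl : Num.sqrt dl ^+ 2 = dl. Proof. by rewrite sqr_sqrtr// ltW. Qed.

(** By Tonelli this is the crossing probability at a fixed time, integrated over the window [G] of
    length [dl / 4]. *)
Let crossing_time_ge :
  ((dl / 4 * (crossing_const x0 * (Num.sqrt dl / N0%:R)))%:E <= \int[P]_w (\1_A w * Z w)%:E)%E.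
Proof.
rewrite weighted_tonelli//; last by move=> p; case/andP: (cr01 p).
have hp : 0 < h := h0; have hq := h4; have dp := dl0.
have Npos : 0 < N0%:R :> R by rewrite ltr0n (leq_trans _ N02).
have rE : N0%:R * (Num.sqrt dl / N0%:R) = Num.sqrt dl by rewrite mulrC divfK// gt_eqF.
have c0 : 0 <= crossing_const x0 * (Num.sqrt dl / N0%:R).
  by rewrite mulr_ge0// ?divr_ge0// ltW// crossing_const_gt0.
have mG : measurable G by exact: measurable_itv.
apply: (@le_trans _ _ (\int[leb]_(s in I) ((crossing_const x0 * (Num.sqrt dl / N0%:R))%:E * (\1_G s)%:E))%E).
  rewrite ge0_integralZl//; last exact/measurable_EFinP/measurable_funTS/measurable_indic.
  rewrite integral_indic// (_ : G `&` I = G).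
    rewrite [X in (_ <= _ * X)%E](_ : _ = (dl / 4)%:E); first by rewrite -EFinM mulrC.
    apply: (etrans (lebesgue_itv_length _)); first by lra.
    by congr _%:E; field.
  apply/setIidPl => s; rewrite /G /I /= !in_itv /= => /andP[g1 g2].
  by apply/andP; move: g1 g2; rewrite eE a_def; split; lra.
apply: ge0_le_integral => //.
- by move=> s _; rewrite mule_ge0 ?lee_fin//; case/andP: (indic01 G s).
- apply/measurable_EFinP/measurable_funTS/measurable_funM => //; exact: measurable_indic.
- apply: measurable_funTS.
  apply: (measurable_space_integral P (F := fun p => (\1_A p.2 * cr p)%:E)).
  + apply/measurable_EFinP; apply: measurable_funM => //.
    by apply: (measurableT_comp (f := \1_A : T -> R)).
  + move=> p; by rewrite lee_fin mulr_ge0//; case/andP: (cr01 p).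
move=> s _; have [sG|nG] := boolP (s \in G); last first.
  rewrite indicE (negbTE nG) mule0; apply: integral_ge0 => w _.
  by rewrite lee_fin mulr_ge0//; case/andP: (cr01 (s, w)).
rewrite indicE sG mule1.
have E w : (\1_A w * cr (s, w))%:E = (\1_(A `&` crossing V x0 u a s b e) w)%:E :> \bar R.
  have -> : \1_(A `&` crossing V x0 u a s b e) w = \1_A w * \1_(crossing V x0 u a s b e) w :> R.
    by rewrite indicI.
  have -> : cr (s, w) = \1_(crossing V x0 u a s b e) w; last by [].
  rewrite /cr [\1_G _]indicE sG mul1r !indicE.
  suff -> : ((s, w) \in C) = (w \in crossing V x0 u a s b e) by [].
  by apply/idP/idP => /set_mem ?; exact/mem_set.
under eq_integral => w _ do rewrite E.
rewrite integral_indic//; last by apply: measurableI => //; exact: (measurable_crossing hV).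
rewrite setIT /A.
move: sG; rewrite inE /G /= in_itv /= => /andP[g1 g2].
have rr : h = (Num.sqrt dl / N0%:R) ^+ 2 by rewrite expr_div_n sqr_dl.
rewrite -[in X in near_level _ _ X _]rE; apply: crossing_prob_ge => //.
- by rewrite (leq_trans _ N02).
- by rewrite divr_gt0.
- by rewrite rE -sqrtr1 ler_sqrt.
- by rewrite a_def -rr; ring.
- by rewrite bE -rr; ring.
- by rewrite rE sqr_dl; lra.
- by rewrite rE sqr_dl; lra.
- by move: g2; rewrite bE eE a_def; lra.
Qed.

(** The event has probability at most [4 * sqrt dl]. The shift is a difference of two increments
    after time [u], independent of the event and of mean absolute value at most 2, whence
    [20 = 4 + 8 + 8]. *)
Let weighted_shift_le s : I s ->
  (\int[P]_w (\1_A w * (1 + `|shift s w|))%:E <= (20 * Num.sqrt dl)%:E)%E.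
Proof.
rewrite /I /= in_itv /= => /andP[us se].
have hp : 0 < h := h0; have hq := h4; have dp := dl0; have e1' := e1; have u2' := u2; have eE' := eE.
pose al := clip h (s - u); pose be := clip h (s - b).
have /andP[al0 alh] : 0 <= al <= h by apply: clip_itv; exact: ltW.
have /andP[be0 beh] : 0 <= be <= h by apply: clip_itv; exact: ltW.
have ba : be <= al.
  by apply: clip_homo; rewrite lerD2l lerN2 bE eE; lra.
pose i1 w := V (b + al) w - V (b + be) w; pose i2 w := V (u + al) w - V (u + be) w.
have mV t : measurable_fun setT (V t) by exact: (cbm_measurable hV).
have mi1 : measurable_fun setT (fun w => (\1_A w * `|i1 w|)%:E).
  apply/measurable_EFinP; apply: measurable_funM; first exact: measurable_indic.
  by apply: (measurableT_comp (@normr_measurable R setT)); exact: measurable_funB.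
have mi2 : measurable_fun setT (fun w => (\1_A w * `|i2 w|)%:E).
  apply/measurable_EFinP; apply: measurable_funM; first exact: measurable_indic.
  by apply: (measurableT_comp (@normr_measurable R setT)); exact: measurable_funB.
have m1A : measurable_fun setT (fun w => (\1_A w : R)%:E).
  by apply/measurable_EFinP; exact: measurable_indic.
have A0 w : 0 <= (\1_A w : R) by [].
apply: (@le_trans _ _ (\int[P]_w ((\1_A w)%:E + ((\1_A w * `|i1 w|)%:E + (\1_A w * `|i2 w|)%:E)))%E).
  apply: ge0_le_integral => //.
  - apply/measurable_EFinP; apply: measurable_funM; first exact: measurable_indic.
    apply: measurable_funD; first exact: measurable_cst.
    apply: (measurableT_comp (@normr_measurable R setT)).
    by apply: (measurableT_comp mshift (g := fun w => (s, w))); exact: pair1_measurable.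
  - by apply: emeasurable_funD => //; exact: emeasurable_funD.
  - move=> w _; rewrite -!EFinD lee_fin -mulrDr -[X in X + _ * _]mulr1 -mulrDr.
    rewrite ler_wpM2l// lerD2l.
    have -> : shift s w = i1 w - i2 w.
      rewrite /shift /swap_shift /i1 /i2 /al /be h_def u_def b_def.
      move: (V _ w) (V _ w) (V _ w) (V _ w) => *; ring.
    exact: ler_normB.
rewrite ge0_integralD//; last 2 first.
- by move=> w _; rewrite adde_ge0// lee_fin mulr_ge0.
- exact: emeasurable_funD.
rewrite ge0_integralD//.
have PA : (P A <= (4 * Num.sqrt dl)%:E)%E.
  by apply: (near_level_le hV) => //; lra.
have step t t' : u <= t -> t <= t' -> t' <= 1 -> t' - t <= h ->
    (\int[P]_w (\1_A w * `|V t' w - V t w|)%:E <= (8 * Num.sqrt dl)%:E)%E.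
  move=> ut tt' t1 th; have u0 : 0 <= u by lra.
  apply: le_trans (incr_abs_moment hV u0 ut tt' t1 (measurable_itv _)) _.
  rewrite (_ : 8 * Num.sqrt dl = 4 * Num.sqrt dl * 2); last by ring.
  rewrite [X in (_ <= X)%E]EFinM; apply: lee_pmul => //.
  have : Num.sqrt (t' - t) <= 1 by rewrite -sqrtr1 ler_sqrt//; lra.
  by rewrite lee_fin; lra.
have ub : u <= b by rewrite bE eE; lra.
have be' : b = e - h := bE.
have s1 := step (b + be) (b + al) ltac:(lra) ltac:(lra) ltac:(lra) ltac:(lra).
have s2 := step (u + be) (u + al) ltac:(lra) ltac:(lra) ltac:(lra) ltac:(lra).
rewrite integral_indic// setIT (_ : 20 * Num.sqrt dl =
  4 * Num.sqrt dl + (8 * Num.sqrt dl + 8 * Num.sqrt dl)); last by ring.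
by rewrite !EFinD; apply: leeD => //; exact: leeD.
Qed.

Let loss_le : (\int[P]_w (\1_A w * L w)%:E <= (Cg * (20 * Num.sqrt dl) * (h + h))%:E)%E.
Proof.
have hp : 0 < h := h0; have sp := sqrt_dl.
have A0 w : 0 <= (\1_A w : R) by [].
have mshift1 s : measurable_fun setT (fun w => (\1_A w * (1 + `|shift s w|))%:E).
  apply/measurable_EFinP; apply: measurable_funM; first exact: measurable_indic.
  apply: measurable_funD; first exact: measurable_cst.
  apply: (measurableT_comp (@normr_measurable R setT)).
  by apply: (measurableT_comp mshift (g := fun w => (s, w))); exact: pair1_measurable.
rewrite weighted_tonelli//.
have med : measurable_fun setT edge.
  by apply: measurable_funD; apply: measurable_indic; exact: measurable_itv.
have c0 : 0 <= Cg * (20 * Num.sqrt dl) by rewrite !mulr_ge0 ?ltW.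
apply: (@le_trans _ _ (\int[leb]_(s in I) ((Cg * (20 * Num.sqrt dl))%:E * (edge s)%:E))%E).
  apply: ge0_le_integral => //.
  - by move=> s _; apply: integral_ge0 => w _; rewrite lee_fin mulr_ge0.
  - apply: measurable_funTS.
    apply: (measurable_space_integral P (F := fun p => (\1_A p.2 * k p)%:E)).
    + apply/measurable_EFinP; apply: measurable_funM => //.
      by apply: (measurableT_comp (f := \1_A : T -> R)).
    + by move=> p; rewrite lee_fin mulr_ge0.
  - by apply/measurable_EFinP/measurable_funTS/measurable_funM.
  move=> s Is; have /andP[ed _] := edge02 s.
  rewrite (_ : (fun w => _) = (fun w => (Cg * edge s)%:E * (\1_A w * (1 + `|shift s w|))%:E)%E); last first.
    by apply/funext => w; rewrite -EFinM /k /=; congr _%:E; ring.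
  rewrite ge0_integralZl//; last by rewrite lee_fin mulr_ge0// ltW.
  have -> : ((Cg * (20 * Num.sqrt dl))%:E * (edge s)%:E =
      (Cg * edge s)%:E * (20 * Num.sqrt dl)%:E)%E.
    by rewrite -[LHS]EFinM -[RHS]EFinM; congr _%:E; ring.
  apply: lee_wpmul2l; first by rewrite lee_fin mulr_ge0// ltW.
  exact: weighted_shift_le.
rewrite ge0_integralZl//; last 2 first.
- exact/measurable_EFinP/measurable_funTS.
- by move=> s _; rewrite lee_fin; case/andP: (edge02 s).
rewrite [X in (_ <= X)%E]EFinM; apply: lee_wpmul2l; first by rewrite lee_fin.
under eq_integral => s _ do rewrite EFinD.
have mua : measurable (`[u, a]%classic : set R) by exact: measurable_itv.
have mbe : measurable (`[b, e]%classic : set R) by exact: measurable_itv.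
rewrite ge0_integralD//; last 2 first.
- exact/measurable_EFinP/measurable_funTS/measurable_indic.
- exact/measurable_EFinP/measurable_funTS/measurable_indic.
rewrite !integral_indic// EFinD; apply: leeD.
  apply: le_trans (le_measure _ _ _ (@subIsetl _ _ _)) _; rewrite ?inE//.
    exact: measurableI.
  by rewrite [X in (X <= _)%E](lebesgue_itv_length _) a_def ?lerDl ?(ltW hp)// addrAC subrr add0r.
apply: le_trans (le_measure _ _ _ (@subIsetl _ _ _)) _; rewrite ?inE//.
  exact: measurableI.
by rewrite [X in (X <= _)%E](lebesgue_itv_length _) bE ?gerBl ?(ltW hp)// opprB addrC subrK.
Qed.

Let Z_le w : Z w <= dl.
Proof.
have -> : dl = \int[leb]_(s in I) (1 : R).
  rewrite Rintegral_cst// mul1r [X in _ = fine X](_ : _ = dl%:E)//.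
  apply: (etrans (lebesgue_itv_length _)); first by rewrite eE lerDl (ltW dl0).
  by rewrite eE addrAC subrr add0r.
apply: le_Rintegral => //.
- by apply: bounded_integrable_itv => //; exact: section_measurable.
- by apply: bounded_integrable_itv => //; exists 1 => s; rewrite normr1.
- by move=> s _; case/andP: (cr01 (s, w)).
Qed.

Let gain_decomposition w :
  J * (\1_A w * Z w) <= dl * truncated_gain V mu x0 J m M j w + \1_A w * L w.
Proof.
have L0 : 0 <= L w by apply: Rintegral_ge0 => s _; exact: k0.
rewrite /truncated_gain -u_def -dl_def -/A indicE; case: (w \in A); last first.
  by rewrite /= !mul0r !mulr0 add0r.
rewrite /= !mul1r; have zl := Z_le w; have bg := block_gain_path w.
(* Without truncation the scaling factors cancel; with truncation the crossing time [Z w], at most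
   the block length, yields [J * Z w <= J * dl]. *)
have [_|_] := leP (m%:R * `|block_gain V mu m M j w|) J.
  by rewrite mulrA dl_def mulVf ?mul1r// gt_eqF.
by have : J * Z w <= J * dl; [rewrite ler_pM2l|move=> *; lra].
Qed.

Lemma measurable_truncated_gain :
  measurable_fun setT (truncated_gain V mu x0 J m M j).
Proof.
apply: measurable_funM.
  by apply: measurable_indic; exact: (measurable_near_level hV).
apply: measurable_minr; last exact: measurable_cst.
apply: measurable_funM; first exact: measurable_cst.
apply: (measurableT_comp (@normr_measurable R setT)).
exact: (measurable_block_gain hV ndmu).
Qed.

Lemma truncated_gain_bounds w : 0 <= truncated_gain V mu x0 J m M j w <=
  J * \1_(near_level V x0 (Num.sqrt m%:R^-1) (block_start R m M j)) w.
Proof.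
rewrite /truncated_gain [J * _]mulrC ler_wpM2l ?ge_min ?lexx ?orbT// andbT.
by rewrite mulr_ge0// le_min mulr_ge0//= ltW.
Qed.

(** The gain is of order [1 / N0] and the loss of order [1 / N0 ^ 2], relative to [dl * sqrt dl].
    The condition on [N0] says exactly that the loss is at most half the gain, [J * c / (4 * N0)]
    with [c] the crossing constant. *)
Lemma truncated_gain_ge : 320 * Cg <= J * crossing_const x0 * N0%:R ->
  ((J * crossing_const x0 / (8 * N0%:R) * Num.sqrt m%:R^-1)%:E <=
   \int[P]_w (truncated_gain V mu x0 J m M j w)%:E)%E.
Proof.
move=> N0_large; have mX := measurable_truncated_gain.
have X0 w : 0 <= truncated_gain V mu x0 J m M j w by case/andP: (truncated_gain_bounds w).
have Z0 w : 0 <= Z w by apply: Rintegral_ge0 => s _; case/andP: (cr01 (s, w)).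
have L0 w : 0 <= L w by apply: Rintegral_ge0 => s _; exact: k0.
have mZ : measurable_fun setT (fun w => \1_A w * Z w).
  apply: measurable_funM; first exact: measurable_indic.
  exact: (measurable_time_Rintegral mI mcr).
have mL : measurable_fun setT (fun w => \1_A w * L w).
  apply: measurable_funM; first exact: measurable_indic.
  exact: (measurable_time_Rintegral mI mk).
have dp := dl0; have sp := sqrt_dl.
have main : (\int[P]_w (J%:E * (\1_A w * Z w)%:E) <=
    \int[P]_w (dl%:E * (truncated_gain V mu x0 J m M j w)%:E + (\1_A w * L w)%:E))%E.
  apply: ge0_le_integral => //.
  - by move=> w _; rewrite mule_ge0 ?lee_fin ?mulr_ge0// ltW.
  - by apply: measurable_funeM; exact/measurable_EFinP.
  - apply: emeasurable_funD; last exact/measurable_EFinP.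
    by apply: measurable_funeM; exact/measurable_EFinP.
  - by move=> w _; exact: gain_decomposition.
rewrite ge0_integralZl// in main; last 3 first.
- exact/measurable_EFinP.
- by move=> w _; rewrite lee_fin mulr_ge0.
- by rewrite lee_fin ltW.
rewrite ge0_integralD// in main; last 4 first.
- by move=> w _; rewrite mule_ge0 ?lee_fin// ltW.
- by apply: measurable_funeM; exact/measurable_EFinP.
- by move=> w _; rewrite lee_fin mulr_ge0.
- exact/measurable_EFinP.
rewrite ge0_integralZl// in main; last 3 first.
- exact/measurable_EFinP.
- by move=> w _; rewrite lee_fin.
- by rewrite lee_fin ltW.
have lhs := lee_wpmul2l (ltac:(by rewrite lee_fin ltW) : (0 <= J%:E)%E) crossing_time_ge.
have {lhs main} := le_trans lhs (le_trans main (leeD (lexx _) loss_le)).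
have : (0 <= \int[P]_w (truncated_gain V mu x0 J m M j w)%:E)%E.
  by apply: integral_ge0 => w _; rewrite lee_fin.
rewrite -dl_def; case: (\int[P]_w _)%E => [x|_|//]; last by rewrite leey.
rewrite !lee_fin hE => _; set s := Num.sqrt dl; set c := crossing_const x0 => main.
have Npos : 0 < N0%:R :> R by rewrite ltr0n (leq_trans _ N02).
rewrite -(ler_pM2l dp).
have {main} : J * (dl / 4 * (c * (s / N0%:R))) - Cg * (20 * s) * (dl / N0%:R ^+ 2 + dl / N0%:R ^+ 2)
  <= dl * x by rewrite lerBlDr.
apply: le_trans; rewrite -subr_ge0.
rewrite (_ : _ - _ = dl * s / (8 * N0%:R ^+ 2) * (J * c * N0%:R - 320 * Cg)).
  by rewrite mulr_ge0 ?subr_ge0// divr_ge0 ?mulr_ge0 ?ltW ?exprn_gt0.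
by field; rewrite gt_eqF.
Qed.
End block_gain_lower_bound.

(** * Blocks started near the jump *)

Section near_level_count.
Context (d : measure_display) (T : measurableType d) (R : realType).
Variable P : probability T R.
Variables (V : R -> T -> R) (hV : continuous_brownian P V).
Variables (x0 : R) (m n0 : nat) (m0 : (0 < m)%N) (mn0 : (m <= 2 * n0)%N).

Definition grid_near_level (j : nat) : set T := near_level V x0 (Num.sqrt m%:R^-1) (j%:R / m%:R).

Definition near_count (q : nat) (w : T) : R :=
  \sum_(j < q) (if (n0 <= j)%N then \1_(grid_near_level j) w else 0).

Let m0' : 0 < m%:R :> R. Proof. by rewrite ltr0n. Qed.

Lemma grid_near_level_le j : (n0 <= j)%N -> (j <= m)%N ->
  (P (grid_near_level j) <= (4 * Num.sqrt m%:R^-1)%:E)%E.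
Proof.
move=> nj jm; apply: (near_level_le hV); last exact: sqrtr_ge0.
  rewrite ler_pdivlMr// mulrC ler_pdivrMr// mulrC -natrM ler_nat.
  by rewrite (leq_trans mn0)// leq_mul2l.
by rewrite ler_pdivrMr// mul1r ler_nat.
Qed.

Let mgrid j : measurable (grid_near_level j).
Proof. exact: (measurable_near_level hV). Qed.

Lemma measurable_near_count q : measurable_fun setT (near_count q).
Proof.
apply: measurable_sum => j; case: (n0 <= j)%N; last exact: measurable_cst.
exact: measurable_indic.
Qed.

Lemma near_count_ge0 q w : 0 <= near_count q w.
Proof. by apply: sumr_ge0 => j _; case: ifP. Qed.

(** A new block adds twice the old count times its indicator, plus the indicator. By the pair bound
    the first has expectation at most [32 / sqrt m] times the sum of [1 / sqrt (q - l)], hence at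
    most 64; the second has expectation at most 4. *)
Lemma near_count_moment q : (q <= m)%N ->
  (\int[P]_w ((near_count q w) ^+ 2)%:E <= (68 * q%:R)%:E)%E.
Proof.
elim: q => [|q IH] qm.
  under eq_integral => w _ do rewrite /near_count big_ord0 expr0n.
  by rewrite integral0 mulr0.
have {}IH := IH (ltnW qm).
have [nq|nq] := leqP n0 q; last first.
  under eq_integral => w _ do rewrite /near_count big_ord_recr /= leqNgt nq addr0.
  by apply: le_trans IH _; rewrite lee_fin ler_pM2l// ler_nat.
pose f l w : R := if (n0 <= l)%N then \1_(grid_near_level l `&` grid_near_level q) w else 0.
have mf l : measurable_fun setT (fun w => (2 * f l w)%:E).
  apply/measurable_EFinP; apply: measurable_funM; first exact: measurable_cst.
  rewrite /f; case: (n0 <= l)%N; last exact: measurable_cst.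
  by apply: measurable_indic; exact: measurableI.
have f0 l w : 0 <= 2 * f l w by rewrite mulr_ge0// /f; case: ifP.
have mN : measurable_fun setT (fun w => (near_count q w ^+ 2)%:E).
  by apply/measurable_EFinP; apply: measurable_funX; exact: measurable_near_count.
have mI : measurable_fun setT (fun w => (\1_(grid_near_level q) w : R)%:E).
  by apply/measurable_EFinP; exact: measurable_indic.
have E w : ((near_count q.+1 w) ^+ 2)%:E =
    (((near_count q w) ^+ 2)%:E + \sum_(l < q) (2 * f l w)%:E + (\1_(grid_near_level q) w)%:E)%E.
  rewrite sumEFin -mulr_sumr -!EFinD; congr _%:E.
  rewrite /near_count big_ord_recr /= nq; set i := \1__ w.
  have ii : i * i = i by rewrite /i indicE; case: (_ \in _); rewrite ?mulr1 ?mulr0.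
  have -> : \sum_(l < q) f l w = (\sum_(l < q) (if (n0 <= l)%N then \1_(grid_near_level l) w else 0)) * i.
    rewrite mulr_suml; apply: eq_bigr => l _; rewrite /f; case: ifP => _; last by rewrite mul0r.
    by rewrite indicI.
  by rewrite sqrrD [i ^+ 2]expr2 ii mulr_natl.
under eq_integral => w _ do rewrite E.
have S0 w : (0 <= \sum_(l < q) (2 * f l w)%:E)%E.
  by apply: sume_ge0 => l _; rewrite lee_fin.
have mS : measurable_fun setT (fun w => \sum_(l < q) (2 * f l w)%:E)%E.
  by apply: emeasurable_sum.
rewrite ge0_integralD//; last 2 first.
- by move=> w _; rewrite adde_ge0// lee_fin sqr_ge0.
- exact: emeasurable_funD.
rewrite ge0_integralD//; last by move=> w _; rewrite lee_fin sqr_ge0.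
have -> : 68 * q.+1%:R = 68 * q%:R + 64 + 4 :> R by rewrite -natr1; ring.
have s1 : Num.sqrt m%:R^-1 <= 1 :> R.
  by rewrite -[leRHS]sqrtr1 ler_sqrt// invf_le1// ler1n.
have s0 : 0 < Num.sqrt m%:R^-1 :> R by rewrite sqrtr_gt0 invr_gt0.
rewrite !EFinD; apply: leeD; last first.
  rewrite integral_indic// setIT; apply: le_trans (grid_near_level_le nq (ltnW qm)) _.
  by rewrite lee_fin; lra.
apply: leeD => //.
rewrite ge0_integral_sum//; last by move=> l w _; rewrite lee_fin.
apply: (@le_trans _ _ (\sum_(l < q) (32 * Num.sqrt m%:R^-1 * (Num.sqrt (q - l)%:R)^-1)%:E)%E).
  apply: lee_sum => l _.
  have ql : 0 < (q - l)%:R :> R by rewrite ltr0n subn_gt0.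
  rewrite /f; case: (boolP (n0 <= l)%N) => nl; last first.
    under eq_integral => w _ do rewrite mulr0.
    by rewrite integral0 lee_fin !mulr_ge0// ?invr_ge0 ltW.
  under eq_integral => w _ do rewrite EFinM.
  rewrite ge0_integralZl//; last first.
    by apply/measurable_EFinP; apply: measurable_indic; exact: measurableI.
  rewrite integral_indic// ?setIT; last exact: measurableI.
  have -> : 32 * Num.sqrt m%:R^-1 * (Num.sqrt (q - l)%:R)^-1 =
      2 * (4 * Num.sqrt m%:R^-1 * (4 * Num.sqrt m%:R^-1 / Num.sqrt (q%:R / m%:R - l%:R / m%:R))) :> R.
    rewrite -mulrBl -natrB ?(ltnW (ltn_ord l))// sqrtrM ?ler0n//.
    by field; rewrite !gt_eqF// sqrtr_gt0.
  rewrite [X in (_ <= X)%E]EFinM; apply: lee_wpmul2l; first by rewrite lee_fin.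
  apply: (near_level_pair_le hV) => //.
  - rewrite ler_pdivlMr// mulrC ler_pdivrMr// mulrC -natrM ler_nat.
    by rewrite (leq_trans mn0)// leq_mul2l.
  - by rewrite ltr_pM2r ?invr_gt0// ltr_nat.
  - by rewrite ler_pdivrMr// mul1r ler_nat ltnW.
rewrite sumEFin lee_fin -mulr_sumr (reindex_inj rev_ord_inj) /=.
rewrite (eq_bigr (fun i : 'I_q => (Num.sqrt i.+1%:R)^-1)); last first.
  by move=> i _; rewrite subKn.
have := sum_inv_sqrt R q.
have : Num.sqrt m%:R^-1 * Num.sqrt q%:R <= 1 :> R.
  rewrite -sqrtrM ?invr_ge0 ?ler0n// -[leRHS]sqrtr1 ler_sqrt// mulrC ler_pdivrMr// mul1r ler_nat.
  exact: ltnW.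
move: (\sum_(_ < _) _) s0; move: (Num.sqrt m%:R^-1) (Num.sqrt q%:R) => s t S s0 st1 S2t.
by nra.
Qed.
End near_level_count.

(** * Blocks free of observations *)

Section free_blocks.
Context (R : realType) (n : nat) (tt : n.-tuple R) (m : nat) (m0 : (0 < m)%N).

Let inside (i : 'I_n) (j : nat) : bool := j%:R / m%:R < tnth tt i < j.+1%:R / m%:R.

(** Only the open block counts: an observation at an endpoint is unaffected by the exchange, and
    with open blocks each observation spoils at most one. *)
Definition free_block (j : nat) : bool := [forall i, ~~ inside i j].

Let inside_unique i j j' : inside i j -> inside i j' -> j = j'.
Proof.
have m0' : 0 < m%:R :> R by rewrite ltr0n.
move=> /andP[h1 h2] /andP[h3 h4]; apply/eqP; rewrite eqn_leq.
have := lt_trans h1 h4; have := lt_trans h3 h2.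
by rewrite !ltr_pM2r ?invr_gt0// !ltr_nat !ltnS => -> ->.
Qed.

Lemma blocked_count q : (\sum_(j < q) (~~ free_block j : nat) <= n)%N.
Proof.
apply: (@leq_trans (\sum_(j < q) \sum_(i < n) inside i j)).
  apply: leq_sum => j _; case: (boolP (free_block j)) => //=.
  rewrite negb_forall => /existsP[i]; rewrite negbK => ij.
  by rewrite (bigD1 i)//= ij.
rewrite exchange_big /=; apply: (@leq_trans (\sum_(i < n) 1)); last by rewrite sum1_card card_ord.
apply: leq_sum => i _; rewrite -big_mkcond sum1_card.
apply/card_le1_eqP => j j'; rewrite !unfold_in => h h'.
by apply: ord_inj; exact: (inside_unique h' h).
Qed.

Lemma late_count p q : (\sum_(j < q) (p <= j)%N = q - p)%N.
Proof. by elim: q => [|q IH]; rewrite ?big_ord0// big_ord_recr /= IH; lia. Qed.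

(** With [q = 4 * n] and [p = 2 * n] it leaves at least [n] free blocks in the second half of the
    time interval. *)
Lemma free_count p q : (q - p <= n + \sum_(j < q) ((p <= j)%N && free_block j : nat))%N.
Proof.
rewrite -late_count; apply: leq_trans (leq_add (blocked_count q) (leqnn _)).
rewrite -big_split /=; apply: leq_sum => j _.
by case: (p <= j)%N; case: (free_block j).
Qed.

End free_blocks.

(** * The lower bound *)

Section averaged_error.
Context (d : measure_display) (T : measurableType d) (R : realType).
Variable P : probability T R.
Variables (V : R -> T -> R) (hV : continuous_brownian P V).
Variables (mu : R -> R) (ndmu : nondecreasing_fun mu).
Variables (bp : seq R) (C : R) (C0 : 0 < C).
Hypothesis modulus : forall x y, `|mu x - mu y| <=
    C * (`|x - y| + \sum_(z <- bp) (`|y - z| <= `|x - y|)%R%:R).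
Variables (n : nat) (tt : n.-tuple R) (g : n.-tuple R -> R).
Hypotheses (tt01 : forall i, 0 <= tnth tt i <= 1) (mg : measurable_fun setT g).
Variables (m M : nat) (m0 : (0 < m)%N) (fr : nat -> bool).
Hypothesis fr_free : forall j, fr j -> free_block tt m j.

Let b (w : T) (j : nat) : R := if fr j then block_gain V mu m M j w else 0.

Lemma averaged_error_ge :
  (\int[P]_w (Num.sqrt (\sum_(j < m) b w j ^+ 2) / 4)%:E <=
   \int[P]_w (quadrature_error mu tt g V V w)%:E)%E.
Proof.
pose x w := drift_integral mu V w - g [tuple V (tnth tt i) w | i < n].
pose f (eps : nat -> bool) w := `|x w + \sum_(j < m) (if eps j then b w j else 0)|.
pose U (eps : nat -> bool) := swap_process V m M (fun j => fr j && eps j).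
have hU eps : brownian_copy P V (U eps) by exact: swap_process_copy.
have fE eps w : f eps w = quadrature_error mu tt g (U eps) (U eps) w.
  rewrite /f /quadrature_error /x /U (drift_integral_swap hV ndmu M m0).
  have -> : [tuple swap_process V m M (fun j => fr j && eps j) (tnth tt i) w | i < n] =
      [tuple V (tnth tt i) w | i < n].
    apply: eq_from_tnth => i; rewrite !tnth_mktuple; apply: (swap_process_out V m0) => j _.
    move=> /andP[/fr_free /forallP/(_ i) + _]; rewrite !block_startE negb_and -!leNgt.
    by move=> /orP.
  congr `|_|; rewrite [RHS]addrAC; congr (_ + _); apply: eq_bigr => j _.
  by rewrite /b; case: (fr j); case: (eps j).
have mf eps : measurable_fun setT (f eps).
  rewrite (_ : f eps = quadrature_error mu tt g (U eps) (U eps)); last exact/funext.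
  apply: (measurableT_comp (@normr_measurable R setT)); apply: measurable_funB.
    exact: (measurable_drift_integral ndmu (hU eps)).
  exact: (measurable_sample tt mg (hU eps)).
have f0 eps w : 0 <= f eps w by exact: normr_ge0.
have fle eps : (\int[P]_w (f eps w)%:E <= \int[P]_w (quadrature_error mu tt g V V w)%:E)%E.
  under eq_integral => w _ do rewrite fE.
  exact: (copy_error_le hV ndmu C0 modulus tt01 mg (hU eps)).
have [ma a0 ale] := subset_average_integral_le m mf f0 fle.
apply: le_trans ale; apply: ge0_le_integral => //.
- apply/measurable_EFinP; apply: measurable_funM => //.
  apply: (measurableT_comp (continuous_measurable_fun (@sqrt_continuous R))).
  apply: measurable_sum => j; apply: measurable_funX; rewrite /b.
  by case: (fr j) => //; exact: (measurable_block_gain hV ndmu).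
- exact/measurable_EFinP.
move=> w _; rewrite lee_fin.
(* The centre depends on the unknown [g], but Khintchine's bound holds for every centre. The factor
   4 collects the halved coefficients and the constant [1 / 2]. *)
have -> : subset_average m (f^~ w) = sign_average (fun j => b w j / 2) m Num.norm (x w + \sum_(j < m) b w j / 2).
  by rewrite -subset_average_sign.
apply: le_trans (khintchine_abs (fun j => b w j / 2) m (x w + \sum_(j < m) b w j / 2)).
have -> : \sum_(j < m) (b w j / 2) ^+ 2 = (\sum_(j < m) b w j ^+ 2) * 2^-1 ^+ 2.
  by rewrite mulr_suml; apply: eq_bigr => j _; rewrite exprMn.
rewrite sqrtrM ?sumr_ge0// => [|j _]; last exact: sqr_ge0.
by rewrite sqrtr_sqr ger0_norm ?invr_ge0//; lra.
Qed.
End averaged_error.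

(** Here [rho] is the fourth root of [n], [k * rho] the contact point of the quartic and [x] the
    expected error. In units of [q ^ 2 * rho / (288 * k)] the main term is 54, the quartic term 17
    and the claimed bound 36. *)
Lemma error_balance (R : realFieldType) (q k rho x : R) : 0 < q -> 0 < k -> 0 < rho ->
  3 / (2 * (k * rho)) * (rho ^+ 4 * (q ^+ 2 / 4 * (2 * rho ^+ 2)^-1)) <=
  4 * (4 * rho ^+ 4) * x + (q * k / 48) ^+ 2 / (2 * (k * rho) ^+ 3) * (68 * (4 * rho ^+ 4)) ->
  q ^+ 2 / (128 * k) / rho ^+ 3 <= x.
Proof.
move=> q0 k0 rho0; rewrite -lerBlDr => h.
have r16 : 0 < 4 * (4 * rho ^+ 4) by rewrite !mulr_gt0// exprn_gt0.
rewrite -(ler_pM2l r16); apply: le_trans h; rewrite -subr_ge0.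
rewrite (_ : _ - _ = q ^+ 2 * rho / (288 * k)).
  by apply: divr_ge0; rewrite !mulr_ge0// ?exprn_ge0// ltW.
by field; rewrite !gt_eqF.
Qed.

Section quadrature_lower_bound.
Context (d : measure_display) (T : measurableType d) (R : realType).
Variable P : probability T R.
Variables (V : R -> T -> R) (hV : continuous_brownian P V).
Variables (mu : R -> R) (ndmu : nondecreasing_fun mu).
Variables (x0 J Cg : R) (J0 : 0 < J) (Cg0 : 0 < Cg).
Hypothesis gap : forall x y, x < x0 -> x0 < y -> J <= mu y - mu x.
Hypothesis growth : forall x y, `|mu x - mu y| <= Cg * (1 + `|x - y|).
Variables (bp : seq R) (C : R) (C0 : 0 < C).
Hypothesis modulus : forall x y, `|mu x - mu y| <=
    C * (`|x - y| + \sum_(z <- bp) (`|y - z| <= `|x - y|)%R%:R).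
Variables (M N0 : nat) (N02 : (1 < N0)%N) (MN : (M.+2 = N0 ^ 2)%N).
Hypothesis N0_large : 320 * Cg <= J * crossing_const x0 * N0%:R.
Let q := J * crossing_const x0 / (8 * N0%:R).
Variables (n : nat) (n0 : (0 < n)%N) (tt : n.-tuple R) (g : n.-tuple R -> R).
Hypotheses (tt01 : forall i, 0 <= tnth tt i <= 1) (mg : measurable_fun setT g).

Let m := (4 * n)%N.
Let m0 : (0 < m)%N. Proof. by rewrite muln_gt0. Qed.
Let X j w := truncated_gain V mu x0 J m M j w.
Let fr j := (2 * n <= j)%N && free_block tt m j.
Let Y w := \sum_(j < m) (if fr j then X j w ^+ 2 else 0).
Let s : R := Num.sqrt m%:R^-1.

Let N0pos : 0 < N0%:R :> R. Proof. by rewrite ltr0n (ltn_trans _ N02). Qed.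
Let q0 : 0 < q.
Proof. by rewrite divr_gt0 ?mulr_gt0// crossing_const_gt0. Qed.
Let s0 : 0 < s. Proof. by rewrite sqrtr_gt0 invr_gt0 ltr0n. Qed.

Let mX j : measurable_fun setT (X j).
Proof. exact: (measurable_truncated_gain hV ndmu). Qed.

Let X_bounds j w : 0 <= X j w <= J * \1_(grid_near_level V x0 m j) w.
Proof.
by have := truncated_gain_bounds V mu x0 J0 m M j w; rewrite block_startE.
Qed.

(** Completing the square around [q / 4] on the event near the jump, outside which [X j] vanishes,
    bounds the second moment below; Cauchy-Schwarz on that event, in linear form. *)
Let gain_square_moment j : (2 * n <= j)%N -> (j < m)%N ->
  ((q ^+ 2 / 4 * s)%:E <= \int[P]_w (X j w ^+ 2)%:E)%E.
Proof.
move=> nj jm.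
have mj : (m <= 2 * j)%N by rewrite /m; lia.
have X0 w : 0 <= X j w by case/andP: (X_bounds j w).
have mX2 : measurable_fun setT (fun w => (X j w ^+ 2)%:E).
  by apply/measurable_EFinP; exact: measurable_funX.
have mA : measurable (grid_near_level V x0 m j) by exact: (measurable_near_level hV).
have PA : (P (grid_near_level V x0 m j) <= (4 * s)%:E)%E.
  by apply: (grid_near_level_le hV x0 m0 (n0 := 2 * n) _ nj (ltnW jm)); rewrite /m; lia.
have q4 : 0 <= q / 2 by rewrite divr_ge0// ltW.
have main : (\int[P]_w ((q / 2)%:E * (X j w)%:E) <=
    \int[P]_w ((X j w ^+ 2)%:E + ((q / 4) ^+ 2)%:E * (\1_(grid_near_level V x0 m j) w)%:E))%E.
  apply: ge0_le_integral => //.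
  - by move=> w _; rewrite mule_ge0// lee_fin.
  - by apply: measurable_funeM; exact/measurable_EFinP.
  - apply: emeasurable_funD => //.
    by apply: measurable_funeM; apply/measurable_EFinP; exact: measurable_indic.
  - move=> w _; rewrite -EFinM -EFinM -EFinD lee_fin.
    have := X_bounds j w; rewrite indicE; case: (_ \in _).
      rewrite mulr1 => _; rewrite -subr_ge0 (_ : _ - _ = (X j w - q / 4) ^+ 2) ?sqr_ge0//.
      by rewrite /= mulr1; field.
    rewrite mulr0 => /andP[h1 h2]; have -> : X j w = 0 by apply: le_anti; rewrite h1 h2.
    by rewrite !mulr0 expr0n addr0.
have tg := truncated_gain_ge hV ndmu J0 Cg0 gap growth m0 N02 MN jm mj erefl erefl erefl erefl erefl erefl N0_large.
rewrite ge0_integralZl// in main; last 2 first.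
- exact/measurable_EFinP.
- by move=> w _; rewrite lee_fin.
rewrite ge0_integralD// in main; last 3 first.
- by move=> w _; rewrite lee_fin sqr_ge0.
- by move=> w _; rewrite mule_ge0// lee_fin sqr_ge0.
- by apply: measurable_funeM; apply/measurable_EFinP; exact: measurable_indic.
rewrite ge0_integralZl// in main; last 2 first.
- by apply/measurable_EFinP; exact: measurable_indic.
- by rewrite lee_fin sqr_ge0.
rewrite integral_indic// setIT in main.
have q42 : (0 <= ((q / 4) ^+ 2)%:E)%E by rewrite lee_fin sqr_ge0.
have lhs := @lee_wpmul2l _ (q / 2)%:E ltac:(by rewrite lee_fin) _ _ tg.
have {main} := le_trans lhs (le_trans main (leeD (lexx _) (lee_wpmul2l q42 PA))).
have : (0 <= \int[P]_w (X j w ^+ 2)%:E)%E by apply: integral_ge0 => w _; rewrite lee_fin sqr_ge0.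
case: (\int[P]_w _)%E => [x|_ _|//]; last by rewrite leey.
rewrite !lee_fin -/s -/q => _ h.
have : q / 2 * (q * s) <= x + (q / 4) ^+ 2 * (4 * s) by exact: h.
rewrite (_ : q ^+ 2 / 4 * s = q / 2 * (q * s) - (q / 4) ^+ 2 * (4 * s)); last by field.
by rewrite lerBlDr.
Qed.

Let mY : measurable_fun setT Y.
Proof.
by apply: measurable_sum => j; case: (fr j) => //; exact: measurable_funX.
Qed.

Let Y0 w : 0 <= Y w.
Proof. by apply: sumr_ge0 => j _; case: ifP => // _; exact: sqr_ge0. Qed.

Let Y_moment : ((n%:R * (q ^+ 2 / 4 * s))%:E <= \int[P]_w (Y w)%:E)%E.
Proof.
have nn := free_count tt m0 (2 * n) m.
under eq_integral => w _ do rewrite /Y -sumEFin.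
rewrite ge0_integral_sum//; last 2 first.
- by move=> j; apply/measurable_EFinP; case: (fr j) => //; exact: measurable_funX.
- by move=> j w _; rewrite lee_fin; case: ifP => // _; exact: sqr_ge0.
apply: (@le_trans _ _ (\sum_(j < m) ((fr j)%:R * (q ^+ 2 / 4 * s))%:E)%E).
  rewrite sumEFin -mulr_suml lee_fin ler_wpM2r//.
    by rewrite mulr_ge0 ?divr_ge0 ?sqr_ge0// ltW.
  rewrite -natr_sum ler_nat.
  have : (2 * n <= n + \sum_(j < m) fr j)%N by apply: leq_trans nn; rewrite /m; lia.
  by rewrite mul2n -addnn leq_add2l.
apply: lee_sum => j _; have [/andP[frj _]|nfr] := boolP (fr j).
  by rewrite mul1r; exact: gain_square_moment.
by rewrite mul0r; apply: integral_ge0.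
Qed.

Let Y_le_count w : Y w <= J ^+ 2 * near_count V x0 m (2 * n) m w.
Proof.
rewrite /Y /near_count mulr_sumr; apply: ler_sum => j _.
have /andP[x_ge0 x_le] := X_bounds j w.
have : X j w ^+ 2 <= J ^+ 2 * \1_(grid_near_level V x0 m j) w.
  have -> : \1_(grid_near_level V x0 m j) w = \1_(grid_near_level V x0 m j) w ^+ 2 :> R.
    by rewrite indicE; case: (_ \in _); rewrite /= ?expr1n ?expr0n.
  by rewrite -exprMn ler_pXn2r// nnegrE// (le_trans x_ge0).
rewrite /fr; case: (2 * n <= j)%N; case: (free_block tt m j) => //= _.
all: by rewrite ?mulr0// mulr_ge0// sqr_ge0.
Qed.

Let sqrt_Y_le w : Num.sqrt (Y w) / m%:R <=
  Num.sqrt (\sum_(j < m) (if fr j then block_gain V mu m M j w else 0) ^+ 2).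
Proof.
have m0' : 0 < m%:R :> R by rewrite ltr0n.
set S := \sum_(j < m) _; have S0 : 0 <= S by apply: sumr_ge0 => j _; exact: sqr_ge0.
have mE : Num.sqrt (m%:R ^+ 2) = m%:R :> R by rewrite sqrtr_sqr ger0_norm// ltW.
rewrite ler_pdivrMr// -[X in _ <= _ * X]mE -sqrtrM// ler_sqrt.
  rewrite /S mulr_suml; apply: ler_sum => j _; case: (fr j); last by rewrite expr0n mul0r.
  rewrite -exprMn -[leRHS]real_normK ?num_real// ler_pXn2r ?nnegrE//; last by case/andP: (X_bounds j w).
  rewrite normrM [`|m%:R|]ger0_norm ?(ltW m0')// mulrC /X /truncated_gain indicE.
  have mn : Num.min (m%:R * `|block_gain V mu m M j w|) J <= m%:R * `|block_gain V mu m M j w|.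
    by rewrite ge_min lexx.
  by case: (_ \in _) => /=; [rewrite mul1r|rewrite mul0r mulr_ge0].
by rewrite mulr_ge0// sqr_ge0.
Qed.

Let rho : R := Num.sqrt (Num.sqrt n%:R).

Lemma quadrature_error_ge :
  ((q ^+ 2 / (128 * (48 * J ^+ 2 / q)) / rho ^+ 3)%:E <= \int[P]_w (quadrature_error mu tt g V V w)%:E)%E.
Proof.
have n0' : 0 < n%:R :> R by rewrite ltr0n.
have rho0 : 0 < rho by rewrite !sqrtr_gt0.
have rho2 : rho ^+ 2 = Num.sqrt n%:R by rewrite sqr_sqrtr// sqrtr_ge0.
have rho4 : rho ^+ 4 = n%:R by rewrite (exprM rho 2 2) rho2 sqr_sqrtr// ltW.
have mrho : m%:R = 4 * rho ^+ 4 :> R by rewrite rho4 /m natrM.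
have srho : s = (2 * rho ^+ 2)^-1.
  have -> : s = Num.sqrt (((2 * rho ^+ 2)^-1) ^+ 2).
    by rewrite /s mrho; congr Num.sqrt; field; rewrite gt_eqF.
  by rewrite sqrtr_sqr ger0_norm// invr_ge0 mulr_ge0// sqr_ge0.
(* [Y] is typically of order [sqrt n], so [K] must be of order [rho]; the factor [48 * J ^ 2 / q]
   keeps the quartic term below the main term. *)
have [K KE] : exists K, K = 48 * J ^+ 2 / q * rho by eexists.
have K0 : 0 < K by rewrite KE mulr_gt0// divr_gt0// mulr_gt0// exprn_gt0.
have m0' : 0 < m%:R :> R by rewrite ltr0n.
have mN := measurable_near_count hV x0 m (2 * n) m.
have fr_free j : fr j -> free_block tt m j by case/andP.
have E0 := averaged_error_ge hV ndmu C0 modulus tt01 mg M m0 fr_free.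
have msqrtY : measurable_fun setT (fun w => (Num.sqrt (Y w))%:E).
  by apply/measurable_EFinP; exact: (measurableT_comp (continuous_measurable_fun (@sqrt_continuous R))).
(* The quartic minorant at [sqrt (Y w)], where the fourth power is [Y w ^ 2], at most [J ^ 4] times
   the squared count. *)
have main : (\int[P]_w ((3 / (2 * K))%:E * (Y w)%:E) <= \int[P]_w
    ((Num.sqrt (Y w))%:E + (J ^+ 4 / (2 * K ^+ 3))%:E * ((near_count V x0 m (2 * n) m w) ^+ 2)%:E))%E.
  apply: ge0_le_integral => //.
  - by move=> w _; rewrite mule_ge0// lee_fin// divr_ge0// mulr_ge0// ltW.
  - by apply: measurable_funeM; exact/measurable_EFinP.
  - apply: emeasurable_funD => //; apply: measurable_funeM; apply/measurable_EFinP.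
    exact: measurable_funX.
  - move=> w _; rewrite -EFinM -EFinM -EFinD lee_fin.
    have := abs_ge_tangent (Num.sqrt (Y w)) K0.
    rewrite (exprM _ 2 2) sqr_sqrtr// ger0_norm ?sqrtr_ge0// lerBlDr => /le_trans; apply.
    rewrite lerD2l [leRHS]mulrAC ler_pM2r ?invr_gt0 ?mulr_gt0 ?exprn_gt0//.
    rewrite (exprM J 2 2) -exprMn ler_pXn2r ?nnegrE//.
    by rewrite mulr_ge0 ?sqr_ge0// near_count_ge0.
rewrite ge0_integralZl// in main; last 3 first.
- exact/measurable_EFinP.
- by move=> w _; rewrite lee_fin.
- by rewrite lee_fin divr_ge0// mulr_ge0// ltW.
have J4 : (0 <= (J ^+ 4 / (2 * K ^+ 3))%:E)%E.
  by rewrite lee_fin divr_ge0 ?mulr_ge0 ?exprn_ge0 ?ltW.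
have mN2 : measurable_fun setT (fun w => ((near_count V x0 m (2 * n) m w) ^+ 2)%:E).
  by apply/measurable_EFinP; exact: measurable_funX.
rewrite ge0_integralD// in main; last 2 first.
- by move=> w _; rewrite mule_ge0// lee_fin sqr_ge0.
- exact: measurable_funeM.
rewrite ge0_integralZl// in main; last first.
  by move=> w _; rewrite lee_fin sqr_ge0.
have mn : (m <= 2 * (2 * n))%N by rewrite mulnA.
have N2 := near_count_moment hV x0 m0 mn (leqnn m).
have sqrtE : (\int[P]_w (Num.sqrt (Y w))%:E <=
    (4 * m%:R)%:E * \int[P]_w (quadrature_error mu tt g V V w)%:E)%E.
  apply: le_trans (lee_wpmul2l _ E0); last by rewrite lee_fin mulr_ge0// ltW.
  have mS : measurable_fun setT (fun w =>
      (Num.sqrt (\sum_(j < m) (if fr j then block_gain V mu m M j w else 0) ^+ 2) / 4)%:E).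
    apply/measurable_EFinP; apply: measurable_funM => //.
    apply: (measurableT_comp (continuous_measurable_fun (@sqrt_continuous R))).
    apply: measurable_sum => j; apply: measurable_funX.
    by case: (fr j) => //; exact: (measurable_block_gain hV ndmu).
  rewrite -ge0_integralZl//.
  apply: ge0_le_integral => //.
  - exact: measurable_funeM.
  move=> w _; rewrite -EFinM lee_fin; have := sqrt_Y_le w.
  rewrite ler_pdivrMr// => /le_trans; apply.
  by rewrite le_eqVlt; apply/orP; left; apply/eqP; field.
have lhs := @lee_wpmul2l _ (3 / (2 * K))%:E ltac:(by rewrite lee_fin divr_ge0// mulr_ge0// ltW) _ _ Y_moment.
have {main lhs} := le_trans lhs (le_trans main (leeD sqrtE (lee_wpmul2l J4 N2))).
have : (0 <= \int[P]_w (quadrature_error mu tt g V V w)%:E)%E.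
  by apply: integral_ge0 => w _; rewrite lee_fin normr_ge0.
case: (\int[P]_w _)%E => [x|_ _|//]; last by rewrite leey.
rewrite !lee_fin => _ h.
have {h} : 3 / (2 * K) * (n%:R * (q ^+ 2 / 4 * s)) <=
  4 * m%:R * x + J ^+ 4 / (2 * K ^+ 3) * (68 * m%:R) by exact: h.
rewrite srho mrho -rho4 KE (_ : J ^+ 4 = (q * (48 * J ^+ 2 / q) / 48) ^+ 2); last first.
  by rewrite mulrCA divff ?gt_eqF// mulr1 mulrAC divff// mul1r -exprM.
apply: error_balance => //; rewrite divr_gt0// mulr_gt0// exprn_gt0//.
Qed.
End quadrature_lower_bound.

(** * Both directions of monotonicity and both exponents *)

Lemma sqrt_sqrt_cube (R : realType) (n : nat) :
  Num.sqrt (Num.sqrt n%:R) ^+ 3 = n%:R `^ (3 / 4) :> R.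
Proof.
rewrite -powR_mulrn ?sqrtr_ge0// -!powR12_sqrt ?powR_ge0 ?ler0n// -!powRrM.
by congr (_ `^ _); field.
Qed.

(** [f] stands for an error computed from [W], whose paths are arbitrary on the null set. The
    integral of a nonnegative function is a supremum over simple functions below it, and those below
    [h] cut to zero on [N] are also below [f]. *)
Lemma le_integral_outside_null (d : measure_display) (T : measurableType d) (R : realType)
    (P : {measure set T -> \bar R}) (N : set T) (h f : T -> \bar R) :
  measurable N -> P N = 0%E -> measurable_fun setT h ->
  (forall w, 0 <= h w)%E -> (forall w, 0 <= f w)%E ->
  (forall w, ~ N w -> (h w <= f w)%E) -> (\int[P]_w h w <= \int[P]_w f w)%E.
Proof.
move=> mN N0 mh h0 f0 hf; rewrite (ge0_negligible_integral mN)//.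
rewrite !ge0_integralE//; apply: le_ereal_sup => _ [s sh <-]; exists s => // x.
apply: (le_trans (sh x)); rewrite patch_setT /patch; case: ifPn => //.
by rewrite inE /= => -[_ /hf].
Qed.

Section monotone_lower_bound.
Context (d : measure_display) (T : measurableType d) (R : realType).
Variable P : probability T R.
Notation leb := (@lebesgue_measure R).
Variables (V : R -> T -> R) (hV : continuous_brownian P V).
Variables (k : nat) (xi : nat -> \bar R) (a : R).
Implicit Type mu : R -> R.

Lemma nondecreasing_lower_bound mu : nondecreasing_fun mu ->
  piecewise_lipschitz mu k xi -> jump_at mu a ->
  exists2 c : R, 0 < c & forall n, (0 < n)%N -> forall (tt : n.-tuple R) (g : n.-tuple R -> R),
    (forall i, 0 <= tnth tt i <= 1) -> measurable_fun setT g ->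
    ((c / n%:R `^ (3 / 4))%:E <= \int[P]_w (quadrature_error mu tt g V V w)%:E)%E.
Proof.
move=> ndmu hlip jmp.
have [J J0 gap] := monotone_jump_gap ndmu jmp.
have [Cg Cg0 growth] := piecewise_lipschitz_growth hlip ndmu.
have [C C0 modulus] := piecewise_lipschitz_modulus hlip ndmu.
have c0 : 0 < J * crossing_const a by rewrite mulr_gt0// crossing_const_gt0.
pose N0 := (Num.truncn (320 * Cg / (J * crossing_const a))).+2.
have N0_large : 320 * Cg <= J * crossing_const a * N0%:R.
  rewrite [leRHS]mulrC -ler_pdivrMr//; apply: le_trans (ltW (truncnS_gt _)) _.
  by rewrite ler_nat.
have MN : ((N0 ^ 2).-2.+2 = N0 ^ 2)%N by rewrite /N0 expnS.
pose q := J * crossing_const a / (8 * N0%:R).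
have q0 : 0 < q by rewrite divr_gt0// mulr_gt0// ltr0n.
exists (q ^+ 2 / (128 * (48 * J ^+ 2 / q))).
  apply: divr_gt0; first exact: exprn_gt0.
  by rewrite mulr_gt0// divr_gt0// mulr_gt0// exprn_gt0.
move=> n n0 tt g tt01 mg; rewrite -sqrt_sqrt_cube.
exact: (quadrature_error_ge hV ndmu J0 Cg0 gap growth C0 modulus (isT : 1 < N0)%N MN N0_large n0 tt01 mg).
Qed.

Lemma piecewise_lipschitzN mu : piecewise_lipschitz mu k xi ->
  piecewise_lipschitz (fun x => - mu x) k xi.
Proof.
move=> [x1 x2 x3 hl]; split=> // i ik; have h := hl i ik.
set A := [set x : R | _].
suff H : \forall M \near +oo, forall p, (A `*` A) p -> `|- mu p.1 - - mu p.2| <= M * `|p.1 - p.2|.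
  exact: H.
near=> M => p pA.
have : forall p, (A `*` A) p -> `|mu p.1 - mu p.2| <= M * `|p.1 - p.2|.
  by near: M; exact: h.
by move=> /(_ p pA); rewrite opprK [- _ + _]addrC [`|mu _ - mu _|]distrC.
Unshelve. all: by end_near. Qed.

Lemma jump_atN mu : nonincreasing_fun mu -> jump_at mu a -> jump_at (fun x => - mu x) a.
Proof.
move=> nimu jmp e; apply: jmp.
have nd : nondecreasing_fun (fun x => - mu x) by move=> x y xy; rewrite lerN2; exact: nimu.
(* [lim] has a default value where there is no limit, so it commutes with negation only once
   convergence is known; monotonicity provides it. *)
have cr : cvg (- mu x @[x --> a^'+]).
  apply: nondecreasing_at_right_is_cvgr; first by near=> x => y z _ _; exact: nd.
  near=> x; exists (- mu a) => _ /= [y + <-].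
  by rewrite in_itv /= => /andP[ay _]; apply: nd; exact: ltW.
have cl : cvg (- mu x @[x --> a^'-]).
  apply: nondecreasing_at_left_is_cvgr; first by near=> x => y z _ _; exact: nd.
  near=> x; exists (- mu a) => _ /= [y + <-].
  by rewrite in_itv /= => /andP[_ ya]; apply: nd; exact: ltW.
have := limN cr; have := limN cl.
rewrite (_ : - (fun x => - mu x) = mu); last by apply/funext => x /=; rewrite opprK.
by move=> -> ->; rewrite e.
Unshelve. all: by end_near. Qed.

Lemma quadrature_errorN mu n (tt : n.-tuple R) g w : nonincreasing_fun mu ->
  quadrature_error (fun x => - mu x) tt (fun x => - g x) V V w = quadrature_error mu tt g V V w.
Proof.
move=> nimu; have nd : nondecreasing_fun (fun x => - mu x).
  by move=> x y xy; rewrite lerN2; exact: nimu.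
have mf := drift_path_measurable nd (cbm_copy hV) w.
have bf := drift_path_bounded nd (cbm_copy hV) w.
have E : drift_integral mu V w = - drift_integral (fun x => - mu x) V w.
  rewrite /drift_integral -mulN1r -RintegralZl//.
    by apply: eq_Rintegral => s _; rewrite mulN1r opprK.
  exact: bounded_integrable_itv.
by rewrite /quadrature_error E [in RHS]distrC /= !opprK addrC.
Qed.

(** A decreasing [mu] is replaced by [- mu] and [g] by [- g], which leaves the error unchanged. *)
Lemma monotone_lower_bound mu : nondecreasing_fun mu \/ nonincreasing_fun mu ->
  piecewise_lipschitz mu k xi -> jump_at mu a ->
  exists2 c : R, 0 < c & forall n, (0 < n)%N -> forall (tt : n.-tuple R) (g : n.-tuple R -> R),
    (forall i, 0 <= tnth tt i <= 1) -> measurable_fun setT g ->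
    measurable_fun setT (quadrature_error mu tt g V V) /\
    ((c / n%:R `^ (3 / 4))%:E <= \int[P]_w (quadrature_error mu tt g V V w)%:E)%E.
Proof.
have mq mu' n (tt : n.-tuple R) g : nondecreasing_fun mu' -> measurable_fun setT g ->
    measurable_fun setT (quadrature_error mu' tt g V V).
  move=> nd mg; apply: (measurableT_comp (@normr_measurable R setT)); apply: measurable_funB.
    exact: (measurable_drift_integral nd (cbm_copy hV)).
  exact: (measurable_sample tt mg (cbm_copy hV)).
move=> [nd|ni] hlip jmp.
  have [c c0 hc] := nondecreasing_lower_bound nd hlip jmp; exists c => // n n0 tt g tt01 mg.
  by split; [exact: mq|exact: hc].
have nd : nondecreasing_fun (fun x => - mu x).
  by move=> x y xy; rewrite lerN2; exact: ni.
have [c c0 hc] := nondecreasing_lower_bound nd (piecewise_lipschitzN hlip) (jump_atN ni jmp).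
exists c => // n n0 tt g tt01 mg.
have mNg : measurable_fun setT (fun x => - g x) by exact: measurableT_comp mg.
have E : quadrature_error mu tt g V V = quadrature_error (fun x => - mu x) tt (fun x => - g x) V V.
  by apply/funext => w; rewrite quadrature_errorN.
by rewrite E; split; [exact: mq|exact: hc].
Qed.
End monotone_lower_bound.

(** Jensen's inequality in the form [2 * a * h <= h ^ 2 + a ^ 2], integrated. *)
Lemma second_moment_ge (d : measure_display) (T : measurableType d) (R : realType)
    (P : probability T R) (h : T -> R) (a : R) :
  measurable_fun setT h -> (forall w, 0 <= h w) -> 0 <= a ->
  (a%:E <= \int[P]_w (h w)%:E)%E -> ((a ^+ 2)%:E <= \int[P]_w (h w ^+ 2)%:E)%E.
Proof.
move=> mh h0 a0 ah.
have mh1 : measurable_fun setT (fun w => (h w)%:E) by exact/measurable_EFinP.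
have mh2 : measurable_fun setT (fun w => (h w ^+ 2)%:E).
  by apply/measurable_EFinP; exact: measurable_funX.
have a2 : (0 <= (2 * a)%:E)%E by rewrite lee_fin mulr_ge0.
have : (\int[P]_w ((2 * a)%:E * (h w)%:E) <= \int[P]_w ((h w ^+ 2)%:E + (a ^+ 2)%:E))%E.
  apply: ge0_le_integral => //.
  - by move=> w _; rewrite mule_ge0// lee_fin.
  - exact: measurable_funeM.
  - exact: emeasurable_funD.
  - move=> w _; rewrite -EFinM -EFinD lee_fin -subr_ge0.
    by rewrite (_ : _ - _ = (h w - a) ^+ 2) ?sqr_ge0//; ring.
rewrite ge0_integralZl//; last by move=> w _; rewrite lee_fin.
rewrite ge0_integralD//; last 2 first.
- by move=> w _; rewrite lee_fin sqr_ge0.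
- by move=> w _; rewrite lee_fin sqr_ge0.
rewrite (_ : (\int[P]_w (a ^+ 2)%:E = (a ^+ 2)%:E)%E); last first.
  by rewrite integral_cst//= probability_setT mule1.
move=> /(le_trans (lee_wpmul2l a2 ah)).
case: (\int[P]_w _)%E => [x|_|//]; last by rewrite leey.
rewrite -EFinM -EFinD !lee_fin; rewrite expr2; lra.
Qed.

Theorem theorem3 (R : realType) (d : measure_display) (T : measurableType d)
    (P : probability T R) (W : R -> {RV P >-> R}) (mu : R -> R)
    (k : nat) (xi : nat -> \bar R)
    (hW : standard_brownian_motion W)
    (hk : (1 <= k)%N)
    (hlip : piecewise_lipschitz mu k xi)
    (hjump : exists2 i : nat, (1 <= i <= k)%N & jump_at mu (fine (xi i)))
    (hmono : nondecreasing_fun mu \/ nonincreasing_fun mu)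
    (eps : R) (heps : 0 < eps) :
  exists2 c : R, 0 < c &
    forall n : nat, (1 <= n)%N ->
      ((c / n%:R `^ (3 / 4))%:E <= minimal_error W mu 2 n)%E /\
      ((c / n%:R `^ (3 / 4 + eps))%:E <= minimal_error W mu 1 n)%E.
Proof.
have [V hV [N [mN N0 VW]]] := continuous_version hW.
have [i ik jmp] := hjump.
have [c c0 hc] := monotone_lower_bound hV hmono hlip jmp.
(* The constant of the L1 bound serves both exponents, because [n >= 1] gives
   [n ^ (3/4) <= n ^ (3/4 + eps)]. *)
exists c => // n n1; set a := c / n%:R `^ (3 / 4).
have n1' : 1 <= n%:R :> R by rewrite ler1n.
have n0 : 0 < n%:R :> R := lt_le_trans ltr01 n1'.
have a0 : 0 < a by rewrite divr_gt0// powR_gt0.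
have errorE (tt : n.-tuple R) g w : (forall i, 0 <= tnth tt i <= 1) -> ~ N w ->
    `|occupation_integral W mu w - g [tuple W (tnth tt i) w | i < n]| =
    quadrature_error mu tt g V V w.
  move=> tt01 Nw; rewrite /quadrature_error /occupation_integral /drift_integral.
  congr `|_ - g _|.
    apply: eq_Rintegral => s; rewrite inE /= in_itv /= => s01.
    by rewrite VW.
  by apply: eq_from_tnth => j; rewrite !tnth_mktuple VW.
split; apply/ereal_infP => e [tt [g [tt01 mg ->]]]; rewrite expectation.unlock.
  have [mq hq] := hc n n1 tt g tt01 mg.
  have h2 := second_moment_ge mq (fun w => normr_ge0 _) (ltW a0) hq.
  have -> : a%:E = ((a ^+ 2)%:E `^ 2^-1)%E.
    by rewrite poweR_EFin powR12_sqrt ?sqr_ge0// sqrtr_sqr ger0_norm// ltW.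
  apply: gt0_ler_poweR; rewrite ?invr_ge0// ?in_itv /= ?leey ?andbT ?lee_fin ?sqr_ge0//.
    by apply: integral_ge0 => w _; rewrite lee_fin powR_ge0.
  apply: le_trans h2 _; apply: (le_integral_outside_null mN N0).
  - by apply/measurable_EFinP; exact: measurable_funX.
  - by move=> w; rewrite lee_fin sqr_ge0.
  - by move=> w; rewrite lee_fin powR_ge0.
  - by move=> w Nw; rewrite errorE// lee_fin powR_mulrn// normr_ge0.
have [mq hq] := hc n n1 tt g tt01 mg.
rewrite invr1 poweRe1; last by apply: integral_ge0 => w _; rewrite lee_fin powR_ge0.
apply: (@le_trans _ _ a%:E).
  rewrite lee_fin ler_pM2l// lef_pV2 ?posrE ?powR_gt0//.
  by apply: ler_powR => //; rewrite lerDl ltW.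
apply: le_trans hq _; apply: (le_integral_outside_null mN N0).
- exact/measurable_EFinP.
- by move=> w; rewrite lee_fin normr_ge0.
- by move=> w; rewrite lee_fin powR_ge0.
- by move=> w Nw; rewrite errorE// lee_fin powRr1// normr_ge0.
Qed.
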